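(* Let $G$ be a compact, simple, simply connected Lie group of rank $l$. For all integers $k\ge0$ the chain complex $(C_\bullet,\partial)$, $$C_p=\bigoplus_{|I|=p+1}\mathbb{Z}[\Lambda^*]^{W_I-\mathrm{as}}\ \Big(\cong\bigoplus_{|I|=p+1}R(\widehat G_I)_k\Big),\qquad \partial\phi^I=\sum_{r=0}^p(-1)^r\,\mathrm{Sk}_I^{\delta_rI}(\phi^I)\quad(\phi^I\in\mathbb{Z}[\Lambda^*]^{W_I-\mathrm{as}},\ |I|=p+1),$$ with the sum over nonempty subsets $I\subset\{0,\dots,l\}$, defines a resolution $$0\to C_l\xrightarrow{\partial}\cdots\xrightarrow{\partial}C_0\xrightarrow{\epsilon}R_k(G)\to0$$ of $R_k(G)$ as an $R(G)$-module (i.e. this is an exact sequence of $R(G)$-modules).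
   Context: **Lie theory.** $T\subset G$ is a maximal torus with Lie algebra $\mathfrak{t}$, $\Lambda=\ker(\exp\colon\mathfrak{t}\to T)$, $\Lambda^*=\mathrm{Hom}(\Lambda,\mathbb{Z})\subset\mathfrak{t}^*$ the weight lattice, $W$ the Weyl group. $B$ is the basic inner product (smallest length of a nonzero element of $\Lambda$ is $\sqrt2$), $B^\flat\colon\mathfrak{t}\to\mathfrak{t}^*$, $B^\sharp=(B^\flat)^{-1}$. $\alpha_1,\dots,\alpha_l$ are simple roots with coroots $\alpha_i^\vee$, $\alpha_0=-\alpha_{\max}$, $\rho$ the half-sum of positive roots, $\mathsf{h}^\vee=1+\langle\alpha_{\max},B^\sharp(\rho)\rangle$ the dual Coxeter number. $\Delta=\{\xi\in\mathfrak{t}:\langle\alpha_i,\xi\rangle+\delta_{i,0}\ge0,\ i=0,\dots,l\}$ is the alcove and $\Lambda^*_k=\Lambda^*\cap B^\flat(k\Delta)=\{\nu\in\Lambda^*:\langle\nu,\alpha_i^\vee\rangle+k\delta_{i,0}\ge0\ \forall i\}$. **Affine action.** The affine Weyl group $W_{\mathrm{aff}}$ is the Coxeter group generated by simple affine reflections $\sigma_0,\dots,\sigma_l$, with length function $\mathrm{length}$. At level $k+\mathsf{h}^\vee$ it acts on $\Lambda^*$, $\nu\mapsto w\bullet_{k+\mathsf{h}^\vee}\nu$, with $\sigma_i$ acting by $\nu\mapsto\nu-(\langle\nu,\alpha_i^\vee\rangle+(k+\mathsf{h}^\vee)\delta_{i,0})\alpha_i$. For nonempty $I\subset\{0,\dots,l\}$,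 $W_I\subset W_{\mathrm{aff}}$ is the (finite) subgroup generated by $\sigma_i$, $i\notin I$; $W_{\{0\}}=W$. $\mathbb{Z}[\Lambda^*]$ is the group ring, $\mathbb{Z}[[\Lambda^*]]$ the $\mathbb{Z}[\Lambda^*]$-module of all functions $\Lambda^*\to\mathbb{Z}$. The superscripts $W_I-\mathrm{as}$, $W_{\mathrm{aff}}-\mathrm{as}$ denote anti-invariants (elements transforming by $(-1)^{\mathrm{length}(w)}$) for the level $k+\mathsf{h}^\vee$ action. **Skew-symmetrizations.** $\mathrm{Sk}^I(\nu)=\sum_{w\in W_I}(-1)^{\mathrm{length}(w)}w\bullet_{k+\mathsf{h}^\vee}\nu$ and $\mathrm{Sk}_{\mathrm{aff}}(\nu)=\sum_{w\in W_{\mathrm{aff}}}(-1)^{\mathrm{length}(w)}w\bullet_{k+\mathsf{h}^\vee}\nu$, extended linearly to maps $\mathbb{Z}[\Lambda^*]\to\mathbb{Z}[\Lambda^*]^{W_I-\mathrm{as}}$ and $\mathbb{Z}[\Lambda^*]\to\mathbb{Z}[[\Lambda^*]]^{W_{\mathrm{aff}}-\mathrm{as}}$. For $J\subset I$, $\mathrm{Sk}_I^J=\frac{1}{|W_I|}\mathrm{Sk}^J\colon\mathbb{Z}[\Lambda^*]^{W_I-\mathrm{as}}\to\mathbb{Z}[\Lambda^*]^{W_J-\mathrm{as}}$ (integral-valued on anti-invariants). For $I=\{i_0<\dots<i_p\}$, $\delta_rI$ is $I$ with $i_r$ omitted; $\partial=0$ on $C_0$. **Modules.** $R(G)\cong\mathbb{Z}[\Lambda^*]^W$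 (usual linear $W$-action) acts on all these modules by multiplication. $R_k(G)=R(G)/I_k(G)$ is the level $k$ fusion ring, where $I_k(G)$ is the ideal of characters vanishing at all $t_\nu=\exp(\frac{1}{k+\mathsf{h}^\vee}B^\sharp(\nu+\rho))\in T$, $\nu\in\Lambda_k^*$. Additively it is free on the classes of $\chi_\mu$, $\mu\in\Lambda^*_k$, and as an $R(G)$-module it is identified with $\mathbb{Z}[[\Lambda^*]]^{W_{\mathrm{aff}}-\mathrm{as}}$ via $\chi_\mu\mapsto\mathrm{Sk}_{\mathrm{aff}}(\mu+\rho)$, $\mu\in\Lambda_k^*$. The map $\epsilon$ is, on the summand of $C_0$ for $I=\{i\}$, $\phi\mapsto\frac{1}{|W_{\{i\}}|}\mathrm{Sk}_{\mathrm{aff}}(\phi)$. **Representation-theoretic meaning.** Let $G_I\supset T$ be the centralizer in $G$ of $\exp(\Delta_I)$, where $\Delta_I\subset\Delta$ is the face where $\langle\alpha_i,\xi\rangle+\delta_{i,0}=0$ for all $i\notin I$. It has a canonical central extension $\widehat G_I$ by $U(1)$, with maximal torus $T\times U(1)$ and simple coroots $(\alpha_i^\vee,\delta_{i,0})$, $i\notin I$. $R(\widehat G_I)_k$ is the Grothendieck group of $\widehat G_I$-representations on which the central circle acts with weight $k$, with basis the irreducible characters $\chi^I_\mu$ of highest weight $(\mu,k)$, where $\langle\mu,\alpha_i^\vee\rangle+k\delta_{i,0}\ge0$ for $i\notin I$. The isomorphism $R(\widehat G_I)_k\cong\mathbb{Z}[\Lambda^*]^{W_I-\mathrm{as}}$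 is $\chi_\mu^I\mapsto\mathrm{Sk}^I(\mu+\rho)$; it carries holomorphic induction $R(\widehat G_I)_k\to R(\widehat G_J)_k$ to $\mathrm{Sk}_I^J$, so $\partial$ is the alternating sum of holomorphic induction maps. *)

(* Defs.v *)
From HB Require Import structures.
From mathcomp Require Import all_boot all_order all_algebra.
From mathcomp Require Import finmap.
From mathcomp Require Import all_classical all_reals all_analysis.
From mathcomp Require Import complex.

Set Implicit Arguments.
Unset Strict Implicit.
Unset Printing Implicit Defensive.

Import Order.TTheory GRing.Theory Num.Theory.
Local Open Scope ring_scope.

Section GroupRing.
Variable L : zmodType.

Definition grpring := {fsfun L -> int with 0}.
HB.instance Definition _ := Choice.on grpring.

Implicit Types (f g h : grpring) (u v : L -> int) (d : {fset L}).

Definition conv f u : L -> int :=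
  fun x => \sum_(y <- finsupp f) f y * u (x - y).

Lemma grpringP f g : (forall x, f x = g x) <-> f = g.
Proof. by split=> [H|->//]; apply/fsfunP. Qed.

Lemma fsfun_incl (V : zmodType) d f (F : L -> V) : (finsupp f `<=` d)%fset ->
  (forall y, f y = 0 -> F y = 0) ->
  \sum_(y <- finsupp f) F y = \sum_(y <- d) F y.
Proof.
move=> sfd F0; apply: big_fset_incl => // y _ yf.
by rewrite F0 // fsfun_dflt.
Qed.

Lemma convEw d f u x : (finsupp f `<=` d)%fset ->
  conv f u x = \sum_(y <- d) f y * u (x - y).
Proof. by move=> sfd; apply: fsfun_incl => // y ->; rewrite mul0r. Qed.

Definition gr0 : grpring := [fsfun].
Definition grN f : grpring := [fsfun x in finsupp f => - f x].
Definition grD f g : grpring :=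
  [fsfun x in (finsupp f `|` finsupp g)%fset => f x + g x].
Definition delta (x : L) : grpring := [fsfun y in [fset x]%fset => 1].
Definition grM f g : grpring :=
  [fsfun x in [fset (y + z)%R | y in finsupp f, z in finsupp g]%fset => conv f g x].

Lemma gr0E x : gr0 x = 0.
Proof. by rewrite fsfunE. Qed.

Lemma grNE f x : grN f x = - f x.
Proof. by rewrite fsfunE; case: finsuppP; rewrite ?oppr0. Qed.

Lemma grDE f g x : grD f g x = f x + g x.
Proof.
rewrite fsfunE in_fsetU.
by case: (finsuppP f); case: (finsuppP g); rewrite ?addr0.
Qed.

Lemma deltaE x y : delta x y = (x == y)%:R.
Proof. by rewrite fsfunE in_fset1 eq_sym; case: eqP. Qed.

Lemma grME f g x : grM f g x = conv f g x.
Proof.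
rewrite fsfunE; case: ifPn => // xP; rewrite /conv big_seq big1 // => y yf.
apply/eqP; rewrite mulf_eq0 orbC -[g _ == 0]negbK -mem_finsupp; apply/orP; left.
apply: contra xP => xyg; apply/imfset2P; exists y => //; exists (x - y) => //.
by rewrite addrC subrK.
Qed.

Lemma grDA : associative grD.
Proof. by move=> f g h; apply/grpringP => x; rewrite !grDE addrA. Qed.
Lemma grDC : commutative grD.
Proof. by move=> f g; apply/grpringP => x; rewrite !grDE addrC. Qed.
Lemma gr0D : left_id gr0 grD.
Proof. by move=> f; apply/grpringP => x; rewrite !grDE gr0E add0r. Qed.
Lemma grND : left_inverse gr0 grN grD.
Proof. by move=> f; apply/grpringP => x; rewrite grDE grNE gr0E addNr. Qed.

HB.instance Definition _ := GRing.isZmodule.Build grpring grDA grDC gr0D grND.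

Lemma gr_sumE (I : Type) (r : seq I) (P : pred I) (F : I -> grpring) x :
  (\sum_(i <- r | P i) F i) x = \sum_(i <- r | P i) F i x.
Proof.
by elim/big_rec2: _ => [|i y1 y2 _ <-]; [exact: gr0E | exact: grDE].
Qed.

Lemma finsupp_delta x : (finsupp (delta x) `<=` [fset x])%fset.
Proof.
apply/fsubsetP => y; rewrite mem_finsupp deltaE in_fset1 [x == y]eq_sym.
by case: (y == x).
Qed.

Lemma conv_delta x u y : conv (delta x) u y = u (y - x).
Proof.
by rewrite (convEw _ _ (finsupp_delta x)) big_seq_fset1 deltaE eqxx mul1r.
Qed.

Lemma convDl f g u x : conv (f + g) u x = conv f u x + conv g u x.
Proof.
pose d := (finsupp f `|` finsupp g)%fset.
rewrite !(@convEw d) ?fsubsetUl ?fsubsetUr //; last first.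
  apply/fsubsetP => z; rewrite mem_finsupp grDE in_fsetU.
  by case: (finsuppP f); case: (finsuppP g).
by rewrite -big_split; apply: eq_bigr => y _; rewrite grDE mulrDl.
Qed.

Lemma convA f g u x : conv (grM f g) u x = conv f (conv g u) x.
Proof.
pose d := [fset (y + z)%R | y in finsupp f, z in finsupp g]%fset.
rewrite (@convEw d); last first.
  apply/fsubsetP => z; rewrite mem_finsupp; apply: contraR => zd.
  by rewrite fsfunE (negbTE zd).
under eq_bigr => y _ do rewrite grME /conv mulr_suml.
rewrite exchange_big /= /conv; rewrite big_seq [RHS]big_seq.
apply: eq_bigr => y yf.
rewrite mulr_sumr.
pose F z := f y * (g z * u (x - y - z)).
rewrite (_ : \sum_(i <- d) _ = \sum_(i <- d) F (i - y)); last first.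
  by apply: eq_bigr => i _; rewrite /F mulrA opprB addrA subrK.
pose d' := [fset (i - y)%R | i in d]%fset.
transitivity (\sum_(z <- d') F z).
  by rewrite big_imfset //= => a b _ _ /addIr.
apply/esym/fsfun_incl => [|z gz]; last by rewrite /F gz mul0r mulr0.
apply/fsubsetP => z zg; apply/imfsetP; exists (y + z); last by rewrite addrC addKr.
by apply/imfset2P; exists y => //; exists z.
Qed.

Lemma grMA : associative grM.
Proof.
move=> f g h; apply/grpringP => x; rewrite [RHS]grME convA grME.
by apply: eq_bigr => y _; rewrite grME.
Qed.

Lemma grMC : commutative grM.
Proof.
move=> f g; apply/grpringP => x; rewrite !grME.
pose d := (finsupp f `|` [fset (x - y)%R | y in finsupp g])%fset.
rewrite (@convEw d) ?fsubsetUl //.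
rewrite (@convEw [fset (x - y)%R | y in d]%fset); last first.
  apply/fsubsetP => z zg; apply/imfsetP; exists (x - z); last by rewrite subKr.
  by rewrite in_fsetU; apply/orP; right; apply/imfsetP; exists z.
rewrite [RHS]big_imfset /=; last first.
  by move=> a b _ _ /= E; rewrite -(subKr x a) E subKr.
by apply: eq_bigr => y _; rewrite subKr mulrC.
Qed.

Lemma gr1M : left_id (delta 0) grM.
Proof. by move=> f; apply/grpringP => x; rewrite grME conv_delta subr0. Qed.

Lemma grMDl : left_distributive grM grD.
Proof. by move=> f g h; apply/grpringP => x; rewrite grDE !grME convDl. Qed.

Lemma gr1_neq0 : delta 0 != 0 :> grpring.
Proof. by apply/eqP => /(congr1 (fun f => f 0)); rewrite deltaE eqxx gr0E. Qed.

HB.instance Definition _ := GRing.Zmodule_isComNzRing.Build grpring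
  grMA grMC gr1M grMDl gr1_neq0.

Lemma sum_finsupp_eval (S : comNzRingType) (e : L -> S) f d :
  (finsupp f `<=` d)%fset ->
  \sum_(y <- finsupp f) (f y)%:~R * e y = \sum_(y <- d) (f y)%:~R * e y.
Proof. by move=> sfd; apply: fsfun_incl => // y ->; rewrite mul0r. Qed.

Definition gr_eval (S : comNzRingType) (e : L -> S) f : S :=
  \sum_(y <- finsupp f) (f y)%:~R * e y.

Lemma gr_evalB (S : comNzRingType) (e : L -> S) f g :
  gr_eval e (f - g) = gr_eval e f - gr_eval e g.
Proof.
pose d := (finsupp f `|` finsupp g)%fset.
rewrite /gr_eval !(@sum_finsupp_eval _ _ _ d) ?fsubsetUl ?fsubsetUr //; last first.
  apply/fsubsetP => z; rewrite mem_finsupp grDE grNE in_fsetU.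
  by case: (finsuppP f); case: (finsuppP g); rewrite ?oppr0.
by rewrite -sumrB; apply: eq_bigr => y _; rewrite grDE grNE rmorphB mulrBl.
Qed.

Lemma gr_eval1 (S : comNzRingType) (e : L -> S) : e 0 = 1 -> gr_eval e 1 = 1.
Proof.
move=> e0; rewrite /gr_eval (sum_finsupp_eval _ (finsupp_delta 0)).
by rewrite big_seq_fset1 deltaE eqxx e0 mulr1.
Qed.

Lemma gr_evalM (S : comNzRingType) (e : L -> S) f g :
  {morph e : x y / x + y >-> x * y} ->
  gr_eval e (f * g) = gr_eval e f * gr_eval e g.
Proof.
move=> eD; pose d := [fset (y + z)%R | y in finsupp f, z in finsupp g]%fset.
rewrite {1}/gr_eval (@sum_finsupp_eval _ _ _ d); last first.
  apply/fsubsetP => z; rewrite mem_finsupp; apply: contraR => zd.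
  by rewrite fsfunE (negbTE zd).
under eq_bigr => x _ do rewrite grME /conv rmorph_sum mulr_suml.
rewrite exchange_big /= mulr_suml big_seq [RHS]big_seq.
apply: eq_bigr => y yf.
rewrite {1}/gr_eval mulr_sumr.
pose F z := (f y)%:~R * e y * ((g z)%:~R * e z).
rewrite (_ : \sum_(i <- d) _ = \sum_(i <- d) F (i - y)); last first.
  by apply: eq_bigr => i _; rewrite /F mulrACA -eD [y + _]addrC subrK rmorphM.
pose d' := [fset (i - y)%R | i in d]%fset.
transitivity (\sum_(z <- d') F z).
  by rewrite big_imfset //= => a b _ _ /addIr.
apply/esym/fsfun_incl => [|z gz]; last by rewrite /F gz mul0r mulr0.
apply/fsubsetP => z zg; apply/imfsetP; exists (y + z); last by rewrite addrC addKr.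
by apply/imfset2P; exists y => //; exists z.
Qed.

End GroupRing.

Definition pairing (S : pzRingType) l (mu : 'rV[S]_l) (xi : 'cV[S]_l) : S :=
  (mu *m xi) 0 0.

(* A semisimple compact connected Lie group of rank l is encoded by its root
   datum: Lambda = ker exp is identified with the column vectors Z^l, its dual
   Lambda^* with the row vectors, and t = Lambda (x) R with 'cV[R]_l. *)
Record root_datum (l : nat) := RootDatum {
  roots : seq 'rV[int]_l;
  coroot : 'rV[int]_l -> 'cV[int]_l;
  roots_uniq : uniq roots;
  coroot_inj : {in roots &, injective coroot};
  pairing_coroot : {in roots, forall a, pairing a (coroot a) = 2};
  roots_reflect : {in roots &, forall a b,
    b - pairing b (coroot a) *: a \in roots};
  coroots_reflect : {in roots &, forall a b,
    coroot b - pairing a (coroot b) *: coroot a \in map coroot roots};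
  roots_reduced : {in roots, forall a, a *+ 2 \notin roots} }.

(* pi_1 of the group is Lambda modulo the coroot lattice. In particular the
   coroots, hence the roots, have rank l, so the group is semisimple. *)
Definition simply_connected l (G : root_datum l) :=
  forall xi : 'cV[int]_l, exists c : 'rV[int]_l -> int,
    xi = \sum_(a <- roots G) c a *: coroot G a.

Definition simple_group l (G : root_datum l) :=
  roots G <> [::] /\
  forall P : pred 'rV[int]_l, (exists2 a, a \in roots G & P a) ->
    {in roots G &, forall a b, P a -> ~~ P b -> pairing a (coroot G b) = 0} ->
    {in roots G, forall a, P a}.

Definition nonneg_comb l (s : 'I_l -> 'rV[int]_l) (mu : 'rV[int]_l) :=
  exists c : 'I_l -> nat, mu = \sum_i s i *+ c i.

Definition bform (R : pzRingType) l (B : 'M[R]_l) (xi eta : 'cV[R]_l) : R :=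
  (xi^T *m B *m eta) 0 0.

Definition bsharp (R : fieldType) l (B : 'M[R]_l) (mu : 'rV[R]_l) : 'cV[R]_l :=
  (mu *m invmx B)^T.

Definition coreflection (R : pzRingType) l (G : root_datum l)
    (a : 'rV[int]_l) (xi : 'cV[R]_l) : 'cV[R]_l :=
  xi - pairing (map_mx intr a) xi *: map_mx intr (coroot G a).

(* The choice of simple roots, together with the data that it determines (the
   basic inner product B does not depend on it). *)
Record lie_data (R : realType) l (G : root_datum l) := LieData {
  simple_root : 'I_l -> 'rV[int]_l;
  alpha_max : 'rV[int]_l;
  rho : 'rV[int]_l;
  basic : 'M[R]_l;
  dual_coxeter : nat;
  simple_root_in : forall i, simple_root i \in roots G;
  simple_root_base : {in roots G, forall b,
    nonneg_comb simple_root b \/ nonneg_comb simple_root (- b)};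
  alpha_max_in : alpha_max \in roots G;
  alpha_max_highest : {in roots G, forall b,
    nonneg_comb simple_root (alpha_max - b)};
  rho_half_sum : rho *+ 2 =
    \sum_(b <- roots G | `[< nonneg_comb simple_root b >]) b;
  basic_sym : basic^T = basic;
  basic_pos : forall xi, xi != 0 -> 0 < bform basic xi xi;
  basic_inv : {in roots G, forall a, forall xi eta,
    bform basic (coreflection G a xi) (coreflection G a eta) =
    bform basic xi eta};
  basic_min : forall xi : 'cV[int]_l, xi != 0 ->
    2 <= bform basic (map_mx intr xi) (map_mx intr xi);
  basic_min_attained : exists2 xi : 'cV[int]_l, xi != 0 &
    bform basic (map_mx intr xi) (map_mx intr xi) = 2;
  dual_coxeterE : dual_coxeter%:R =
    1 + pairing (map_mx intr alpha_max) (bsharp basic (map_mx intr rho)) }.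

(* Z[Lambda^*] and Z[[Lambda^*]], with the structure of R(G)-modules below *)
Definition grmod l (G : root_datum l) := grpring 'rV[int]_l.
HB.instance Definition _ l (G : root_datum l) := GRing.Zmodule.on (grmod G).

Definition grseries l (G : root_datum l) := 'rV[int]_l -> int.
HB.instance Definition _ l (G : root_datum l) := GRing.Zmodule.on (grseries G).

Section Representations.
Variables (l : nat) (G : root_datum l).
Local Notation L := 'rV[int]_l.

Definition reflection (a x : L) : L := x - pairing x (coroot G a) *: a.

Lemma pairingB (x y : L) xi : pairing (x - y) xi = pairing x xi - pairing y xi.
Proof. by rewrite /pairing mulmxBl !mxE. Qed.

Lemma pairingZ c (x : L) xi : pairing (c *: x) xi = c * pairing x xi.
Proof. by rewrite /pairing -scalemxAl !mxE. Qed.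

Lemma reflectionB a x y : reflection a (x - y) = reflection a x - reflection a y.
Proof. by rewrite /reflection pairingB scalerBl opprD addrACA -opprD. Qed.

Lemma reflectionK a : a \in roots G -> involutive (reflection a).
Proof.
move=> aG x; rewrite /reflection pairingB pairingZ (pairing_coroot aG).
set c := pairing x _; rewrite -addrA -opprD -scalerDl.
by rewrite (_ : c + (c - c * 2) = 0) ?scale0r ?subr0 // addrA -mulr2n mulr_natr subrr.
Qed.

Lemma reflection0 a : reflection a 0 = 0.
Proof. by rewrite -{1}(subrr 0) reflectionB subrr. Qed.

(* W is generated by all root reflections. *)
Definition winv : {pred grpring L} := fun f =>
  `[< {in roots G, forall a, forall x, f (reflection a x) = f x} >].

Lemma winv_subring : subring_closed winv.
Proof.
split=> [|f g /asboolP Hf /asboolP Hg|f g /asboolP Hf /asboolP Hg];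
  apply/asboolP => a aG x.
- rewrite !deltaE; congr (_ %:R); congr nat_of_bool.
  by rewrite -(inj_eq (inv_inj (reflectionK aG))) reflection0 reflectionK.
- by rewrite !grDE !grNE Hf ?Hg.
- rewrite !grME /conv.
  rewrite [LHS](@convEw _ [fset reflection a y | y in finsupp f]%fset); last first.
    apply/fsubsetP => y yf; apply/imfsetP; exists (reflection a y).
      by rewrite mem_finsupp Hf // -mem_finsupp.
    by rewrite reflectionK.
  rewrite big_imfset /=; last by move=> y z _ _; exact: (inv_inj (reflectionK aG)).
  by apply: eq_bigr => y _; rewrite -reflectionB !(Hf, Hg).
Qed.

HB.instance Definition _ := GRing.isSubringClosed.Build _ winv winv_subring.

(* R(G) = Z[Lambda^*]^W *)
Record rep_ring := RepRing { rep_val :> grpring L; _ : rep_val \in winv }.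
HB.instance Definition _ := [isSub for rep_val].
HB.instance Definition _ := [Choice of rep_ring by <:].
HB.instance Definition _ := [SubChoice_isSubComNzRing of rep_ring by <:].


Definition grscale (chi : rep_ring) (f : grmod G) : grmod G :=
  (rep_val chi : grpring L) * (f : grpring L).

Fact grscaleA a b f : grscale a (grscale b f) = grscale (a * b) f.
Proof. exact: mulrA. Qed.
Fact grscale1 : left_id 1 grscale.
Proof. exact: mul1r. Qed.
Fact grscaleDr : right_distributive grscale +%R.
Proof. by move=> a f g; exact: mulrDr. Qed.
Fact grscaleDl f : {morph grscale^~ f : a b / a + b}.
Proof. by move=> a b; exact: mulrDl. Qed.

HB.instance Definition _ := GRing.Zmodule_isLmodule.Build rep_ring (grmod G)
  grscaleA grscale1 grscaleDr grscaleDl.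


Definition sscale (chi : rep_ring) (u : grseries G) : grseries G := conv chi u.

Fact sscaleA a b u : sscale a (sscale b u) = sscale (a * b) u.
Proof. by apply/funext => x; rewrite /sscale -convA. Qed.
Fact sscale1 : left_id 1 sscale.
Proof. by move=> u; apply/funext => x; rewrite /sscale conv_delta subr0. Qed.
Fact sscaleDr : right_distributive sscale +%R.
Proof.
move=> a u v; apply/funext => x; rewrite /sscale /conv !fctE -big_split.
by apply: eq_bigr => y _; rewrite mulrDr.
Qed.
Fact sscaleDl u : {morph sscale^~ u : a b / a + b}.
Proof. by move=> a b; apply/funext => x; exact: convDl. Qed.

HB.instance Definition _ := GRing.Zmodule_isLmodule.Build rep_ring (grseries G)
  sscaleA sscale1 sscaleDr sscaleDl.

End Representations.

Section AffineWeylGroup.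
Variables (R : realType) (l : nat) (G : root_datum l) (D : lie_data R G).
Local Notation L := 'rV[int]_l.

(* The index set {0, ..., l} is 'I_l.+1, with alpha_0 = - alpha_max. *)
Definition aroot (i : 'I_l.+1) : L :=
  if unlift ord0 i is Some j then simple_root D j else - alpha_max D.

(* <nu, alpha_i^vee> + n delta_{i,0} *)
Definition apairing (n : int) (i : 'I_l.+1) (nu : L) : int :=
  pairing nu (coroot G (aroot i)) + n *+ (i == ord0).

Definition dominant (I : {set 'I_l.+1}) (n : int) (mu : L) : Prop :=
  forall i, i \notin I -> 0 <= apairing n i mu.

(* Lambda^*_k *)
Definition level_weight (k : nat) (mu : L) : Prop := dominant finset.set0 k%:Z mu.

Definition asigma (i : 'I_l.+1) (n : int) (nu : L) : L :=
  nu - apairing n i nu *: aroot i.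

Definition word_act (s : seq 'I_l.+1) (n : int) (nu : L) : L :=
  foldr (fun i => asigma i n) nu s.

(* An element w of W_aff is represented by the family of its actions at all
   levels, w n nu being w \bullet_n nu; equivalently by its linear action on
   Lambda^* (+) Z, which is faithful (already on each level n != 0). *)
Definition waff := {w : int -> L -> L | `[< exists s, w = word_act s >]}.

Lemma waff_word (w : waff) :
  exists r, `[< exists2 s, size s = r & val w = word_act s >].
Proof.
by have /asboolP[s ws] := valP w; exists (size s); apply/asboolP; exists s.
Qed.

Definition wlength (w : waff) : nat := ex_minn (waff_word w).

Definition wsign (w : waff) : int := (-1) ^+ wlength w.

Definition parabolic (I : {set 'I_l.+1}) : set waff :=
  [set w | exists2 s, all (fun i => i \notin I) s & val w = word_act s].

Definition parabolic_order (I : {set 'I_l.+1}) : nat :=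
  #|` fset_set (parabolic I)|.

(* Z[Lambda^*]^{W_I - as} and Z[[Lambda^*]]^{W_aff - as} at level n; as
   (w f)(w nu) = f nu, anti-invariance reads f (w nu) = (-1)^length(w) f nu. *)
Definition antiinv (I : {set 'I_l.+1}) (n : int) : set (grmod G) :=
  [set f | forall w, parabolic I w ->
    forall nu, f (val w n nu) = wsign w * f nu].

Definition aff_antiinv (n : int) : set (grseries G) :=
  [set u | forall (w : waff) nu, u (val w n nu) = wsign w * u nu].

Definition sk_wt (I : {set 'I_l.+1}) (n : int) (nu : L) : grpring L :=
  \sum_(w \in parabolic I) delta (val w n nu) *~ wsign w.

Definition sk (I : {set 'I_l.+1}) (n : int) (f : grmod G) : grmod G :=
  \sum_(nu <- finsupp f) sk_wt I n nu *~ f nu.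

(* Pointwise, the sum over W_aff has finite support for n != 0. *)
Definition sk_aff_wt (n : int) (nu : L) : grseries G := fun x =>
  \sum_(w \in [set: waff]) wsign w *+ (val w n nu == x).

Definition sk_aff (n : int) (f : grmod G) : grseries G := fun x =>
  \sum_(nu <- finsupp f) f nu * sk_aff_wt n nu x.

(* Sk_I^J; the integer division is exact on W_I-anti-invariants. *)
Definition sk_ind (I J : {set 'I_l.+1}) (n : int) (f : grmod G) : grmod G :=
  [fsfun nu in finsupp (sk J n f) => (sk J n f nu %/ parabolic_order I)%Z].

Definition chain := {ffun {set 'I_l.+1} -> grmod G}.

Definition chains (n : int) (p : nat) : set chain :=
  [set c | forall I : {set 'I_l.+1},
    if #|I| == p.+1 then antiinv I n (c I) else c I = 0].

(* enum_val r is the r-th element of I in increasing order. *)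
Definition face (I : {set 'I_l.+1}) (r : 'I_#|I|) : {set 'I_l.+1} :=
  I :\ enum_val r.

Definition boundary (n : int) (c : chain) : chain :=
  [ffun J => \sum_(I : {set 'I_l.+1} | (1 < #|I|)%N)
             \sum_(r < #|I| | face r == J) sk_ind I J n (c I) *~ (-1) ^+ r].

Definition augmentation (n : int) (c : chain) : grseries G := fun x =>
  \sum_i (sk_aff n (c [set i]) x %/ parabolic_order [set i])%Z.

(* Characters of \hat G_I on which the central circle acts with weight k: the
   W_I-invariants for the level k action. *)
Definition rep_level (I : {set 'I_l.+1}) (k : int) : set (grmod G) :=
  [set f | forall w, parabolic I w -> forall nu, f (val w k nu) = f nu].

(* chi is the irreducible character of \hat G_I of highest weight (mu, k), by
   the Weyl character formula: (rho, h^vee) pairs to 1 with each simple coroot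
   (alpha_i^vee, delta_{i,0}), so it plays the role of rho for \hat G_I. For
   I = {0} this is chi_mu in R(G), for any k. *)
Definition irr_char (I : {set 'I_l.+1}) (k : int) (mu : L) (chi : grpring L) :=
  rep_level I k chi /\
  chi * sk_wt I (dual_coxeter D)%:Z (rho D) =
  sk_wt I (k + (dual_coxeter D)%:Z) (mu + rho D).

End AffineWeylGroup.

Section FusionRing.
Variables (R : realType) (l : nat) (G : root_datum l) (D : lie_data R G).
Variable k : nat.
Local Notation L := 'rV[int]_l.

(* e^mu (exp xi) = exp (2 pi i <mu, xi>) *)
Definition torus_char (xi : 'cV[R]_l) (mu : L) : R[i] :=
  let x := 2 * pi * pairing (map_mx intr mu) xi in (cos x +i* sin x)%C.

(* t_nu = exp (fusion_point nu) *)
Definition fusion_point (nu : L) : 'cV[R]_l :=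
  ((k + dual_coxeter D)%:R)^-1 *: bsharp (basic D) (map_mx intr (nu + rho D)).

Definition fusion_ideal : {pred rep_ring G} := fun chi =>
  `[< forall nu, level_weight D k nu ->
      gr_eval (torus_char (fusion_point nu)) (rep_val chi) = 0 >].

Lemma torus_char0 xi : torus_char xi 0 = 1.
Proof.
by rewrite /torus_char /pairing map_mx0 mul0mx mxE mulr0 cos0 sin0.
Qed.

Lemma torus_charD xi : {morph torus_char xi : x y / x + y >-> x * y}.
Proof.
move=> x y; rewrite /torus_char /pairing map_mxD mulmxDl mxE mulrDr cosD sinD.
by apply/eqP; rewrite eq_complex /= eqxx /= [X in _ == X + _]mulrC addrC mulrC.
Qed.

Lemma fusion_ideal_closed : idealr_closed fusion_ideal.
Proof.
split.
- apply/asboolP => nu _; rewrite /gr_eval big_seq big1 // => y.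
  by rewrite mem_finsupp gr0E eqxx.
- have lw0 : level_weight D k 0.
    by move=> i _; rewrite /apairing /pairing mul0mx mxE add0r mulrn_wge0.
  apply/asboolP => /(_ 0 lw0); rewrite gr_eval1 ?torus_char0 //.
  exact/eqP/oner_neq0.
- move=> a u v /asboolP Hu /asboolP Hv; apply/asboolP => nu Hnu.
  have E : rep_val (a * u + v) = rep_val a * rep_val u + rep_val v by [].
  rewrite E -[rep_val v]opprK gr_evalB -[- rep_val v]sub0r gr_evalB.
  rewrite gr_evalM ?Hu ?Hv //; last exact: torus_charD.
  rewrite mulr0 /gr_eval big_seq big1 ?subrr // => y.
  by rewrite mem_finsupp gr0E eqxx.
Qed.

HB.instance Definition _ := isIdealr.Build _ fusion_ideal fusion_ideal_closed.

(* R_k(G) = R(G) / I_k(G) *)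
Definition fusion_ring := {ideal_quot fusion_ideal}.
HB.instance Definition _ := GRing.ComNzRing.on fusion_ring.

Definition fusion_class (chi : rep_ring G) : fusion_ring :=
  (\pi_{ideal_quot fusion_ideal} chi)%qT.

Definition fscale (chi : rep_ring G) (x : fusion_ring) : fusion_ring :=
  fusion_class chi * x.

Fact fscaleA a b x : fscale a (fscale b x) = fscale (a * b) x.
Proof. by rewrite /fscale mulrA; congr (_ * x); exact/esym/Quotient.pi_mul. Qed.
Fact fscale1 : left_id 1 fscale.
Proof.
move=> x; rewrite /fscale (_ : fusion_class 1 = 1) ?mul1r //.
by rewrite -[RHS]/(Quotient.one _); unlock Quotient.one. Qed.
Fact fscaleDr : right_distributive fscale +%R.
Proof. by move=> a x y; rewrite /fscale mulrDr. Qed.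
Fact fscaleDl x : {morph fscale^~ x : a b / a + b}.
Proof. by move=> a b; rewrite /fscale /fusion_class rmorphD mulrDl. Qed.

HB.instance Definition _ := GRing.Zmodule_isLmodule.Build (rep_ring G) fusion_ring
  fscaleA fscale1 fscaleDr fscaleDl.

End FusionRing.

Section Exactness.
Variables (S : nzRingType) (U V W : lmodType S).

Definition submodule (M : set U) : Prop :=
  M 0 /\ forall a x y, M x -> M y -> M (a *: x + y).

Definition linear_on (M : set U) (N : set V) (f : U -> V) : Prop :=
  (forall x, M x -> N (f x)) /\
  forall a x y, M x -> M y -> f (a *: x + y) = a *: f x + f y.

Definition exact_at (M : set U) (f : U -> V) (N : set V) (g : V -> W) : Prop :=
  [set y | N y /\ g y = 0]%classic = (f @` M)%classic.

End Exactness.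

(* Main.v *)
Require Import Defs.
From HB Require Import structures.
From mathcomp Require Import all_boot all_order all_algebra.
From mathcomp Require Import finmap.
From mathcomp Require Import all_classical all_reals all_analysis.
From mathcomp Require Import complex.
From mathcomp Require Import ring lra zify.
Import Order.TTheory GRing.Theory Num.Theory.
Local Open Scope ring_scope.
Set Implicit Arguments.
Unset Strict Implicit.
Unset Printing Implicit Defensive.

(** Weights are filtered by their distance to an interior point of the alcove.
    On the graded pieces the boundary becomes, weight by weight, that of a cone
    of simplices, which is contractible.

    An anti-invariant of W_I vanishes on the walls of the I-chambers and is
    determined by its values in the open I-chamber (antif_ext). In these terms
    Sk_I^J is the operator ind: it sums f over the elements of W_J that move a
    weight into the open I-chamber, one in each coset of W_I (asum_ind). This
    shows integrality, and the transitivity of ind together with a sign rule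
    shows that the boundary squares to 0. The same formula with J empty is the
    augmentation, so that exactness at C_0 is the same statement about the
    operator dE as exactness at the other C_p (exact_chain).

    The filtration is by weyl_dist, the squared distance to the point n rho / h
    of the alcove, where h is the dual Coxeter number and n = k + h. On leading
    terms, ind is the identity (ind_top): a nontrivial element of W_I moves a
    weight of the open I-chamber strictly away from that point. So the top
    layer of a cycle is a family, indexed by the weights x, of simplicial
    chains of those I that contain all the indices along which x is not
    strictly dominant. Some index is not among those, because a positive
    combination of the simple affine coroots takes the value n > 0 up to a
    positive factor (apairing_pos). The cone with this index as apex contracts
    the layer, and induction on the radius of the support finishes
    (kill_top_layer).

    These facts rest on the combinatorics of the affine Weyl group W_aff as a
    group of words in the simple reflections: affine roots are nonnegative or
    nonpositive combinations of the simple ones, the exchange property follows,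
    and along a reduced word a dominant weight always moves away from its
    chamber (reduced_mono). That rho has pairing 1 with all simple affine
    coroots at level h needs that the coroot of the highest root has B-norm 2
    (bnorm_theta), which is where the normalization of the basic inner product
    enters.

    The isomorphism of R(G_I)_k with the anti-invariants is multiplication by
    the Weyl denominator. It is injective because the denominator has a leading
    term, and surjective because products of orbit sums with the denominator
    have leading terms that exhaust the open chamber (weyl_den_conv_surj).

    Finally chi maps to chi Sk_aff(rho) from R(G) to the anti-invariant series.
    It sends an irreducible character to the skew-symmetrization of its shifted
    highest weight (irr_char_series), hence is onto. Pairing such a series with
    the skew-symmetrized character wsum x multiplies by the value of chi at the
    point of T attached to x (wsum_fusion_series). The matrix of the numbers
    wsum x z is invertible with no zero in the column of rho, by linear
    independence of characters (wsum_indep, wsum_rho_neq0); so the kernel is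
    the fusion ideal, and the quotient is R_k(G). *)

Local Notation roots := Defs.roots.
Local Notation conv := Defs.conv.

(** * Finite sums, group rings and characters of groups *)

Lemma fsum_split (T : choiceType) (P : set T) (F1 F2 : T -> int) :
  finite_set (P `&` [set t | F1 t != 0])%classic ->
  finite_set (P `&` [set t | F2 t != 0])%classic ->
  \sum_(t \in P) (F1 t + F2 t) = \sum_(t \in P) F1 t + \sum_(t \in P) F2 t.
Proof.
set A1 := (P `&` _)%classic; set A2 := (P `&` _)%classic => A1f A2f.
pose A := (A1 `|` A2)%classic.
have AP : (A `<=` P)%classic by move=> t [[]|[]].
have out t : (P `\` A)%classic t -> F1 t = 0 /\ F2 t = 0.
  move=> [Pt At]; split; apply/eqP; apply: contrapT => /negP Ft; apply: At.
    by left.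
  by right.
rewrite -!(fsbig_widen _ _ _ AP) //.
- by rewrite fsbig_split // finite_setU.
- by move=> t /out[].
- by move=> t /out[].
- by move=> t /out[/= -> ->]; rewrite addr0.
Qed.

Lemma fsum_seq (K : eqType) (r : seq K) (T : choiceType) (P : set T) (F : K -> T -> int) :
  (forall i, i \in r -> finite_set (P `&` [set t | F i t != 0])%classic) ->
  \sum_(t \in P) \sum_(i <- r) F i t = \sum_(i <- r) \sum_(t \in P) F i t.
Proof.
elim: r => [|i r IH] Hf.
  by rewrite big_nil fsbig1 // => t _; rewrite big_nil.
rewrite big_cons -IH; last by move=> j jr; apply: Hf; rewrite inE jr orbT.
rewrite -fsum_split.
- by apply: eq_fsbigr => t _; rewrite big_cons.
- by apply: Hf; rewrite mem_head.
have : finite_set (\bigcup_(j in [set` r]) (P `&` [set t | F j t != 0]))%classic.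
  apply: bigcup_finite => [|j jr]; first exact: finite_seq.
  by apply: Hf; rewrite inE; apply/orP; right.
apply: sub_finite_set => t [Pt /= Ft].
have [j jr Fj] : exists2 j, j \in r & F j t != 0.
  apply: contrapT => H; move/eqP: Ft; apply; rewrite big_seq big1 // => j jr.
  by apply/eqP; apply: contrapT => /negP Fj; apply: H; exists j.
by exists j.
Qed.

(** This turns the position of an element of a set, on which the sign of a face
    depends, into a count. *)
Lemma rank_enum_val m (A : {set 'I_m}) (r : 'I_#|A|) :
  #|[set j in A | (j < enum_val r)%N]| = r.
Proof.
pose s := map val (enum A).
have ss : sorted ltn s.
  rewrite /s /enum_mem sorted_map sorted_filter //.
    by move=> i j k; exact: ltn_trans.
  by rewrite -(@sorted_map _ _ val ltn) -enumT val_enum_ord iota_ltn_sorted.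
have rs : (r < size s)%N by rewrite size_map -cardE.
have C (x : 'I_m) : #|[set j in A | (j < x)%N]| = count (fun j : 'I_m => (j < x)%N) (enum A).
  rewrite cardE /enum_mem size_filter count_filter; apply: eq_count => j.
  by rewrite !inE andbC.
have x0 : 'I_m := enum_val r.
have E : nth 0%N s r = enum_val r.
  by rewrite (nth_map x0) -?cardE // (enum_val_nth x0).
have := @count_lt_nth _ nat 0%N s r ss rs; rewrite E count_map => Er.
by rewrite C -[RHS]Er; apply: eq_count.
Qed.

Lemma gr_mulzE (L : zmodType) (f : grpring L) (c : int) x : (f *~ c) x = c * f x.
Proof.
have natE (k : nat) : (f *+ k) x = f x *+ k.
  elim: k => [|k IH]; first by rewrite !mulr0n gr0E.
  by rewrite !mulrS grDE IH.
case: c => k; first by rewrite -pmulrn natE -mulr_natl natz.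
by rewrite NegzE mulrNz grNE -pmulrn natE -mulr_natl natz mulNr.
Qed.

Lemma convZr (L : zmodType) (chi : grpring L) (c : int) f x :
  conv chi (fun y => c * f y) x = c * conv chi f x.
Proof. by rewrite /conv mulr_sumr; apply: eq_bigr => y _; rewrite mulrCA. Qed.

Lemma conv_fsumr (L : zmodType) (K : eqType) (r : seq K) (chi : grpring L) (c : K -> int)
    (F : K -> L -> int) x :
  conv chi (fun y => \sum_(k <- r) c k * F k y) x = \sum_(k <- r) c k * conv chi (F k) x.
Proof.
rewrite /conv; under eq_bigr do rewrite mulr_sumr.
rewrite exchange_big /=; apply: eq_bigr => k _; rewrite mulr_sumr.
by apply: eq_bigr => y _; rewrite mulrCA.
Qed.

Lemma cos_sin_int (R : realType) (m : int) :
  cos (2 * pi * m%:~R) = 1 :> R /\ sin (2 * pi * m%:~R) = 0 :> R.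
Proof.
have H (p : nat) : cos (2 * pi * p%:R) = 1 :> R /\ sin (2 * pi * p%:R) = 0 :> R.
  elim: p => [|p [IHc IHs]]; first by rewrite mulr0 cos0 sin0.
  have E : 2 * pi * p.+1%:R = 2 * pi * p%:R + pi *+ 2 :> R.
    by rewrite -[p.+1%:R]natr1 mulrDr mulr1 mulr_natl.
  by rewrite E (cosD (2 * pi * _)) (sinD (2 * pi * _)) IHc IHs cos2pi sin2pi; split; ring.
case: m => p; first by rewrite -pmulrn.
rewrite NegzE mulrNz mulrN cosN sinN -pmulrn.
by have [-> ->] := H p.+1; rewrite oppr0.
Qed.

Lemma cos_eq1 (R : realType) (x : R) : 0 <= x < 1 -> cos (2 * pi * x) = 1 -> x = 0.
Proof.
move=> /andP[x0 x1] c1; apply/eqP; rewrite eq_le x0 andbT leNgt; apply/negP => xp.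
have : 0 < sin (pi * x).
  by apply: sin_gt0_pi; rewrite mulr_gt0 ?pi_gt0 //= gtr_pMr ?pi_gt0.
have E : 2 * pi * x = (pi * x) *+ 2 by rewrite -mulrA mulr_natl.
move: c1; rewrite E cos_mulr2n => c1.
have := cos2Dsin2 (pi * x); have := sqr_ge0 (sin (pi * x)).
move: c1; set c := cos _ ^+ 2; set s := sin _ => c1 s0 cs sp.
have : s ^+ 2 = 0 by rewrite mulr2n in c1; lra.
by move/eqP; rewrite sqrf_eq0 gt_eqF.
Qed.

(** Dedekind's argument: comparing the relation with its translate by an
    element that distinguishes two characters eliminates one of them. *)
Lemma characters_indep (F : fieldType) (A : zmodType) (K : eqType) (psi : K -> A -> F)
    (r : seq K) (a : K -> F) :
  (forall i (x y : A), psi i (x + y) = psi i x * psi i y) -> (forall i, psi i 0 = 1) ->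
  uniq r -> (forall i j, i \in r -> j \in r -> (forall x : A, psi i x = psi j x) -> i = j) ->
  (forall x : A, \sum_(i <- r) a i * psi i x = 0) -> forall i, i \in r -> a i = 0.
Proof.
move=> psiD psi0; elim: r a => // i r IH a /= /andP[ir ur] inj S0.
have ar j : j \in r -> a j = 0.
  move=> jr; have [y yij] : exists y : A, psi j y != psi i y.
    apply: contrapT => H; move: ir; rewrite (inj i j) ?jr ?mem_head ?inE ?jr ?orbT //.
    by move=> y; apply/eqP; apply: contrapT => /negP H'; apply: H; exists y; rewrite eq_sym.
  have : a j * (psi j y - psi i y) = 0.
    apply: (IH (fun j => a j * (psi j y - psi i y))) jr => //.
      by move=> u v uR vR; apply: inj; rewrite inE ?uR ?vR orbT.
    move=> x; have := S0 (x + y); have := S0 x; rewrite !big_cons => Sx Sxy.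
    have Ex : \sum_(t <- r) a t * psi t x = - (a i * psi i x).
      by apply/eqP; rewrite -addr_eq0 addrC Sx.
    have Exy : \sum_(t <- r) a t * psi t (x + y) = - (a i * psi i (x + y)).
      by apply/eqP; rewrite -addr_eq0 addrC Sxy.
    transitivity (\sum_(t <- r) a t * psi t (x + y) - (\sum_(t <- r) a t * psi t x) * psi i y).
      by rewrite mulr_suml -sumrB; apply: eq_bigr => t _; rewrite psiD; ring.
    by rewrite Exy Ex psiD; ring.
  by move/eqP; rewrite mulf_eq0 subr_eq0 (negbTE yij) orbF => /eqP.
move=> j; rewrite inE => /orP[/eqP ->|]; last exact: ar.
have := S0 0; rewrite big_cons big_seq big1 ?addr0 ?psi0 ?mulr1 // => t tr.
by rewrite ar // mul0r.
Qed.

(** * The canonical integral form of a root datum *)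

Section RootForm.
Variables (l : nat) (G : root_datum l).
Local Notation L := 'rV[int]_l.
Local Notation "<< x , a >>" := (pairing x (coroot G a)).

Lemma pairingD (x y : L) xi : pairing (x + y) xi = pairing x xi + pairing y xi.
Proof. by rewrite /pairing mulmxDl mxE. Qed.

Lemma pairingN (x : L) xi : pairing (- x) xi = - pairing x xi.
Proof. by rewrite /pairing mulNmx mxE. Qed.

Lemma pairing0 xi : pairing (0 : L) xi = 0.
Proof. by rewrite /pairing mul0mx mxE. Qed.

Lemma pairingBr (x : L) xi eta : pairing x (xi - eta) = pairing x xi - pairing x eta.
Proof. by rewrite /pairing mulmxBr !mxE. Qed.

Lemma pairingZr c (x : L) xi : pairing x (c *: xi) = c * pairing x xi.
Proof. by rewrite /pairing -scalemxAr mxE. Qed.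

Lemma pairing_sum I (r : seq I) P (F : I -> L) xi :
  pairing (\sum_(i <- r | P i) F i) xi = \sum_(i <- r | P i) pairing (F i) xi.
Proof. by rewrite /pairing mulmx_suml summxE. Qed.

Lemma pairing_sumr I (r : seq I) P (x : L) (F : I -> 'cV[int]_l) :
  pairing x (\sum_(i <- r | P i) F i) = \sum_(i <- r | P i) pairing x (F i).
Proof. by rewrite /pairing mulmx_sumr summxE. Qed.

Lemma pairing_delta (x : L) j : pairing x (delta_mx j 0) = x 0 j.
Proof. by rewrite /pairing -colE mxE. Qed.

Lemma pairing_inj (xi eta : 'cV[int]_l) :
  (forall x : L, pairing x xi = pairing x eta) -> xi = eta.
Proof.
move=> E; apply/matrixP => i j; rewrite ord1.
by have := E (delta_mx 0 i); rewrite /pairing -!rowE !mxE.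
Qed.

Lemma reflectionE a x : reflection G a x = x - <<x, a>> *: a.
Proof. by []. Qed.

Lemma reflection_root a : a \in roots G -> reflection G a a = - a.
Proof.
move=> aG; rewrite reflectionE (pairing_coroot aG) scaler_nat mulr2n opprD addrA.
by rewrite subrr add0r.
Qed.

Lemma reflection_in a b : a \in roots G -> b \in roots G ->
  reflection G a b \in roots G.
Proof. exact: roots_reflect. Qed.

Lemma rootN a : a \in roots G -> - a \in roots G.
Proof. by move=> aG; rewrite -reflection_root // reflection_in. Qed.

Lemma root_neq0 a : a \in roots G -> a != 0.
Proof.
by move=> aG; apply/eqP => a0; have := pairing_coroot aG; rewrite a0 pairing0.
Qed.

Lemma reflectionZ a c x : reflection G a (c *: x) = c *: reflection G a x.
Proof. by rewrite !reflectionE pairingZ scalerBr scalerA. Qed.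

Lemma reflectionN a x : reflection G a (- x) = - reflection G a x.
Proof. by rewrite -scaleN1r reflectionZ scaleN1r. Qed.

(** The canonical integral form of a root datum. It is invariant under the Weyl
   group because reflections permute the coroots. *)
Definition ip (x y : L) : int := \sum_(a <- roots G) <<x, a>> * <<y, a>>.

Lemma ipE x y : ip x y = \sum_(a <- roots G) <<x, a>> * <<y, a>>.
Proof. by []. Qed.

Lemma ipC x y : ip x y = ip y x.
Proof. by apply: eq_bigr => a _; rewrite mulrC. Qed.

Lemma ipDl x y z : ip (x + y) z = ip x z + ip y z.
Proof. by rewrite -big_split; apply: eq_bigr => a _; rewrite pairingD mulrDl. Qed.

Lemma ipZl c x z : ip (c *: x) z = c * ip x z.
Proof. by rewrite mulr_sumr; apply: eq_bigr => a _; rewrite pairingZ mulrA. Qed.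

Lemma ipNl x z : ip (- x) z = - ip x z.
Proof. by rewrite -scaleN1r ipZl mulN1r. Qed.

Lemma ipBl x y z : ip (x - y) z = ip x z - ip y z.
Proof. by rewrite ipDl ipNl. Qed.

Lemma ip0l z : ip 0 z = 0.
Proof. by rewrite -(scale0r 0) ipZl mul0r. Qed.

Lemma ipDr x y z : ip z (x + y) = ip z x + ip z y.
Proof. by rewrite ipC ipDl !(ipC z). Qed.

Lemma ipZr c x z : ip z (c *: x) = c * ip z x.
Proof. by rewrite ipC ipZl (ipC z). Qed.

Lemma ipNr x z : ip z (- x) = - ip z x.
Proof. by rewrite ipC ipNl (ipC z). Qed.

Lemma ipBr x y z : ip z (x - y) = ip z x - ip z y.
Proof. by rewrite ipDr ipNr. Qed.

Lemma ip_suml I (r : seq I) P (F : I -> L) z :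
  ip (\sum_(i <- r | P i) F i) z = \sum_(i <- r | P i) ip (F i) z.
Proof.
by elim/big_rec2: _ => [|i x y _ <-]; rewrite ?ip0l ?ipDl.
Qed.

Lemma ip_ge0 x : 0 <= ip x x.
Proof. by apply: sumr_ge0 => a _; rewrite -expr2 sqr_ge0. Qed.

Lemma ip_coroot_le x a : a \in roots G -> <<x, a>> ^+ 2 <= ip x x.
Proof.
move=> aG; rewrite /ip (bigD1_seq a) ?roots_uniq //= -expr2 lerDl.
by apply: sumr_ge0 => b _; rewrite -expr2 sqr_ge0.
Qed.

Lemma ip_root_gt0 a : a \in roots G -> 0 < ip a a.
Proof. by move=> aG; apply: lt_le_trans (ip_coroot_le a aG); rewrite pairing_coroot. Qed.

Lemma ip_reflection a x y : a \in roots G ->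
  ip (reflection G a x) (reflection G a y) = ip x y.
Proof.
move=> aG; pose s xi : 'cV[int]_l := xi - pairing a xi *: coroot G a.
have sK : involutive s.
  move=> xi; rewrite /s pairingBr pairingZr (pairing_coroot aG).
  set c := pairing a xi; rewrite -addrA -opprD -scalerDl.
  by rewrite (_ : c + (c - c * 2) = 0) ?scale0r ?subr0 //; ring.
pose M := map (coroot G) (roots G).
have uM : uniq M by rewrite map_inj_in_uniq ?roots_uniq //; exact: coroot_inj.
have sM xi : xi \in M -> s xi \in M.
  by case/mapP=> b bG ->; apply: coroots_reflect.
have pM : perm_eq (map s M) M.
  apply: uniq_perm => //; first by rewrite map_inj_uniq //; exact: inv_inj.
  move=> xi; apply/mapP/idP => [[eta /sM etaM ->]//|/sM xiM].
  by exists (s xi); rewrite ?sK.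
have E F : \sum_(b <- roots G) F (coroot G b) = \sum_(xi <- M) F xi :> int.
  by rewrite big_map.
rewrite /ip !(E (fun xi => pairing _ xi * pairing _ xi)) -(perm_big _ pM) big_map.
apply: eq_bigr => xi _; rewrite /reflection !pairingB !pairingZ /s !pairingBr.
by rewrite !pairingZr (pairing_coroot aG); ring.
Qed.

Lemma ip_reflectionC a x y : a \in roots G ->
  ip (reflection G a x) y = ip x (reflection G a y).
Proof. by move=> aG; rewrite -(ip_reflection _ _ aG) reflectionK. Qed.

Lemma ip_root a x : a \in roots G -> 2 * ip x a = <<x, a>> * ip a a.
Proof.
move=> aG; have := ip_reflectionC x a aG.
by rewrite reflection_root // ipNr reflectionE ipBl ipZl; lia.
Qed.

Lemma coroot_reflection a b x : a \in roots G -> b \in roots G ->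
  <<x, reflection G a b>> = <<reflection G a x, b>>.
Proof.
move=> aG bG; apply: (@mulIf _ (ip b b)); first by rewrite gt_eqF ?ip_root_gt0.
rewrite -{1}(ip_reflection b b aG) -!ip_root ?reflection_in //.
by rewrite ip_reflectionC.
Qed.

Lemma corootN a x : a \in roots G -> <<x, - a>> = - <<x, a>>.
Proof.
move=> aG; rewrite -(reflection_root aG) coroot_reflection // reflectionE.
by rewrite pairingB pairingZ pairing_coroot //; ring.
Qed.

(** The multiplier could only be 1, 2 or 1/2, and the root system is reduced. *)
Lemma root_scale a b (c : nat) : a \in roots G -> b \in roots G ->
  a = b *+ c -> a = b.
Proof.
move=> aG bG ab; have := pairing_coroot aG.
rewrite {1}ab -scaler_nat pairingZ => E.
rewrite natz in E; set p := <<b, a>> in E.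
have : (c <= 2)%N by have [p0|p0] := leP p 0; nia.
case: c ab E => [|[|[|//]]] ab E _; [by lia | by [] |].
by have := roots_reduced bG; rewrite -ab aG.
Qed.

Section SimplyConnected.
Hypothesis hsc : simply_connected G.

(** The coordinates of x are integral combinations of its pairings with the
    coroots, which the form bounds. *)
Lemma ip_finite_ball N : finite_set [set x : L | ip x x <= N]%classic.
Proof.
have [b xb] : exists b : nat, forall x, ip x x <= N -> forall j, `|x 0 j| <= b%:Z.
  have /choice[c Hc] : forall j, exists c : L -> int,
      delta_mx j 0 = \sum_(a <- roots G) c a *: coroot G a.
    by move=> j; exact: hsc.
  pose m := \sum_j \sum_(a <- roots G) `|c j a| * `|N|.
  have m0 j : 0 <= \sum_(a <- roots G) `|c j a| * `|N|.
    by apply: sumr_ge0 => a _; rewrite mulr_ge0.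
  exists `|m|%N => x xN j; rewrite abszE.
  rewrite (@ger0_norm _ m); last by apply: sumr_ge0.
  rewrite -pairing_delta Hc pairing_sumr /m (bigD1 j) //=.
  apply: (@le_trans _ _ (\sum_(a <- roots G) `|c j a| * `|N|)); last first.
    by rewrite lerDl sumr_ge0.
  apply: le_trans (ler_norm_sum _ _ _) _; rewrite big_seq [leRHS]big_seq.
  apply: ler_sum => a aG; rewrite pairingZr normrM ler_wpM2l //.
  have := ip_coroot_le x aG; set p := <<x, a>>; nia.
apply: (@sub_finite_set _ _
  (range (fun y : 'rV['I_(b + b).+1]_l => \row_j ((y 0 j)%:Z - b%:Z)))).
  move=> x /= /xb {}xb; exists (\row_j inord (absz (x 0 j + b%:Z))) => //.
  apply/rowP => j; rewrite !mxE; move: (xb j); move: (x 0 j) => z zb.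
  by rewrite inordK; lia.
exact/finite_image/finite_finset.
Qed.

End SimplyConnected.

End RootForm.

(** * Simple roots and the basic inner product *)

Section LieTheory.
Variables (R : realType) (l : nat) (G : root_datum l) (D : lie_data R G).
Hypothesis hsc : simply_connected G.
Local Notation L := 'rV[int]_l.
Local Notation "<< x , a >>" := (pairing x (coroot G a)).
Local Notation ip := (ip G).
Local Notation theta := (alpha_max D).
Local Notation alpha := (aroot D).
Local Notation B := (basic D).
Local Notation coR a := (map_mx intr (coroot G a) : 'cV[R]_l).

Lemma bformBr (xi eta zeta : 'cV[R]_l) :
  bform B xi (eta - zeta) = bform B xi eta - bform B xi zeta.
Proof. by rewrite /bform mulmxBr !mxE. Qed.

Lemma bformZr c (xi eta : 'cV[R]_l) : bform B xi (c *: eta) = c * bform B xi eta.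
Proof. by rewrite /bform -scalemxAr mxE. Qed.

Lemma bformC (xi eta : 'cV[R]_l) : bform B xi eta = bform B eta xi.
Proof.
rewrite /bform; transitivity ((xi^T *m B *m eta)^T 0 0); first by rewrite [RHS]mxE.
by rewrite !trmx_mul trmxK (basic_sym D) mulmxA.
Qed.

Lemma bformDl (xi eta zeta : 'cV[R]_l) :
  bform B (xi + eta) zeta = bform B xi zeta + bform B eta zeta.
Proof. by rewrite /bform raddfD !mulmxDl mxE. Qed.

Lemma bformNr (xi eta : 'cV[R]_l) : bform B xi (- eta) = - bform B xi eta.
Proof. by rewrite -scaleN1r bformZr mulN1r. Qed.

Lemma bformZl c (xi eta : 'cV[R]_l) : bform B (c *: xi) eta = c * bform B xi eta.
Proof. by rewrite bformC bformZr bformC. Qed.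

Lemma bform0l (xi : 'cV[R]_l) : bform B 0 xi = 0.
Proof. by rewrite -(scale0r 0) bformZl mul0r. Qed.

Lemma bform_suml I (r : seq I) P (F : I -> 'cV[R]_l) xi :
  bform B (\sum_(i <- r | P i) F i) xi = \sum_(i <- r | P i) bform B (F i) xi.
Proof. by elim/big_rec2: _ => [|i x y _ <-]; rewrite ?bform0l ?bformDl. Qed.

Lemma bform_coroot a (xi : 'cV[R]_l) : a \in roots G ->
  2 * bform B (coR a) xi = pairing (map_mx intr a) xi * bform B (coR a) (coR a).
Proof.
move=> aG; have := basic_inv D aG (coR a) xi.
have paa : pairing (map_mx intr a) (coR a) = 2 :> R.
  by rewrite /pairing -map_mxM mxE -/(<<a, a>>) (pairing_coroot aG).
rewrite /coreflection paa scaler_nat mulr2n opprD addrA subrr add0r.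
rewrite [LHS]bformC bformNr bformC bformBr bformZr => E.
by lra.
Qed.

Lemma pairing_intr (x : L) (xi : 'cV[int]_l) :
  pairing (map_mx intr x) (map_mx intr xi) = (pairing x xi)%:~R :> R.
Proof. by rewrite /pairing -map_mxM mxE. Qed.

Local Notation bnorm xi := (bform B (map_mx intr xi) (map_mx intr xi)).

Lemma bform_eq0 (xi : 'cV[R]_l) : bform B xi xi = 0 -> xi = 0.
Proof.
move=> E; apply/eqP; apply: contraT => /(basic_pos D).
by rewrite E ltxx.
Qed.

(** Such a vector is orthogonal to the coroots for the basic form, and the
    coroots span. *)
Lemma coweight_eq0 (xi : 'cV[int]_l) :
  {in roots G, forall a, pairing a xi = 0} -> xi = 0.
Proof.
move=> xi0; have [c Hc] := hsc xi.
have /bform_eq0 : bnorm xi = 0.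
  rewrite {1}Hc raddf_sum bform_suml big_seq big1 // => a aG.
  have := bform_coroot (map_mx intr xi) aG.
  rewrite pairing_intr xi0 // mul0r => /eqP.
  rewrite mulf_eq0 pnatr_eq0 /= => /eqP E.
  rewrite [X in bform B X _](_ : _ = (c a)%:~R *: coR a).
    by rewrite bformZl E mulr0.
  by apply/matrixP => i j; rewrite !mxE rmorphM.
move=> /matrixP E; apply/matrixP => i j; have := E i j; rewrite !mxE => /eqP.
by rewrite intr_eq0 => /eqP.
Qed.

Local Notation sroot := (simple_root D).

(** A linear relation between the simple roots would make their matrix
    singular, and a vector of its kernel would be annihilated by all roots. *)
Lemma simple_root_indep (c : 'I_l -> int) :
  \sum_i c i *: sroot i = 0 -> forall i, c i = 0.
Proof.
move=> c0; pose M : 'M[int]_l := \matrix_(i, j) sroot i 0 j.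
have rowM i : row i M = sroot i by apply/rowP => j; rewrite !mxE.
have detM : \det M != 0.
  rewrite -det_tr; apply/det0P => -[v /eqP v0 vM]; case: v0.
  apply: trmx_inj; rewrite trmx0; apply: coweight_eq0.
  have E i : pairing (sroot i) v^T = 0.
    rewrite /pairing -rowM -row_mul -[M]trmxK -trmx_mul vM trmx0.
    by rewrite !mxE.
  move=> b bG; case: (simple_root_base D bG) => -[e Eb].
    by rewrite Eb pairing_sum big1 // => i _; rewrite -scaler_nat pairingZ E mulr0.
  rewrite -[b]opprK Eb pairingN pairing_sum big1 ?oppr0 // => i _.
  by rewrite -scaler_nat pairingZ E mulr0.
move=> i; pose v : L := \row_j c j.
have vM : v *m M = 0.
  rewrite mulmx_sum_row -[RHS]c0; apply: eq_bigr => j _.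
  by rewrite rowM mxE.
have : v = 0.
  by apply/eqP; apply: contraNT detM => v0; apply/det0P; exists v.
by move=> /rowP/(_ i); rewrite !mxE.
Qed.

Lemma nonneg_combE mu : nonneg_comb sroot mu ->
  exists e : 'I_l -> int, (forall i, 0 <= e i) /\ mu = \sum_i e i *: sroot i.
Proof.
case=> c ->; exists (fun i => (c i)%:Z); split=> //.
by apply: eq_bigr => i _; rewrite -scaler_nat natz.
Qed.

Lemma simple_root_inj (c e : 'I_l -> int) :
  \sum_i c i *: sroot i = \sum_i e i *: sroot i -> forall i, c i = e i.
Proof.
move=> /eqP; rewrite -subr_eq0 -sumrB => /eqP E i; apply/eqP; rewrite -subr_eq0.
apply/eqP; apply: (@simple_root_indep (fun i => c i - e i)); rewrite -[RHS]E.
by apply: eq_bigr => j _; rewrite scalerBl.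
Qed.

(** Both theta - b and theta + b are nonnegative combinations of the simple
    roots, whence the bound. *)
Lemma root_coefs : exists t : 'I_l -> int, theta = \sum_i t i *: sroot i /\
  forall b, b \in roots G -> exists e : 'I_l -> int,
    [/\ b = \sum_i e i *: sroot i, forall i, `|e i| <= t i &
        (forall i, 0 <= e i) \/ (forall i, e i <= 0)].
Proof.
have coef b : b \in roots G -> exists e : 'I_l -> int,
    b = \sum_i e i *: sroot i /\ ((forall i, 0 <= e i) \/ (forall i, e i <= 0)).
  move=> bG; case: (simple_root_base D bG) => /nonneg_combE[e [e0 E]].
    by exists e; split=> //; left.
  exists (fun i => - e i); split; last by right=> i; rewrite oppr_le0.
  by rewrite -[b]opprK E -sumrN; apply: eq_bigr => i _; rewrite scaleNr.
have [t [Et _]] := coef _ (alpha_max_in D).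
exists t; split=> // b bG; have [e [Eb eS]] := coef _ bG; exists e; split=> // i.
have /nonneg_combE[u [u0 Eu]] := alpha_max_highest D bG.
have /nonneg_combE[v [v0 Ev]] := alpha_max_highest D (rootN bG).
have Hu : u i = t i - e i.
  apply: (@simple_root_inj u (fun i => t i - e i)); rewrite -Eu {1}Et {1}Eb -sumrB.
  by apply: eq_bigr => j _; rewrite scalerBl.
have Hv : v i = t i + e i.
  apply: (@simple_root_inj v (fun i => t i + e i)).
  rewrite -Ev opprK {1}Et {1}Eb -big_split.
  by apply: eq_bigr => j _; rewrite scalerDl.
have := u0 i; have := v0 i; rewrite Hu Hv; lia.
Qed.

Lemma aroot_in i : alpha i \in roots G.
Proof.
rewrite /aroot; case: unliftP => [j _|_]; first exact: simple_root_in.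
exact/rootN/alpha_max_in.
Qed.

Lemma aroot0 : alpha ord0 = - theta.
Proof. by rewrite /aroot unlift_none. Qed.

Lemma aroot_lift j : alpha (lift ord0 j) = sroot j.
Proof. by rewrite /aroot liftK. Qed.

(** * Affine roots and the action of words *)

(** An affine real root a + m delta is encoded by its integer coefficients c on
   the simple affine roots: then a is acomb c and m is c ord0. *)
Definition acomb (c : 'I_l.+1 -> int) : L := \sum_i c i *: alpha i.

Definition affroot c := acomb c \in roots G.

Lemma acombE c : acomb c = \sum_j c (lift ord0 j) *: sroot j - c ord0 *: theta.
Proof.
rewrite /acomb big_ord_recl aroot0 scalerN addrC; congr (_ - _).
by apply: eq_bigr => j _; rewrite aroot_lift.
Qed.

(** When c ord0 is not 0, its sign is the common one, because the coefficients
    of theta outweigh those of any root; otherwise the affine root is a root. *)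
Lemma affroot_sign c : affroot c -> (forall i, 0 <= c i) \/ (forall i, c i <= 0).
Proof.
have [t [Et coef]] := root_coefs; move=> /coef[e [Ee te eS]].
have Ec j : c (lift ord0 j) = e j + c ord0 * t j.
  apply: (@simple_root_inj (fun j => c (lift ord0 j))
                           (fun j => e j + c ord0 * t j)) j.
  move/eqP: Ee; rewrite acombE subr_eq => /eqP ->.
  rewrite {1}Et scaler_sumr -big_split.
  by apply: eq_bigr => j _; rewrite scalerDl scalerA.
have [c0|c0|c0] := ltrgtP (c ord0) 0.
- right=> i; case: (unliftP ord0 i) => [j ->|->]; last exact: ltW.
  by rewrite Ec; have := te j; nia.
- left=> i; case: (unliftP ord0 i) => [j ->|->]; last exact: ltW.
  by rewrite Ec; have := te j; nia.
- case: eS => e0; [left|right] => i; case: (unliftP ord0 i) => [j ->|->];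
    by rewrite ?Ec c0 // mul0r addr0.
Qed.

Lemma apairing_level n m i x y :
  apairing D (n + m) i (x + y) = apairing D n i x + apairing D m i y.
Proof. by rewrite /apairing pairingD mulrnDl addrACA. Qed.

Lemma apairingZ n c i x : apairing D (c * n) i (c *: x) = c * apairing D n i x.
Proof. by rewrite /apairing pairingZ mulrDr mulrnAr. Qed.

Lemma apairing0 i x : apairing D 0 i x = <<x, alpha i>>.
Proof. by rewrite /apairing mul0rn addr0. Qed.

Lemma asigma_level i n m x y :
  asigma D i (n + m) (x + y) = asigma D i n x + asigma D i m y.
Proof. by rewrite /asigma apairing_level scalerDl opprD addrACA. Qed.

Lemma asigmaZ i n c x : asigma D i (c * n) (c *: x) = c *: asigma D i n x.
Proof. by rewrite /asigma apairingZ scalerBr scalerA. Qed.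

Lemma asigma0 i x : asigma D i 0 x = reflection G (alpha i) x.
Proof. by rewrite /asigma apairing0. Qed.

Lemma apairing_asigma n i x : apairing D n i (asigma D i n x) = - apairing D n i x.
Proof.
rewrite {1}/apairing /asigma pairingB pairingZ (pairing_coroot (aroot_in i)).
by rewrite /apairing; ring.
Qed.

Lemma asigmaK i n : involutive (asigma D i n).
Proof.
move=> x; rewrite {1}/asigma apairing_asigma scaleNr opprK /asigma.
by rewrite subrK.
Qed.

Lemma word_act_cat s1 s2 n x :
  word_act D (s1 ++ s2) n x = word_act D s1 n (word_act D s2 n x).
Proof. by rewrite /word_act foldr_cat. Qed.

Lemma word_act_cons i s n x : word_act D (i :: s) n x = asigma D i n (word_act D s n x).
Proof. by []. Qed.

Lemma word_act_revK s n : cancel (word_act D s n) (word_act D (rev s) n).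
Proof.
elim: s => [|i s IH] x //; rewrite rev_cons -cats1 word_act_cat word_act_cons.
by rewrite /= asigmaK.
Qed.

Lemma word_act_rev s n : cancel (word_act D (rev s) n) (word_act D s n).
Proof. by have := @word_act_revK (rev s) n; rewrite revK. Qed.

Lemma word_act_level s n m x y :
  word_act D s (n + m) (x + y) = word_act D s n x + word_act D s m y.
Proof. by elim: s => [|i s IH] //=; rewrite IH asigma_level. Qed.

Lemma word_actZ s n c x : word_act D s (c * n) (c *: x) = c *: word_act D s n x.
Proof. by elim: s => [|i s IH] //=; rewrite IH asigmaZ. Qed.

Lemma word_actD s n x y : word_act D s n (x + y) = word_act D s n x + word_act D s 0 y.
Proof. by rewrite -{1}[n]addr0 word_act_level. Qed.

Lemma word_actZ0 s c x : word_act D s 0 (c *: x) = c *: word_act D s 0 x.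
Proof. by rewrite -{1}[0](mulr0 c) word_actZ. Qed.

Lemma ip_word_act s x y : ip (word_act D s 0 x) (word_act D s 0 y) = ip x y.
Proof. by elim: s => [|i s IH] //=; rewrite !asigma0 ip_reflection ?aroot_in. Qed.

(** Twice the pairing, in the canonical form, of an affine root with a weight
    of level n: an affine coroot up to a positive factor. *)
Definition acf c n (x : L) : int :=
  \sum_i c i * (ip (alpha i) (alpha i) * apairing D n i x).

Lemma ip_aroot_gt0 i : 0 < ip (alpha i) (alpha i).
Proof. exact/ip_root_gt0/aroot_in. Qed.

Lemma ip_theta : ip theta theta = ip (alpha ord0) (alpha ord0).
Proof. by rewrite aroot0 ipNl ipNr opprK. Qed.

Lemma ip_apairing n i x : ip (alpha i) (alpha i) * apairing D n i x =
  2 * ip (alpha i) x + n * (i == ord0)%:R * ip theta theta.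
Proof.
rewrite [ip _ x]ipC ip_root ?aroot_in // /apairing ip_theta.
by case: eqP => [->|_] /=; rewrite ?mulr1n ?mulr0n; ring.
Qed.

(** The pairing depends on the affine root only through its linear part and its
    coefficient on delta. *)
Lemma acfE c n x : acf c n x = 2 * ip (acomb c) x + n * c ord0 * ip theta theta.
Proof.
rewrite /acf /acomb ip_suml mulr_sumr (bigD1 ord0) //= [in RHS](bigD1 ord0) //=.
rewrite ip_apairing eqxx [in RHS]addrAC; congr (_ + _); first by rewrite ipZl mulr1n; ring.
by apply: eq_bigr => i /negbTE i0; rewrite ip_apairing i0 ipZl mulr0n; ring.
Qed.

(** The simple reflections acting on the coefficients of affine roots. *)
Definition crefl j c i : int := c i - (if i == j then <<acomb c, alpha j>> else 0).

Lemma acomb_crefl j c : acomb (crefl j c) = reflection G (alpha j) (acomb c).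
Proof.
rewrite reflectionE {1}/acomb /crefl.
under eq_bigr do rewrite scalerBl.
rewrite sumrB; congr (_ - _); rewrite (bigD1 j) //= eqxx big1 ?addr0 // => i /negbTE ->.
by rewrite scale0r.
Qed.

Lemma affroot_crefl j c : affroot c -> affroot (crefl j c).
Proof. by move=> cG; rewrite /affroot acomb_crefl reflection_in ?aroot_in. Qed.

Lemma acf_crefl j c n x : acf (crefl j c) n x = acf c n (asigma D j n x).
Proof.
rewrite !acfE acomb_crefl ip_reflectionC ?aroot_in // [asigma _ _ _ _]/asigma.
rewrite reflectionE !ipBr !ipZr /crefl.
have E := ip_root (acomb c) (aroot_in j).
have -> : apairing D n j x = <<x, alpha j>> + n *+ (j == ord0) by [].
rewrite [ord0 == j]eq_sym.
case: eqP E => [->|_] E; rewrite ?mulr1n ?mulr0n; last by ring.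
rewrite ip_theta; have := congr1 (fun z => n * z) E.
move: (ip _ x) (ip (acomb c) _) (ip (alpha _) _) (<<x, _>>) (<<_, _>>) (c _).
move=> u v w y z t; lia.
Qed.

Definition cdelta (j i : 'I_l.+1) : int := (i == j)%:R.

Lemma acomb_cdelta j : acomb (cdelta j) = alpha j.
Proof.
rewrite /acomb (bigD1 j) //= /cdelta eqxx scale1r big1 ?addr0 // => i /negbTE ->.
by rewrite scale0r.
Qed.

Lemma acf_cdelta j n x :
  acf (cdelta j) n x = ip (alpha j) (alpha j) * apairing D n j x.
Proof.
rewrite /acf (bigD1 j) //= /cdelta eqxx mul1r big1 ?addr0 // => i /negbTE ->.
by rewrite mul0r.
Qed.

Lemma affroot_neq0 c : affroot c -> exists i, c i != 0.
Proof.
move=> cG; apply: contrapT => H; have := root_neq0 cG; rewrite /acomb big1 ?eqxx // => i _.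
by have [->|ci] := eqVneq (c i) 0; rewrite ?scale0r //; case: H; exists i.
Qed.

(** Only the coefficient at j changes, so a positive affine root with another
    nonzero coefficient remains positive. *)
Lemma crefl_sign j c : affroot c -> (forall i, 0 <= c i) ->
  (forall i, 0 <= crefl j c i) \/ c = cdelta j.
Proof.
move=> cG c0; have [?|N] := affroot_sign (affroot_crefl j cG); first by left.
right; have cE i : i != j -> c i = 0.
  move=> ij; have := N i; rewrite /crefl (negbTE ij) subr0 => ci.
  by apply/eqP; rewrite eq_le ci c0.
have ac : acomb c = c j *: alpha j.
  by rewrite /acomb (bigD1 j) //= big1 ?addr0 // => i /cE ->; rewrite scale0r.
apply/funext => i; rewrite /cdelta; case: eqP => [->|/eqP /cE //].
have acj : acomb c = alpha j.
  apply: (@root_scale _ _ _ _ `|c j|%N cG (aroot_in j)).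
  by rewrite -scaler_nat natz abszE ger0_norm.
have := congr1 (fun x => <<x, alpha j>>) acj.
by rewrite ac pairingZ pairing_coroot ?aroot_in //= mulr1n; lia.
Qed.

Local Notation off I s := (all (fun i => i \notin I) s).

(** * The exchange property and reduced words *)

(** Induction on the word. The preimage of the simple affine root stays
    positive until some letter makes it negative; by crefl_sign it is then the
    simple root of that letter, which can therefore be deleted from the word i
    :: s. *)
Lemma exchange (I : {set 'I_l.+1}) s i : i \notin I -> off I s ->
  exists c, [/\ affroot c, (forall j, j \in I -> c j = 0),
    word_act D s 0 (acomb c) = alpha i,
    (forall n x, acf c n x =
       ip (alpha i) (alpha i) * apairing D n i (word_act D s n x)) &
    (forall j, 0 <= c j) \/
    (forall j, c j <= 0) /\ exists s', [/\ off I s', (size s' < size s)%N &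
      word_act D s' = word_act D (i :: s)]].
Proof.
move=> iI; elim/last_ind: s => [_|s j IH].
  exists (cdelta i); split=> //.
  - by rewrite /affroot acomb_cdelta aroot_in.
  - by move=> j jI; rewrite /cdelta; case: eqP => // ji; rewrite -ji jI in iI.
  - by rewrite acomb_cdelta.
  - by move=> n x; rewrite acf_cdelta.
  - by left=> j; rewrite /cdelta.
rewrite all_rcons => /andP[jI sI]; have [c [cG cI wc cf cS]] := IH sI.
have wE n x : word_act D (rcons s j) n x = word_act D s n (asigma D j n x).
  by rewrite -cats1 word_act_cat.
exists (crefl j c); split.
- exact: affroot_crefl.
- move=> r rI; rewrite /crefl cI // sub0r.
  by case: eqP => [rj|]; rewrite ?oppr0 // -rj rI in jI.
- by rewrite wE acomb_crefl asigma0 reflectionK ?aroot_in.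
- by move=> n x; rewrite acf_crefl cf wE.
case: cS => [c0|[c0 [s' [s'I s's s'E]]]].
  have [|cj] := crefl_sign j cG c0; first by left.
  right; split.
    move=> r; rewrite cj /crefl acomb_cdelta pairing_coroot ?aroot_in // /cdelta.
    by case: eqP.
  exists s; split=> //; first by rewrite size_rcons.
  apply/funext => n; apply/funext => x; rewrite word_act_cons wE.
  have E y : ip (alpha j) (alpha j) * apairing D n j y =
             ip (alpha i) (alpha i) * apairing D n i (word_act D s n y).
    by rewrite -cf cj acf_cdelta.
  have jE : word_act D s 0 (alpha j) = alpha i by rewrite -wc cj acomb_cdelta.
  have nE : ip (alpha j) (alpha j) = ip (alpha i) (alpha i).
    by rewrite -jE ip_word_act.
  have {}E y : apairing D n j y = apairing D n i (word_act D s n y).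
    apply: (@mulfI _ (ip (alpha i) (alpha i))); last by rewrite -E nE.
    by rewrite gt_eqF ?ip_aroot_gt0.
  rewrite [asigma D i n _]/asigma -E apairing_asigma.
  have -> : asigma D j n x = x + (- apairing D n j x) *: alpha j by rewrite scaleNr.
  by rewrite word_actD word_actZ0 jE addrK.
have [c1|c1] := affroot_sign (affroot_crefl j cG); first by left.
right; split=> //; exists (rcons s' j); split.
- by rewrite all_rcons jI.
- by rewrite !size_rcons ltnS.
- apply/funext => n; apply/funext => x; rewrite word_act_cons wE.
  by rewrite -cats1 word_act_cat s'E.
Qed.

Definition reduced (I : {set 'I_l.+1}) s := off I s /\
  forall s', off I s' -> word_act D s' = word_act D s -> (size s <= size s')%N.

Lemma reduced_exists (I : {set 'I_l.+1}) s : off I s ->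
  exists2 s', reduced I s' & word_act D s' = word_act D s.
Proof.
have [m] := ubnP (size s); elim: m s => // m IH s sm sI.
have [[s' [s'I s'E s's]]|H] := pselect (exists s', [/\ off I s',
    word_act D s' = word_act D s & (size s' < size s)%N]).
  have [|//|t tr tE] := IH s'; first exact: leq_trans s's _.
  by exists t; rewrite ?tE.
exists s => //; split=> // s' s'I s'E; rewrite leqNgt; apply/negP => s's.
by case: H; exists s'.
Qed.

Lemma reduced_behead (I : {set 'I_l.+1}) i s : reduced I (i :: s) -> reduced I s.
Proof.
case=> /= /andP[iI sI] H; split=> // s' s'I s'E.
have := H (i :: s'); rewrite /= iI ltnS; apply=> //.
by apply/funext => n; apply/funext => x; rewrite !word_act_cons s'E.
Qed.

(** By exchange, the pairing is that of x with a positive affine root, since a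
    negative one would provide a shorter word. *)
Lemma reduced_apairing (I : {set 'I_l.+1}) i s n x : reduced I (i :: s) ->
  (forall j, j \notin I -> 0 <= apairing D n j x) ->
  0 <= apairing D n i (word_act D s n x) /\
  ((forall j, j \notin I -> 0 < apairing D n j x) ->
    0 < apairing D n i (word_act D s n x)).
Proof.
move=> [/= /andP[iI sI] H] x0; have [c [cG cI _ cf cS]] := exchange iI sI.
have c0 j : 0 <= c j.
  case: cS => [//|[_ [s' [s'I s's s'E]]]].
  by have := H _ s'I s'E; rewrite leqNgt ltnS ltnW.
have t0 j : 0 <= c j * (ip (alpha j) (alpha j) * apairing D n j x).
  have [jI|jI] := boolP (j \in I); first by rewrite cI ?mul0r.
  by rewrite !mulr_ge0 ?ip_ge0 ?x0.
split=> [|xp]; first by rewrite -(pmulr_rge0 _ (ip_aroot_gt0 i)) -cf sumr_ge0.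
rewrite -(pmulr_rgt0 _ (ip_aroot_gt0 i)) -cf /acf.
have [j cj] := affroot_neq0 cG.
have jI : j \notin I by apply: contra cj => /cI ->.
rewrite (bigD1 j) //= ltr_pwDl ?sumr_ge0 // !mulr_gt0 ?ip_aroot_gt0 ?xp //.
by rewrite lt_def cj c0.
Qed.

(** Along a reduced word every letter meets a dominant weight on its positive
    side, so it raises any function that each simple reflection changes by a
    positive multiple of the pairing. Such functions are linear forms and
    squared distances. *)
Lemma reduced_mono (I : {set 'I_l.+1}) n (E : L -> int) (kap : 'I_l.+1 -> int) s x :
  (forall i y, i \notin I -> E (asigma D i n y) = E y + kap i * apairing D n i y) ->
  (forall i, i \notin I -> 0 < kap i) -> reduced I s ->
  (forall j, j \notin I -> 0 <= apairing D n j x) ->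
  E x <= E (word_act D s n x) /\
  (E (word_act D s n x) <= E x -> word_act D s n x = x).
Proof.
move=> ES kap0 + x0; elim: s => [_|i s IH sr]; first by [].
have [IH1 IH2] := IH (reduced_behead sr).
have iI : i \notin I by case: sr => /andP[].
have [p0 _] := reduced_apairing sr x0.
rewrite word_act_cons ES //; have k0 := kap0 _ iI.
split; first by rewrite (le_trans IH1) // lerDl mulr_ge0 // ltW.
set p := apairing _ _ _ _ in p0 *; move=> H.
have p00 : p = 0 by nia.
rewrite /asigma -/p p00 scale0r subr0; apply: IH2; move: H.
by rewrite p00 mulr0 addr0.
Qed.

Lemma reduced_smono (I : {set 'I_l.+1}) n (E : L -> int) (kap : 'I_l.+1 -> int) s x :
  (forall i y, i \notin I -> E (asigma D i n y) = E y + kap i * apairing D n i y) ->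
  (forall i, i \notin I -> 0 < kap i) -> reduced I s -> s != [::] ->
  (forall j, j \notin I -> 0 < apairing D n j x) ->
  E x < E (word_act D s n x).
Proof.
move=> ES kap0 + + x0; case: s => // i s sr _.
have x1 j : j \notin I -> 0 <= apairing D n j x by move=> /x0/ltW.
have [H _] := reduced_mono ES kap0 (reduced_behead sr) x1.
have iI : i \notin I by case: sr => /andP[].
have [_ p0] := reduced_apairing sr x1.
by rewrite word_act_cons ES // (le_lt_trans H) // ltrDl mulr_gt0 ?kap0 ?p0.
Qed.

Lemma dominant_unique (I : {set 'I_l.+1}) n s x : off I s ->
  (forall j, j \notin I -> 0 < apairing D n j x) ->
  (forall j, j \notin I -> 0 < apairing D n j (word_act D s n x)) ->
  word_act D s = word_act D [::].
Proof.
move=> /reduced_exists[[|i t] tr <-] // x0 wx0.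
have iI : i \notin I by case: tr => /andP[].
have x1 j : j \notin I -> 0 <= apairing D n j x by move=> /x0/ltW.
have [_ /(_ x0) p0] := reduced_apairing tr x1.
by have := wx0 _ iI; rewrite word_act_cons apairing_asigma oppr_gt0 ltNge ltW.
Qed.

(** Induction on positive affine roots: a root that is not simple is made smaller
   by a simple reflection along which it has a positive coefficient, which exists
   because its norm is positive. *)
Lemma affroot_ind (I : {set 'I_l.+1}) (P : ('I_l.+1 -> int) -> Prop) :
  (forall i, i \notin I -> P (cdelta i)) ->
  (forall i c, i \notin I -> affroot c -> (forall j, 0 <= c j) ->
     (forall j, j \in I -> c j = 0) -> P (crefl i c) -> P c) ->
  forall c, affroot c -> (forall j, 0 <= c j) -> (forall j, j \in I -> c j = 0) -> P c.
Proof.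
move=> P1 PS c; have [m] := ubnP (absz (\sum_i c i)).
elim: m c => // m IH c cm cG c0 cI.
have [i ci] : exists i, 0 < c i * ip (alpha i) (acomb c).
  apply: contrapT => H; have := ip_root_gt0 cG.
  rewrite {1}/acomb ip_suml ltNge sumr_le0 // => i _; rewrite ipZl leNgt.
  by apply/negP => ci; apply: H; exists i.
have ci0 : 0 < c i.
  by rewrite lt_def c0 andbT; apply: contraTneq ci => ->; rewrite mul0r ltxx.
have iI : i \notin I by apply: contraTN ci0 => /cI ->.
have [N|->] := crefl_sign i cG c0; last exact: P1.
apply: (PS i) => //; apply: IH => //; last 2 first.
- exact: affroot_crefl.
- move=> j jI; rewrite /crefl cI // sub0r.
  by case: eqP => [ji|_]; rewrite ?oppr0 // -ji jI in iI.
have pc : 0 < <<acomb c, alpha i>>.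
  rewrite -(pmulr_lgt0 _ (ip_aroot_gt0 i)) -ip_root ?aroot_in //.
  by rewrite mulr_gt0 // ipC -(pmulr_rgt0 _ ci0).
have E : \sum_j crefl i c j = \sum_j c j - <<acomb c, alpha i>>.
  rewrite /crefl sumrB; congr (_ - _); rewrite (bigD1 i) //= eqxx big1 ?addr0 //.
  by move=> j /negbTE ->.
have S0 : 0 <= \sum_j crefl i c j by apply: sumr_ge0.
move: S0 cm; rewrite E; set p := <<_, _>> in pc *; set S := \sum_j c j; lia.
Qed.

Lemma affroot_of_root b : b \in roots G -> exists c,
  [/\ acomb c = b, c ord0 = 0 & (forall i, 0 <= c i) \/ (forall i, c i <= 0)].
Proof.
have [t [_ coef]] := root_coefs; move=> /coef[e [Ee _ eS]].
exists (fun i => if unlift ord0 i is Some j then e j else 0); split.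
- rewrite acombE unlift_none scale0r subr0 Ee.
  by apply: eq_bigr => j _; rewrite liftK.
- by rewrite unlift_none.
- by case: eS => e0; [left|right] => i; case: unliftP.
Qed.

(** * The lattice, the highest root and rho *)

Lemma coroot_vecN a : a \in roots G -> coroot G (- a) = - coroot G a.
Proof.
move=> aG; apply: pairing_inj => x; rewrite corootN //.
by rewrite -scaleN1r pairingZr mulN1r.
Qed.

Lemma coroot_vec_reflection a b : a \in roots G -> b \in roots G ->
  coroot G (reflection G a b) = coroot G b - pairing a (coroot G b) *: coroot G a.
Proof.
move=> aG bG; apply: pairing_inj => x; rewrite coroot_reflection //.
by rewrite reflectionE pairingB pairingZ pairingBr pairingZr mulrC.
Qed.

(** The lattice is spanned by all coroots, and affroot_ind reaches each of them
    from the simple ones. *)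
Lemma coroot_span (xi : 'cV[int]_l) : exists n : 'I_l -> int,
  xi = \sum_i n i *: coroot G (sroot i).
Proof.
pose Sp (xi : 'cV[int]_l) := exists n : 'I_l -> int,
  xi = \sum_i n i *: coroot G (sroot i).
have SpD x y : Sp x -> Sp y -> Sp (x + y).
  move=> [n ->] [m ->]; exists (fun i => n i + m i); rewrite -big_split.
  by apply: eq_bigr => i _; rewrite scalerDl.
have SpZ c x : Sp x -> Sp (c *: x).
  move=> [n ->]; exists (fun i => c * n i); rewrite scaler_sumr.
  by apply: eq_bigr => i _; rewrite scalerA.
have Sp1 i : Sp (coroot G (sroot i)).
  exists (fun j => (j == i)%:R); rewrite (bigD1 i) //= eqxx scale1r big1 ?addr0 //.
  by move=> j /negbTE ->; rewrite scale0r.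
have SpP c : affroot c -> (forall j, 0 <= c j) -> c ord0 = 0 ->
    Sp (coroot G (acomb c)).
  move=> cG c0 c00; apply: (@affroot_ind [set ord0]
    (fun c => Sp (coroot G (acomb c))) _ _ c cG c0 _) => [i|i e|].
  - rewrite inE acomb_cdelta; case: (unliftP ord0 i) => [j ->|->]; last by rewrite eqxx.
    by rewrite aroot_lift => _; exact: Sp1.
  - rewrite inE; case: (unliftP ord0 i) => [j ->|->]; last by rewrite eqxx.
    move=> _ eG e0 eI; rewrite acomb_crefl => H.
    rewrite -[acomb e](reflectionK (aroot_in (lift ord0 j))).
    rewrite coroot_vec_reflection ?aroot_in //; last by rewrite reflection_in ?aroot_in.
    by apply: SpD => //; rewrite -scaleNr; apply: (SpZ); rewrite aroot_lift; exact: Sp1.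
  - by move=> j; rewrite inE => /eqP ->.
have [c ->] := hsc xi; rewrite big_seq; elim/big_ind: _ => [|x y|a aG].
- by exists (fun=> 0); rewrite big1 // => i _; rewrite scale0r.
- exact: SpD.
apply: (SpZ); have [e [ea e0 [ep|en]]] := affroot_of_root aG.
  by rewrite -ea; apply: SpP => //; rewrite /affroot ea.
have ena : acomb (fun i => - e i) = - a.
  by rewrite -ea /acomb -sumrN; apply: eq_bigr => i _; rewrite scaleNr.
have nG := rootN aG.
rewrite -[a]opprK coroot_vecN // -scaleN1r; apply: (SpZ); rewrite -ena.
apply: SpP => [|i|]; rewrite ?/affroot ?ena ?oppr_ge0 //.
by rewrite e0 oppr0.
Qed.

Lemma reflection_comb e j b : b = \sum_i e i *: sroot i ->
  reflection G (sroot j) b =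
  \sum_i (e i - (if i == j then <<b, sroot j>> else 0)) *: sroot i.
Proof.
move=> Eb; rewrite reflectionE {1}Eb; under [RHS]eq_bigr do rewrite scalerBl.
rewrite sumrB; congr (_ - _); rewrite (bigD1 j) //= eqxx big1 ?addr0 //.
by move=> i /negbTE ->; rewrite scale0r.
Qed.

(** Otherwise the reflection of theta would have a larger coefficient than theta. *)
Lemma theta_dominant j : 0 <= <<theta, sroot j>>.
Proof.
have [t [Et coef]] := root_coefs.
have jG := simple_root_in D j.
have [e [Ee te _]] := coef _ (reflection_in jG (alpha_max_in D)).
rewrite (reflection_comb _ Et) in Ee.
have := te j; rewrite -(simple_root_inj Ee j) eqxx; lia.
Qed.

Lemma ip_sroot x j : 2 * ip (sroot j) x = <<x, sroot j>> * ip (sroot j) (sroot j).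
Proof. by rewrite ipC ip_root // simple_root_in. Qed.

Lemma ip_sroot_gt0 j : 0 < ip (sroot j) (sroot j).
Proof. exact/ip_root_gt0/simple_root_in. Qed.

(** The highest root is long: any root can be made dominant by reflections that
   raise it, and a dominant root is below the highest one. *)
Lemma theta_long b : b \in roots G -> ip b b <= ip theta theta.
Proof.
have [t [Et coef]] := root_coefs.
move=> bG; have [e [Eb _ _]] := coef _ bG.
have [m] := ubnP (absz (\sum_i t i - \sum_i e i)%R).
elim: m b bG e Eb => // m IH b bG e Eb em.
have tE e' : b = \sum_i e' i *: sroot i -> forall i, e' i <= t i.
  move=> Eb' i; have [u [Eu tu _]] := coef _ bG.
  rewrite (@simple_root_inj e' u) -?Eu //; apply: le_trans (tu i); exact: ler_norm.
have [[j jn]|H] := pselect (exists j, <<b, sroot j>> < 0).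
  have jG := simple_root_in D j.
  rewrite -(ip_reflection b b jG).
  pose e' i := e i - (if i == j then <<b, sroot j>> else 0).
  have Eb' : reflection G (sroot j) b = \sum_i e' i *: sroot i.
    exact: reflection_comb.
  apply: (IH _ (reflection_in jG bG) e') => //.
  have Se' : \sum_i e' i = \sum_i e i - <<b, sroot j>>.
    rewrite /e' sumrB; congr (_ - _); rewrite (bigD1 j) //= eqxx big1 ?addr0 //.
    by move=> i /negbTE ->.
  have : \sum_i e' i <= \sum_i t i.
    apply: ler_sum => i _; have [u [Eu tu _]] := coef _ (reflection_in jG bG).
    rewrite (@simple_root_inj e' u) -?Eu //; apply: le_trans (tu i); exact: ler_norm.
  by move: em; rewrite Se'; set p := <<_, _>> in jn *; lia.
rewrite -subr_ge0.
have -> : ip theta theta - ip b b = ip (theta - b) (theta + b).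
  by rewrite ipBl !ipDr [ip b theta]ipC; ring.
have -> : theta - b = \sum_i (t i - e i) *: sroot i.
  by under eq_bigr do rewrite scalerBl; rewrite sumrB -Et -Eb.
rewrite ip_suml sumr_ge0 // => i _; rewrite ipZl mulr_ge0 ?subr_ge0 ?tE //.
rewrite -(pmulr_rge0 _ (_ : 0 < 2)) // ip_sroot mulr_ge0 ?ip_ge0 // pairingD.
rewrite addr_ge0 ?theta_dominant // leNgt; apply/negP => bi.
by apply: H; exists i.
Qed.

(** A simple reflection permutes the positive roots other than its own, so the
    sum of their pairings with its coroot is 0. *)
Lemma rho_pairing j : <<rho D, sroot j>> = 1.
Proof.
have jG := simple_root_in D j.
pose pos b := `[< nonneg_comb sroot b >].
pose P := [seq b <- roots G | pos b && (b != sroot j)].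
have posE b : b \in roots G -> pos b -> exists c,
    [/\ acomb c = b, c ord0 = 0 & forall i, 0 <= c i].
  move=> bG /asboolP/nonneg_combE[e [e0 Ee]].
  exists (fun i => if unlift ord0 i is Some j then e j else 0); split.
  - rewrite acombE unlift_none scale0r subr0 Ee.
    by apply: eq_bigr => i _; rewrite liftK.
  - by rewrite unlift_none.
  - by move=> i; case: unliftP.
have posI c : c ord0 = 0 -> (forall i, 0 <= c i) -> pos (acomb c).
  move=> c0 cp; apply/asboolP; exists (fun i => `|c (lift ord0 i)|%N).
  rewrite acombE c0 scale0r subr0; apply: eq_bigr => i _.
  by rewrite -[RHS]scaler_nat natz abszE ger0_norm.
have posN b : b \in roots G -> pos b -> ~~ pos (- b).
  move=> bG /asboolP/nonneg_combE[e [e0 Ee]]; apply/asboolP => /nonneg_combE[u [u0 Eu]].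
  have E0 : \sum_i (e i + u i) *: sroot i = 0.
    by under eq_bigr do rewrite scalerDl; rewrite big_split /= -Ee -Eu subrr.
  have := root_neq0 bG; rewrite Ee big1 ?eqxx // => i _.
  have := simple_root_indep E0 i; have := e0 i; have := u0 i => ? ? ?.
  by rewrite (_ : e i = 0) ?scale0r //; lia.
have simp : pos (sroot j).
  apply/asboolP; exists (fun i => (i == j)%N); rewrite (bigD1 j) //= eqxx big1 ?addr0 //.
  by move=> i /negbTE ->.
have sP b : b \in P -> reflection G (sroot j) b \in P.
  rewrite !mem_filter => /andP[/andP[bp bj] bG].
  rewrite reflection_in // andbT; have [c [cb c0 cp]] := posE _ bG bp.
  have cG : affroot c by rewrite /affroot cb.
  have [N|E] := crefl_sign (lift ord0 j) cG cp; last first.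
    by rewrite -cb E acomb_cdelta aroot_lift eqxx in bj.
  apply/andP; split.
    rewrite -cb -aroot_lift -acomb_crefl posI //.
    by rewrite /crefl c0.
  apply/eqP => /(congr1 (reflection G (sroot j))); rewrite reflectionK // reflection_root //.
  by move=> bE; have := posN _ jG simp; rewrite -bE bp.
have uP : uniq P by rewrite filter_uniq ?roots_uniq.
have pP : perm_eq (map (reflection G (sroot j)) P) P.
  apply: uniq_perm => //; first by rewrite map_inj_uniq //; exact: inv_inj (reflectionK jG).
  move=> b; apply/mapP/idP => [[c /sP cP ->]//|/sP bP].
  by exists (reflection G (sroot j) b); rewrite ?reflectionK.
have S0 : \sum_(b <- P) <<b, sroot j>> = 0.
  have : \sum_(b <- P) <<b, sroot j>> = - \sum_(b <- P) <<b, sroot j>>.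
    rewrite -{1}(perm_big _ pP) big_map -sumrN; apply: eq_bigr => b _.
    by rewrite reflectionE pairingB pairingZ pairing_coroot //; ring.
  by set S := \sum_(_ <- _) _; lia.
have : <<rho D *+ 2, sroot j>> = 2.
  rewrite (rho_half_sum D) pairing_sum -big_filter (bigD1_seq (sroot j)) /=.
  - by rewrite big_filter_cond -big_filter S0 addr0 pairing_coroot.
  - by rewrite mem_filter jG andbT.
  - by rewrite filter_uniq ?roots_uniq.
by rewrite -scaler_nat pairingZ; lia.
Qed.

Lemma basic_unit : B \in unitmx.
Proof.
rewrite unitmxE unitfE; apply/negP => /det0P[v v0 vB].
have : v^T != 0 by rewrite trmx_eq0.
by move=> /(basic_pos D); rewrite /bform trmxK vB mul0mx mxE ltxx.
Qed.

(** Invariance under the reflection in a forces B to map the coroot of a to a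
    multiple of a. *)
Lemma coroot_flat a : a \in roots G ->
  2 *: ((coR a)^T *m B) = bnorm (coroot G a) *: map_mx intr a.
Proof.
move=> aG; apply/rowP => j; have := bform_coroot (delta_mx j 0) aG.
rewrite /bform /pairing -colE -[(_ *m delta_mx j 0)]colE.
have c00 (A : 'rV[R]_l) : col j A 0 0 = A 0 j by rewrite mxE.
by rewrite !c00 => E; rewrite [LHS]mxE [RHS]mxE E mulrC.
Qed.

Lemma pairing_bsharp a (mu : 'rV[R]_l) : a \in roots G ->
  bnorm (coroot G a) * pairing (map_mx intr a) (bsharp B mu) =
  2 * pairing mu (coR a).
Proof.
move=> aG; pose v : 'rV[R]_l := map_mx intr a.
have E : 2 *: ((coR a)^T *m B) = bnorm (coroot G a) *: v by exact: coroot_flat.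
have vE : bnorm (coroot G a) *: (v *m invmx B) = 2 *: (coR a)^T.
  by rewrite scalemxAl -E -scalemxAl mulmxK ?basic_unit.
have -> : pairing v (bsharp B mu) = pairing mu (v *m invmx B)^T.
  rewrite /pairing /bsharp; transitivity ((mu *m invmx B *m v^T)^T 0 0).
    by rewrite [in RHS]trmx_mul trmxK.
  by rewrite [LHS]mxE trmx_mul trmx_inv (basic_sym D) mulmxA.
rewrite /pairing; transitivity ((mu *m (bnorm (coroot G a) *: (v *m invmx B))^T) 0 0).
  by rewrite linearZ /= -scalemxAr [in RHS]mxE.
by rewrite vE linearZ /= -scalemxAr [in LHS]mxE trmxK.
Qed.

Lemma bform_coroot_int a (xi : 'cV[int]_l) : a \in roots G ->
  2 * bform B (coR a) (map_mx intr xi) = (pairing a xi)%:~R * bnorm (coroot G a).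
Proof. by move=> aG; rewrite bform_coroot // pairing_intr. Qed.

Lemma bnormB_coroot a (xi : 'cV[int]_l) : a \in roots G ->
  bnorm (xi - coroot G a) =
  bnorm xi + (1 - (pairing a xi)%:~R) * bnorm (coroot G a).
Proof.
move=> aG; have := bform_coroot_int xi aG.
rewrite map_mxB bformBr ![bform B (_ - _) _]bformC !bformBr.
by rewrite [bform B (map_mx intr xi) (coR a)]bformC; lra.
Qed.

Lemma bnorm_coroot_gt0 a : a \in roots G -> 0 < bnorm (coroot G a).
Proof.
move=> aG; apply: basic_pos; apply/eqP => a0.
have := bform_coroot_int (coroot G a) aG; rewrite (pairing_coroot aG).
have /eqP := pairing_intr a (coroot G a).
rewrite a0 /pairing mulmx0 mxE -/(<<a, a>>) pairing_coroot //.
by rewrite eq_sym pnatr_eq0.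
Qed.

(** Positivity of B yields a simple coroot whose coefficient in xi has the sign
    of its pairing with xi. Reflecting lowers this coefficient in absolute
    value and keeps the hypothesis, so by induction the reflected vector is 0. *)
Lemma minuscule_eq0 (xi : 'cV[int]_l) :
  {in roots G, forall a, `|pairing a xi| <= 1} -> xi = 0.
Proof.
have [n En] := coroot_span xi.
have [m] := ubnP (\sum_i `|n i|%N)%N; elim: m xi n En => // m IH xi n En nm xi1.
have [//|xi0] := eqVneq xi 0.
have xiR : map_mx intr xi != 0 :> 'cV[R]_l.
  apply: contra xi0 => /eqP/matrixP E; apply/eqP/matrixP => i j.
  by have := E i j; rewrite !mxE => /eqP; rewrite intr_eq0 => /eqP.
have [i ni] : exists i, 0 < n i * pairing (sroot i) xi.
  apply: contrapT => H; have := basic_pos D xiR.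
  rewrite {1}En raddf_sum bform_suml ltNge sumr_le0 // => i _.
  have iG := simple_root_in D i.
  rewrite [X in bform B X _](_ : _ = (n i)%:~R *: coR (sroot i)); last first.
    by apply/matrixP => j r; rewrite !mxE /= intrM.
  rewrite bformZl -(pmulr_rle0 _ (_ : 0 < 2)) // mulrCA bform_coroot_int //.
  rewrite mulrA -intrM pmulr_lle0 ?bnorm_coroot_gt0 // lerz0 leNgt.
  by apply/negP => ?; apply: H; exists i.
have iG := simple_root_in D i.
set p := pairing _ _ in ni; have p1 : `|p| <= 1 by exact: xi1.
pose eta := xi - p *: coroot G (sroot i).
have etaE a : pairing a eta = pairing (reflection G (sroot i) a) xi.
  by rewrite pairingBr pairingZr reflectionE pairingB pairingZ mulrC.
have eta0 : eta = 0.
  apply: (IH _ (fun j => n j - (if j == i then p else 0))).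
  - rewrite /eta En; under [RHS]eq_bigr do rewrite scalerBl.
    rewrite sumrB; congr (_ - _); rewrite (bigD1 i) //= eqxx big1 ?addr0 //.
    by move=> j /negbTE ->; rewrite scale0r.
  - move: nm; rewrite (bigD1 i) //= [in X in _ -> X](bigD1 i) //= eqxx.
    have -> : (\sum_(j < l | j != i) `|(n j - (if j == i then p else 0))%R| =
               \sum_(j < l | j != i) `|n j|)%N.
      by apply: eq_bigr => j /negbTE ->; rewrite subr0.
    by set S := (\sum_(_ < _ | _) _)%N; nia.
  - by move=> a aG; rewrite etaE xi1 ?reflection_in.
have xiE : xi = p *: coroot G (sroot i) by apply/eqP; rewrite -subr_eq0; apply/eqP.
(* So xi is p times a coroot, and its pairing p with the root is 2 p. *)
have : p = p * 2.
  by rewrite {1}/p {1}xiE pairingZr (pairing_coroot iG).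
by lia.
Qed.

Section Simple.
Hypothesis hsimple : simple_group G.

(** The invariant forms ip and B are proportional because the root system is
   irreducible. *)
Lemma forms_proportional a : a \in roots G ->
  (ip a a)%:~R * bnorm (coroot G a) =
  (ip theta theta)%:~R * bnorm (coroot G theta).
Proof.
pose f a := (ip a a)%:~R * bnorm (coroot G a).
have [_ H] := hsimple; move: a; pose P a := f a == f theta.
suff: {in roots G, forall a, P a} by move=> + a aG => /(_ a aG) /eqP.
apply: H; first by exists theta; rewrite ?alpha_max_in /P.
move=> a b aG bG /eqP Pa Pb; apply: contraNeq Pb => ab; rewrite /P -Pa.
have Ei : <<a, b>> * ip b b = <<b, a>> * ip a a.
  by rewrite -!ip_root // ipC.
have EB : (<<a, b>>)%:~R * bnorm (coroot G a) = (<<b, a>>)%:~R * bnorm (coroot G b).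
  by rewrite -!bform_coroot_int // bformC.
have {}Ei : (<<a, b>>)%:~R * (ip b b)%:~R = (<<b, a>>)%:~R * (ip a a)%:~R :> R.
  by rewrite -!intrM Ei.
have ab0 : (<<a, b>>)%:~R != 0 :> R by rewrite intr_eq0.
have ba0 : (<<b, a>>)%:~R != 0 :> R.
  rewrite intr_eq0; apply/eqP => ba0; move/eqP: EB.
  by rewrite ba0 mul0r mulf_eq0 (negbTE ab0) gt_eqF ?bnorm_coroot_gt0.
apply/eqP/(mulfI ab0)/(mulfI ba0); rewrite /f.
transitivity ((<<a, b>>)%:~R * (ip b b)%:~R * ((<<b, a>>)%:~R * bnorm (coroot G b))).
  by ring.
by rewrite Ei -EB; ring.
Qed.

(** A shortest vector is a coroot: otherwise subtracting a coroot with which it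
    pairs to 2 or more would shorten it by bnormB_coroot, so that minuscule_eq0
    would apply. Its square length is then at least that of the coroot of
    theta, because theta is long. *)
Lemma bnorm_theta : bnorm (coroot G theta) = 2.
Proof.
have tG := alpha_max_in D; have [xi xi0 xi2] := basic_min_attained D.
have [a aG xiE] : exists2 a, a \in roots G & xi = coroot G a.
  apply: contrapT => H; move/eqP: xi0; apply; apply: minuscule_eq0.
  have {}H a : a \in roots G -> pairing a xi <= 1.
    move=> aG; rewrite leNgt; apply/negP => a1; apply: H; exists a => //.
    apply/eqP; rewrite -subr_eq0; apply: contraT => /(basic_min D).
    rewrite (bnormB_coroot _ aG) xi2.
    have : 2 <= (pairing a xi)%:~R :> R by rewrite (ler_int _ 2).
    have := bnorm_coroot_gt0 aG; set z := (_)%:~R; set y := bform _ _ _; nra.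
  by move=> a aG; have := H _ aG; have := H _ (rootN aG); rewrite pairingN; lia.
have a2 : bnorm (coroot G a) = 2 by rewrite -xiE.
have := forms_proportional aG; rewrite a2 => E.
have t0 : coroot G theta != 0.
  apply/eqP => t0; have := bnorm_coroot_gt0 tG.
  by rewrite t0 map_mx0 bform0l ltxx.
have := basic_min D t0; have : (ip a a)%:~R <= (ip theta theta)%:~R :> R.
  by rewrite ler_int theta_long.
have : 0 < (ip theta theta)%:~R :> R by rewrite ltr0z ip_root_gt0.
move: E; set x := (ip a a)%:~R; set y := (ip theta theta)%:~R.
by set z := bform _ _ _; nra.
Qed.

Lemma ip_bnorm a : a \in roots G ->
  (ip a a)%:~R * bnorm (coroot G a) = 2 * (ip theta theta)%:~R.
Proof. by move=> aG; rewrite forms_proportional // bnorm_theta mulrC. Qed.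

Lemma dual_coxeter_pairing : (dual_coxeter D)%:Z = 1 + <<rho D, theta>>.
Proof.
have tG := alpha_max_in D.
have : (dual_coxeter D)%:R = (1 + <<rho D, theta>>)%:~R :> R.
  rewrite (dual_coxeterE D) rmorphD; congr (_ + _).
  have := pairing_bsharp (map_mx intr (rho D)) tG.
  by rewrite bnorm_theta pairing_intr => /mulfI ->.
by rewrite pmulrn => /eqP; rewrite eqr_int => /eqP.
Qed.

Local Notation h := (dual_coxeter D)%:Z.

(** This is what the dual Coxeter number is for: at that level, rho plays for
    the affine root system the part that it plays for the finite one. *)
Lemma apairing_rho i : apairing D h i (rho D) = 1.
Proof.
rewrite /apairing; case: (unliftP ord0 i) => [j ->|->].
  by rewrite aroot_lift rho_pairing addr0.
rewrite aroot0 corootN ?alpha_max_in // eqxx mulr1n dual_coxeter_pairing.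
by rewrite addrCA addNr addr0.
Qed.

Lemma dual_coxeter_gt0 : 0 < h.
Proof.
have tG := alpha_max_in D; have [t [Et coef]] := root_coefs.
rewrite dual_coxeter_pairing ltr_pwDl // -(pmulr_lge0 _ (ip_root_gt0 tG)).
rewrite -ip_root // mulr_ge0 // ipC Et ip_suml sumr_ge0 // => i _.
have [u [Eu tu _]] := coef _ tG.
rewrite ipZl mulr_ge0 //; first by apply: le_trans (tu i).
by rewrite -(pmulr_rge0 _ (_ : 0 < 2)) // ip_sroot rho_pairing mul1r ip_ge0.
Qed.

(** * The affine Weyl group *)

(** By affroot_ind, the reflections in positive affine roots are conjugates of
    simple ones. The factor ip (acomb c) (acomb c) clears the denominator of
    the affine coroot. *)
Lemma affroot_word (I : {set 'I_l.+1}) c : affroot c -> (forall j, 0 <= c j) ->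
  (forall j, j \in I -> c j = 0) -> exists2 s, off I s & forall n x,
    ip (acomb c) (acomb c) *: word_act D s n x =
    ip (acomb c) (acomb c) *: x - acf c n x *: acomb c.
Proof.
move: c; apply: affroot_ind => [i iI|i c iI cG c0 cI [s sI sE]].
  exists [:: i] => [|n x]; first by rewrite /= iI.
  by rewrite acomb_cdelta acf_cdelta /= /asigma scalerBr scalerA.
exists (i :: rcons s i) => [|n x]; first by rewrite /= all_rcons iI.
rewrite word_act_cons -cats1 word_act_cat [word_act D [:: i] n x]/=.
set y := asigma D i n x; have := sE n y; rewrite acomb_crefl.
rewrite ip_reflection ?aroot_in // acf_crefl /y asigmaK -/y => E.
set z := word_act D s n y in E *.
have -> : asigma D i n z = x + reflection G (alpha i) (z - y).
  have {1}-> : z = y + (z - y) by rewrite addrC subrK.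
  by rewrite -{1}[n]addr0 asigma_level asigma0 /y asigmaK.
rewrite scalerDr -reflectionZ scalerBr E addrAC subrr add0r reflectionN reflectionZ.
by rewrite reflectionK ?aroot_in.
Qed.

(** The affine fundamental weights. The level m is 1 for j = ord0, otherwise
    the coefficient of the j-th simple coroot in the coroot of theta. *)
Lemma fundamental_weight (j : 'I_l.+1) : exists m, exists c : L,
  0 < m /\ forall i, apairing D m i c = (i == j)%:R.
Proof.
case: (unliftP ord0 j) => [r ->|->]; last first.
  exists 1, 0; split=> // i; rewrite /apairing pairing0 add0r.
  by case: eqP => _; rewrite ?mulr1n ?mulr0n.
(* The matrix of the simple coroots is invertible over the integers, and the rows
   of its inverse are the fundamental weights. *)
pose A : 'M[int]_l := \matrix_(i, j) coroot G (sroot j) i 0.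
have [N AN] : exists N : 'M[int]_l, A *m N = 1%:M.
  have /choice[f Hf] : forall i, exists n : 'I_l -> int,
      delta_mx i 0 = \sum_j n j *: coroot G (sroot j).
    by move=> i; exact: coroot_span.
  exists (\matrix_(i, j) f j i); apply/matrixP => a b.
  have /matrixP/(_ a 0) := Hf b; rewrite !mxE eqxx andbT summxE => ->.
  by apply: eq_bigr => i _; rewrite !mxE mulrC.
have NA i : <<row r N, sroot i>> = (i == r)%:R.
  have /matrixP/(_ r i) := mulmx1C AN; rewrite [RHS]mxE eq_sym => <-.
  rewrite /pairing !mxE; apply: eq_bigr => t _; by rewrite !mxE.
have tG := alpha_max_in D; have [t [Et coef]] := root_coefs.
have tr : 0 < t r.
  have [e [Ee te _]] := coef _ (simple_root_in D r).
  have er : 1 = e r.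
    have := @simple_root_inj (fun i => (i == r)%:R) e _ r; rewrite eqxx; apply.
    rewrite -Ee (bigD1 r) //= eqxx scale1r big1 ?addr0 // => i /negbTE ->.
    by rewrite scale0r.
  by have := te r; rewrite -er; lia.
exists <<row r N, theta>>, (row r N); split.
  rewrite -(pmulr_lgt0 _ (ip_root_gt0 tG)) -ip_root // ipC Et ip_suml.
  rewrite mulr_sumr (bigD1 r) //= big1 ?addr0.
    by rewrite ipZl mulrCA ip_sroot NA eqxx mul1r mulr_gt0 ?ip_sroot_gt0.
  by move=> i /negbTE ir; rewrite ipZl mulrCA ip_sroot NA ir mul0r mulr0.
move=> i; rewrite /apairing; case: (unliftP ord0 i) => [q ->|->].
  by rewrite aroot_lift NA addr0 (inj_eq lift_inj).
by rewrite aroot0 corootN // eqxx mulr1n addNr.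
Qed.

Definition refl_mx a : 'M[int]_l := 1%:M - coroot G a *m a.

Lemma mul_refl_mx a (x : L) : x *m refl_mx a = reflection G a x.
Proof.
rewrite /refl_mx mulmxBr mulmx1 mulmxA [x *m coroot G a]mx11_scalar.
by rewrite mul_scalar_mx.
Qed.

(** Two factorizations of a block matrix give det (1 - u a) = det (1 - a u), the
    latter being of size 1. *)
Lemma det_refl_mx a : a \in roots G -> \det (refl_mx a) = -1.
Proof.
move=> aG; pose u := coroot G a.
have au : a *m u = 2%:M by rewrite [LHS]mx11_scalar -/(<<a, a>>) pairing_coroot.
have E : block_mx (refl_mx a) u 0 (1%:M : 'M[int]_1) *m block_mx 1%:M 0 a 1%:M =
         block_mx 1%:M 0 a 1%:M *m block_mx (1%:M : 'M[int]_l) u 0 (1%:M - a *m u).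
  rewrite !mulmx_block !(mulmx1, mul1mx, mulmx0, mul0mx, addr0, add0r).
  by rewrite /refl_mx subrK addrC subrK.
have := congr1 determinant E; rewrite !det_mulmx !(det_lblock, det_ublock) !det1.
rewrite !mulr1 !mul1r => ->; rewrite au.
by rewrite (_ : 1%:M - 2%:M = (-1)%:M) ?det_scalar1 // -raddfB.
Qed.

Fixpoint word_mx (s : seq 'I_l.+1) : 'M[int]_l :=
  if s is i :: s' then word_mx s' *m refl_mx (alpha i) else 1%:M.

Lemma mul_word_mx s (x : L) : x *m word_mx s = word_act D s 0 x.
Proof.
elim: s x => [|i s IH] x /=; first by rewrite mulmx1.
by rewrite mulmxA IH mul_refl_mx asigma0.
Qed.

Lemma det_word_mx s : \det (word_mx s) = (-1) ^+ size s.
Proof.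
elim: s => [|i s IH] /=; first by rewrite det1 expr0.
by rewrite det_mulmx IH det_refl_mx ?aroot_in // exprSr.
Qed.

(** The parity of a word is the determinant of its linear part. *)
Lemma word_parity s s' : word_act D s = word_act D s' ->
  (-1) ^+ size s = (-1) ^+ size s' :> int.
Proof.
move=> E; rewrite -!det_word_mx; congr (\det _); apply/row_matrixP => i.
by rewrite !rowE !mul_word_mx E.
Qed.

Lemma waffP (w : waff D) : exists s, val w = word_act D s.
Proof. by have /asboolP := valP w. Qed.

Definition wof s : waff D := exist _ (word_act D s) (asboolT (ex_intro _ s erefl)).

Lemma val_wof s : val (wof s) = word_act D s. Proof. by []. Qed.

Definition wone := wof [::].

Lemma wmul_subproof (u w : waff D) :
  `[< exists s, (fun n x => val u n (val w n x)) = word_act D s >].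
Proof.
apply/asboolP; have [s us] := waffP u; have [t wt] := waffP w; exists (s ++ t).
by apply/funext => n; apply/funext => x; rewrite us wt word_act_cat.
Qed.

Definition wmul (u w : waff D) : waff D :=
  exist _ (fun n x => val u n (val w n x)) (wmul_subproof u w).

Lemma wmulE u w n x : val (wmul u w) n x = val u n (val w n x). Proof. by []. Qed.

Definition winve (w : waff D) : waff D := wof (rev (sval (cid (waffP w)))).

Implicit Types (u w : waff D).

Lemma wactK w n : cancel (val w n) (val (winve w) n).
Proof. by rewrite /winve; case: cid => s /= -> x; exact: word_act_revK. Qed.

Lemma wactVK w n : cancel (val (winve w) n) (val w n).
Proof. by rewrite /winve; case: cid => s /= -> x; exact: word_act_rev. Qed.

Lemma waff_eqP (u w : waff D) : (forall n x, val u n x = val w n x) -> u = w.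
Proof. by move=> E; apply: val_inj; apply/funext => n; apply/funext => x. Qed.

Lemma wmulK w : cancel (wmul w) (wmul (winve w)).
Proof. by move=> u; apply: waff_eqP => n x; rewrite !wmulE wactK. Qed.

Lemma wmulVK w : cancel (wmul (winve w)) (wmul w).
Proof. by move=> u; apply: waff_eqP => n x; rewrite !wmulE wactVK. Qed.

Lemma wmulrK w : cancel (wmul^~ w) (wmul^~ (winve w)).
Proof. by move=> u; apply: waff_eqP => n x; rewrite !wmulE wactVK. Qed.

Lemma wmulrVK w : cancel (wmul^~ (winve w)) (wmul^~ w).
Proof. by move=> u; apply: waff_eqP => n x; rewrite !wmulE wactK. Qed.

Lemma winveK : involutive winve.
Proof.
move=> w; apply: waff_eqP => n x.
by apply: (can_inj (wactK (winve w) n)); rewrite wactK wactVK.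
Qed.

Lemma wact_level w n m x y : val w (n + m) (x + y) = val w n x + val w m y.
Proof. by have [s ->] := waffP w; rewrite word_act_level. Qed.

Lemma wactD w n x y : val w n (x + y) = val w n x + val w 0 y.
Proof. by rewrite -wact_level addr0. Qed.

Lemma wactZ w n c x : val w (c * n) (c *: x) = c *: val w n x.
Proof. by have [s ->] := waffP w; rewrite word_actZ. Qed.

Lemma wactZ0 w c x : val w 0 (c *: x) = c *: val w 0 x.
Proof. by rewrite -{1}[0](mulr0 c) wactZ. Qed.

Lemma wact00 w : val w 0 0 = 0.
Proof. by rewrite -[X in val w 0 X](scale0r (0 : L)) wactZ0 scale0r. Qed.

Lemma ip_wact w x y : ip (val w 0 x) (val w 0 y) = ip x y.
Proof. by have [s ->] := waffP w; rewrite ip_word_act. Qed.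

Lemma wsign_word w s : val w = word_act D s -> wsign w = (-1) ^+ size s.
Proof.
rewrite /wsign /Defs.wlength; case: (ex_minnP (waff_word w)) => r /asboolP[t <- wt] _ ws.
by apply: word_parity; rewrite -wt ws.
Qed.

Lemma wsign_of s : wsign (wof s) = (-1) ^+ size s. Proof. exact: wsign_word. Qed.

Lemma wsignM u w : wsign (wmul u w) = wsign u * wsign w.
Proof.
have [s us] := waffP u; have [t wt] := waffP w.
rewrite (wsign_word us) (wsign_word wt) -exprD -size_cat; apply: wsign_word.
by apply/funext => n; apply/funext => x; rewrite wmulE us wt word_act_cat.
Qed.

Lemma wsign_sq w : wsign w * wsign w = 1.
Proof. by rewrite /wsign -expr2 sqrr_sign. Qed.

Lemma wsignV w : wsign (winve w) = wsign w.
Proof.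
rewrite -[LHS]mulr1 -(wsign_sq w) mulrA -wsignM.
have -> : wmul (winve w) w = wof [::] by apply: waff_eqP => n x; rewrite wmulE wactK.
by rewrite wsign_of expr0 mul1r.
Qed.

Lemma wsign_neq0 w : wsign w != 0.
Proof. by apply/eqP => w0; have := wsign_sq w; rewrite w0. Qed.

Local Notation parab := (@parabolic R l G D).

Lemma parabolic1 I : parab I wone.
Proof. by exists [::]. Qed.

Lemma parabolicM I u w : parab I u -> parab I w -> parab I (wmul u w).
Proof.
move=> [s sI us] [t tI wt]; exists (s ++ t); first by rewrite all_cat sI.
by apply/funext => n; apply/funext => x; rewrite wmulE us wt word_act_cat.
Qed.

Lemma parabolicV I w : parab I w -> parab I (winve w).
Proof.
move=> [s sI ws]; exists (rev s); first by rewrite all_rev.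
apply/funext => n; apply/funext => x.
by rewrite -{1}[x](word_act_rev s n) -ws wactK.
Qed.

Lemma parabolic_sub (I J : {set 'I_l.+1}) w : J \subset I ->
  parab I w -> parab J w.
Proof.
move=> JI [s sI ws]; exists s => //; apply: sub_all sI => i.
by apply: contra => /(fintype.subsetP JI).
Qed.

Lemma parabolic_wof (I : {set 'I_l.+1}) i : i \notin I -> parab I (wof [:: i]).
Proof. by move=> iI; exists [:: i]; rewrite ?val_wof //= iI. Qed.

Lemma parabolic_set0 : parab finset.set0 = setT.
Proof.
apply/seteqP; split=> // w _; have [s ws] := waffP w; exists s => //.
by apply/allP => i _; rewrite inE.
Qed.

Lemma reindex_parabolicl (V : zmodType) I (F : waff D -> V) u : parab I u ->
  \sum_(w \in parab I) F w = \sum_(w \in parab I) F (wmul u w).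
Proof.
move=> uI; apply: reindex_fsbig; split=> [w wI|w w' _ _|w wI].
- exact: parabolicM.
- by move/(congr1 (wmul (winve u))); rewrite !wmulK.
- exists (wmul (winve u) w); rewrite ?wmulVK //.
  by apply: parabolicM => //; exact: parabolicV.
Qed.

Lemma reindex_parabolicr (V : zmodType) I (F : waff D -> V) u : parab I u ->
  \sum_(w \in parab I) F w = \sum_(w \in parab I) F (wmul w u).
Proof.
move=> uI; apply: reindex_fsbig; split=> [w wI|w w' _ _|w wI].
- exact: parabolicM.
- exact: (can_inj (wmulrK u)).
- exists (wmul w (winve u)); rewrite ?wmulrVK //.
  by apply: parabolicM => //; exact: parabolicV.
Qed.

Lemma reindex_parabolicV (V : zmodType) I (F : waff D -> V) :
  \sum_(w \in parab I) F w = \sum_(w \in parab I) F (winve w).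
Proof.
apply: reindex_fsbig; split=> [w wI|w w' _ _|w wI].
- exact: parabolicV.
- exact: inv_inj winveK _ _.
- by exists (winve w); rewrite ?winveK //; exact: parabolicV.
Qed.

(** The reduced words of dominant_unique show that W_I acts freely on its open
    chambers. *)
Lemma parabolic_dominant I n x w : parab I w ->
  (forall j, j \notin I -> 0 < apairing D n j x) ->
  (forall j, j \notin I -> 0 < apairing D n j (val w n x)) -> w = wone.
Proof.
move=> [s sI ws] x0; rewrite ws => wx0; apply: val_inj.
by rewrite ws (dominant_unique sI x0 wx0).
Qed.

Lemma waff_rho_inj : injective (fun w : waff D => val w h (rho D)).
Proof.
move=> u w E; have rp j : j \notin finset.set0 -> 0 < apairing D h j (rho D).
  by rewrite apairing_rho.
have : wmul (winve w) u = wone.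
  apply: (@parabolic_dominant finset.set0 h (rho D)) => //.
    by rewrite parabolic_set0.
  by rewrite wmulE E wactK.
by move=> /(congr1 (wmul w)); rewrite wmulVK => ->; apply: waff_eqP.
Qed.

Lemma affine_ball_finite n y N : n != 0 ->
  finite_set [set z : L | ip (n *: z - y) (n *: z - y) <= N]%classic.
Proof.
move=> n0; apply: (@finite_preimage _ _ _ (fun z => n *: z - y) _
  (ip_finite_ball hsc N)) => z z' _ _ /addIr /rowP E.
by apply/rowP => j; have := E j; rewrite !mxE; exact: mulfI.
Qed.

(** The weight h x - n rho is transformed by the linear part of w, an isometry.
    This confines w rho to a ball, and w is determined by w rho. *)
Lemma waff_fiber_finite n x y : n != 0 ->
  finite_set [set w : waff D | val w n x = y]%classic.
Proof.
move=> n0; pose t := h *: x - n *: rho D.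
apply: sub_finite_set (@finite_preimage _ _ _ (fun w : waff D => val w h (rho D)) _
  (affine_ball_finite (h *: y) (ip t t) n0)).
  move=> w /= <-.
  have E : h *: val w n x - n *: val w h (rho D) = val w 0 t.
    apply/eqP; rewrite subr_eq -!wactZ [n * h]mulrC [eqbRHS]addrC -wactD.
    by rewrite /t [_ + (_ - _)]addrC subrK.
  by rewrite -[n *: _ - _]opprB E ipNl ipNr opprK ip_wact.
by move=> u w _ _; exact: waff_rho_inj.
Qed.

(** * Chambers and the distance to the center of the alcove *)

(** The squared distance, up to a factor, from x to n rho / h, an interior
    point of the alcove at level n. This distance filters the complex by finite
    sets. *)
Definition weyl_dist n (x : L) : int := ip (h *: x - n *: rho D) (h *: x - n *: rho D).

Lemma weyl_dist_asigma n i x : weyl_dist n (asigma D i n x) =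
  weyl_dist n x + n * h * ip (alpha i) (alpha i) * apairing D n i x.
Proof.
set a := apairing D n i x; set y := h *: x - n *: rho D.
have E : h *: asigma D i n x - n *: rho D = y - (h * a) *: alpha i.
  by rewrite /asigma -/a scalerBr scalerA addrAC.
have Ey : 2 * ip (alpha i) y = ip (alpha i) (alpha i) * (h * a - n).
  have E1 := ip_apairing n i x; have E2 := ip_apairing h i (rho D).
  rewrite apairing_rho mulr1 in E2; rewrite /y ipBr !ipZr.
  move: E1 E2; rewrite -/a; set d := (_ == _)%:R => E1 E2.
  transitivity (h * (2 * ip (alpha i) x) - n * (2 * ip (alpha i) (rho D))); first by ring.
  have -> : 2 * ip (alpha i) x = ip (alpha i) (alpha i) * a - n * d * ip theta theta.
    by rewrite E1 addrK.
  have -> : 2 * ip (alpha i) (rho D) = ip (alpha i) (alpha i) - h * d * ip theta theta.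
    by rewrite E2 addrK.
  by ring.
rewrite /weyl_dist {}E -/y; clearbody y a.
rewrite ipBl !ipBr !ipZl !ipZr [ip y (alpha i)]ipC.
transitivity (ip y y - h * a * (2 * ip (alpha i) y) +
  h * a * (h * a) * ip (alpha i) (alpha i)).
  by ring.
by rewrite Ey; ring.
Qed.

(** The open I-chamber at level n. *)
Definition sdom (I : {set 'I_l.+1}) n (x : L) :=
  [forall i, (i \notin I) ==> (0 < apairing D n i x)].

Implicit Types (I J : {set 'I_l.+1}) (x y : L) (n : int).

Lemma sdomP I n x : reflect (forall i, i \notin I -> 0 < apairing D n i x) (sdom I n x).
Proof. exact: 'forall_implyP. Qed.

Lemma weyl_dist_ge0 n x : 0 <= weyl_dist n x.
Proof. exact: ip_ge0. Qed.

Lemma weyl_dist_finite n N : finite_set [set x : L | weyl_dist n x <= N]%classic.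
Proof. by apply: affine_ball_finite; rewrite gt_eqF ?dual_coxeter_gt0. Qed.

Section PositiveLevel.
Variable n : int.
Hypothesis n0 : 0 < n.

Let kap0 i : 0 < n * h * ip (alpha i) (alpha i).
Proof. by rewrite !mulr_gt0 ?dual_coxeter_gt0 ?ip_aroot_gt0. Qed.

Lemma weyl_dist_strict I w x : parab I w -> w != wone -> sdom I n x ->
  weyl_dist n x < weyl_dist n (val w n x).
Proof.
move=> [s sI ws] w1 /sdomP x0; have [t tr ts] := reduced_exists sI.
rewrite ws -ts.
apply: (reduced_smono (kap := fun i => n * h * ip (alpha i) (alpha i))) tr _ _ => //.
  by move=> i y _; exact: weyl_dist_asigma.
by apply: contraNneq w1 => t0; apply/eqP/val_inj; rewrite ws -ts t0.
Qed.

(** Reflecting in a wall that separates x from the alcove lowers weyl_dist. *)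
Lemma dominant_rep (I : {set 'I_l.+1}) x : exists2 w, parab I w &
  forall i, i \notin I -> 0 <= apairing D n i (val w n x).
Proof.
have [m] := ubnP (absz (weyl_dist n x)); elim: m x => // m IH x xm.
have [[i [iI ai]]|H] := pselect (exists i, i \notin I /\ apairing D n i x < 0).
  have [|w wI wx] := IH (asigma D i n x).
    have := weyl_dist_ge0 n x; have := weyl_dist_ge0 n (asigma D i n x).
    have := kap0 i; move: xm; rewrite weyl_dist_asigma.
    move: (weyl_dist n x) (n * h * _) (apairing D n i x) ai => u v a; nia.
  exists (wmul w (wof [:: i])) => //.
  by apply: parabolicM => //; exact: parabolic_wof.
exists wone => [|i iI]; first exact: parabolic1.
by rewrite leNgt; apply/negP => ai; apply: H; exists i.
Qed.

Definition antif (I : {set 'I_l.+1}) (f : L -> int) :=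
  forall w, parab I w -> forall x, f (val w n x) = wsign w * f x.

Lemma antif_wall I f i x : antif I f -> i \notin I -> apairing D n i x = 0 -> f x = 0.
Proof.
move=> fI iI ix; have := fI _ (parabolic_wof iI) x.
rewrite wsign_of expr1 val_wof /= /asigma ix scale0r subr0.
by lia.
Qed.

(** Anti-invariants vanish on the walls, and every orbit meets the closed
    chamber. *)
Lemma antif_ext I f g : antif I f -> antif I g ->
  (forall x, sdom I n x -> f x = g x) -> f = g.
Proof.
move=> fI gI E; apply/funext => x; have [w wI wx] := dominant_rep I x.
apply: (mulfI (wsign_neq0 w)); rewrite -fI // -gI //.
have [|] := boolP (sdom I n (val w n x)); first exact: E.
move=> /sdomP/existsNP[i /not_implyP[iI /negP ix]].
have i0 : apairing D n i (val w n x) = 0.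
  by apply/eqP; rewrite eq_le wx // leNgt ix.
by rewrite (antif_wall fI iI i0) (antif_wall gI iI i0).
Qed.

(** * Skew-symmetrization *)

Definition asum (J : {set 'I_l.+1}) (f : L -> int) (x : L) : int :=
  \sum_(w \in parab J) wsign w * f (val w n x).

Lemma asum_antif J f : antif J (asum J f).
Proof.
move=> u uJ x; rewrite [in RHS]/asum (reindex_parabolicr _ uJ) mulr_fsumr.
apply: eq_fsbigr => w _; rewrite wsignM wmulE.
by rewrite [wsign w * wsign u]mulrC !mulrA wsign_sq mul1r.
Qed.

Definition fin_supp (f : L -> int) := finite_set [set x | f x != 0]%classic.

Definition cut I (f : L -> int) x := if sdom I n x then f x else 0.

Lemma fin_supp_cut I f : fin_supp f -> fin_supp (cut I f).
Proof.
by apply: sub_finite_set => x; rewrite /= /cut; case: ifP; rewrite ?eqxx.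
Qed.

Lemma asum_cut I f : antif I f -> asum I (cut I f) = f.
Proof.
move=> fI; apply: antif_ext (@asum_antif I _) fI _ => x xI.
rewrite /asum (fsbigE [:: wone]) //.
- rewrite big_mkcond big_seq1 ifT ?inE; last exact: parabolic1.
  by rewrite wsign_of expr0 mul1r /cut xI.
- by move=> w /=; rewrite inE => /eqP ->; exact: parabolic1.
- move=> w wI; rewrite inE => /eqP w1; rewrite /cut; case: ifP; rewrite ?mulr0 //.
  by move=> /sdomP wx; case: w1; apply: parabolic_dominant wI _ wx; exact/sdomP.
Qed.

Lemma asum_supp J f x : fin_supp f ->
  finite_set (parab J `&` [set w | wsign w * f (val w n x) != 0])%classic.
Proof.
move=> ff; apply: (@sub_finite_set _ _
  (\bigcup_(y in [set y | f y != 0]) [set w : waff D | val w n x = y])%classic).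
  move=> w [_ /= wf]; exists (val w n x) => //=.
  by apply: contraNneq wf => ->; rewrite mulr0.
apply: bigcup_finite => // y _; apply: waff_fiber_finite.
by rewrite gt_eqF.
Qed.

(** The subgroup fixes an affine fundamental weight. *)
Lemma parabolic_finite I : I != finset.set0 -> finite_set (parab I).
Proof.
case/set0Pn=> j jI; have [m [c [m0 mc]]] := fundamental_weight j.
apply: sub_finite_set (waff_fiber_finite c c (_ : m != 0)); last by rewrite gt_eqF.
move=> w [s sI ws]; rewrite /mkset ws {w ws}; elim: s sI => //= i s IH /andP[iI /IH ->].
rewrite /asigma mc; case: eqP => [ij|_]; first by rewrite ij jI in iI.
by rewrite scale0r subr0.
Qed.

Lemma parabolic_order_gt0 I : I != finset.set0 -> (0 < parabolic_order D I)%N.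
Proof.
move=> /parabolic_finite Ifin; rewrite /parabolic_order cardfs_gt0.
apply/fset0Pn; exists wone; rewrite in_fset_set // inE; exact: parabolic1.
Qed.

Lemma sum_parabolic_const I (c : int) : I != finset.set0 ->
  \sum_(w \in parab I) c = (parabolic_order D I)%:Z * c.
Proof.
move=> /parabolic_finite Ifin; rewrite fsbig_finite // big_const_seq count_predT.
by rewrite iter_addr_0 /parabolic_order -mulr_natl natz.
Qed.

(** An element of the subgroup W_I can be absorbed into the sum over W_J. *)
Lemma asum_trans I J f : I != finset.set0 -> J \subset I -> fin_supp f ->
  asum J (asum I f) = (fun x => (parabolic_order D I)%:Z * asum J f x).
Proof.
move=> I0 JI ff; apply/funext => x; have Ifin := parabolic_finite I0.
rewrite /asum.
transitivity (\sum_(w \in parab J) \sum_(u <- fset_set (parab I))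
    wsign u * wsign w * f (val u n (val w n x))).
  apply: eq_fsbigr => w _; rewrite fsbig_finite // mulr_sumr.
  by apply: eq_bigr => u _; rewrite mulrA [wsign w * _]mulrC.
have uJ u : u \in fset_set (parab I) -> parab J u.
  by rewrite in_fset_set // inE => /(parabolic_sub JI).
rewrite fsum_seq; last first.
  move=> u /uJ uJ'.
  apply: sub_finite_set (@finite_preimage _ _ _ (wmul u) _ (asum_supp J x ff)).
    move=> w [wJ wf]; split; first exact: parabolicM.
    by rewrite /mkset wsignM wmulE.
  by move=> w w' _ _; exact: (can_inj (wmulK u)).
rewrite -sum_parabolic_const // fsbig_finite //.
rewrite big_seq [RHS]big_seq; apply: eq_bigr => u /uJ uJ'.
rewrite [RHS](reindex_parabolicl _ uJ'); apply: eq_fsbigr => w _.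
by rewrite wsignM wmulE.
Qed.

(** The value at x of the skew-symmetrization from W_I to W_J, divided by the order
   of W_I: each coset of W_I in W_J contributes through its only element that moves
   x into the open I-chamber. *)
Definition ind I J (f : L -> int) := asum J (cut I f).

Lemma asum_ind I J f : I != finset.set0 -> J \subset I -> fin_supp f -> antif I f ->
  asum J f = (fun x => (parabolic_order D I)%:Z * ind I J f x).
Proof.
move=> I0 JI ff fI; rewrite -{1}(asum_cut fI) asum_trans //.
exact: fin_supp_cut.
Qed.

(** * Linearity over the representation ring *)

Lemma winv_wact (chi : grpring L) w x : chi \in winv G -> chi (val w 0 x) = chi x.
Proof.
move=> /asboolP H; have [s ->] := waffP w; elim: s => //= i s <-.
by rewrite asigma0 H ?aroot_in.
Qed.

Lemma conv_wact (f : grpring L) (g : L -> int) w m p x :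
  (forall y, f (val w m y) = f y) ->
  conv f g (val w (m + p) x) = conv f (fun y => g (val w p y)) x.
Proof.
move=> fw; rewrite (@convEw _ [fset val w m y | y in finsupp f]%fset); last first.
  apply/fsubsetP => y yf; apply/imfsetP; exists (val (winve w) m y); last by rewrite wactVK.
  by rewrite /= mem_finsupp -fw wactVK -mem_finsupp.
rewrite big_imfset /=; last by move=> y z _ _; exact: (can_inj (wactK w m)).
rewrite /conv; apply: eq_bigr => y _; rewrite fw; congr (_ * g _).
apply/eqP; rewrite subr_eq; apply/eqP.
rewrite -[in LHS](subrK y x) addrC [in LHS]addrC.
by rewrite [m + p]addrC wact_level.
Qed.

Lemma fin_supp_gr (f : grpring L) : fin_supp f.
Proof.
apply: (@sub_finite_set _ _ [set` finsupp f]%classic); last exact: finite_fset.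
by move=> x /=; rewrite mem_finsupp.
Qed.

Lemma asum_conv J (chi : grpring L) (f : L -> int) : chi \in winv G -> fin_supp f ->
  asum J (conv chi f) = conv chi (asum J f).
Proof.
move=> chiW ff; apply/funext => x; rewrite /asum /conv.
transitivity (\sum_(w \in parab J) \sum_(y <- finsupp chi)
    chi y * (wsign w * f (val w n (x - y)))).
  apply: eq_fsbigr => w _; rewrite -[n]add0r.
  have := @conv_wact chi f w 0 n x (fun y => winv_wact w y chiW).
  rewrite /conv => ->; rewrite add0r mulr_sumr.
  by apply: eq_bigr => y _; rewrite mulrCA.
rewrite fsum_seq; first by apply: eq_bigr => y _; rewrite mulr_fsumr.
move=> y _; apply: sub_finite_set (asum_supp J (x - y) ff) => w [wJ /= wf].
by split=> //=; apply: contraNneq wf => ->; rewrite mulr0.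
Qed.

(** * Induction between anti-invariants *)

Lemma sk_wtE I m x y : I != finset.set0 ->
  sk_wt D I m x y = \sum_(w \in parab I) wsign w * (val w m x == y)%:R.
Proof.
move=> /parabolic_finite Ifin; rewrite /sk_wt !fsbig_finite // gr_sumE.
by apply: eq_bigr => w _; rewrite gr_mulzE deltaE.
Qed.

Lemma sum_supp_wact (f : grpring L) w m x :
  \sum_(y <- finsupp f) f y * (val w m y == x)%:R = f (val (winve w) m x).
Proof.
have E y : (val w m y == x) = (y == val (winve w) m x).
  apply/eqP/eqP => [<-|->]; first by rewrite wactK.
  by rewrite wactVK.
have [xf|xf] := boolP (val (winve w) m x \in finsupp f).
  rewrite (bigD1_seq _ xf) ?fset_uniq //= E eqxx mulr1 big1 ?addr0 //.
  by move=> y /negbTE yx; rewrite E yx mulr0.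
rewrite big_seq big1 ?fsfun_dflt // => y yf.
by rewrite E; case: eqP => [yx|]; rewrite ?mulr0 //; rewrite -yx yf in xf.
Qed.

Lemma skE J (f : grmod G) x : J != finset.set0 -> sk D J n f x = asum J f x.
Proof.
move=> J0; rewrite /sk gr_sumE.
transitivity (\sum_(y <- finsupp f) \sum_(w \in parab J)
    f y * (wsign w * (val w n y == x)%:R)).
  by apply: eq_bigr => y _; rewrite gr_mulzE sk_wtE // mulr_fsumr.
have Jf := parabolic_finite J0.
rewrite -fsum_seq; last by move=> y _; apply: sub_finite_set Jf => w [].
rewrite /asum reindex_parabolicV; apply: eq_fsbigr => w _.
rewrite -[w in RHS]winveK -sum_supp_wact winveK wsignV mulr_sumr.
by apply: eq_bigr => y _; rewrite mulrCA.
Qed.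

Lemma sk_affE (f : grmod G) x : sk_aff D n f x = asum finset.set0 f x.
Proof.
rewrite /sk_aff /sk_aff_wt -parabolic_set0.
transitivity (\sum_(y <- finsupp f) \sum_(w \in parab finset.set0)
    f y * (wsign w * (val w n y == x)%:R)).
  apply: eq_bigr => y _; rewrite mulr_fsumr; apply: eq_fsbigr => w _.
  by rewrite mulr_natr.
rewrite -fsum_seq; last first.
  move=> y _; apply: sub_finite_set (waff_fiber_finite y x (_ : n != 0)).
    move=> w [_] H; apply: contrapT => /eqP/negbTE E.
    by move: H; rewrite /mkset E !mulr0 eqxx.
  by rewrite gt_eqF.
rewrite /asum reindex_parabolicV; apply: eq_fsbigr => w _.
rewrite -[w in RHS]winveK -sum_supp_wact winveK wsignV mulr_sumr.
by apply: eq_bigr => y _; rewrite mulrCA.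
Qed.

Lemma sk_indE I J (f : grmod G) x : I != finset.set0 -> J != finset.set0 ->
  J \subset I -> antif I f -> sk_ind D I J n f x = ind I J f x.
Proof.
move=> I0 J0 JI fI; rewrite /sk_ind fsfunE.
have E : sk D J n f x = (parabolic_order D I)%:Z * ind I J f x.
  by rewrite skE // (asum_ind I0 JI (fin_supp_gr f) fI).
have o0 : (parabolic_order D I)%:Z != 0.
  by rewrite eqz_nat -lt0n parabolic_order_gt0.
case: finsuppP => [sk0|_]; last by rewrite E mulKz.
by apply/esym/eqP; rewrite -(mulrI_eq0 _ (mulfI o0)) -E fsfun_dflt.
Qed.

Lemma ind_antif I J f : antif J (ind I J f).
Proof. exact: asum_antif. Qed.

Lemma asum_fin_supp I f : I != finset.set0 -> fin_supp f -> fin_supp (asum I f).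
Proof.
move=> I0 ff; apply: (@sub_finite_set _ _ (\bigcup_(w in parab I)
  ((fun x => val w n x) @^-1` [set y | f y != 0]))%classic).
  move=> x /= fx; apply: contrapT => H; move/eqP: fx; apply.
  rewrite /asum fsbig1 // => w wI; apply/eqP; rewrite mulf_eq0.
  apply/orP; right; apply: contrapT => /negP fw; apply: H; by exists w.
apply: bigcup_finite => [|w _]; first exact: parabolic_finite.
by apply: finite_preimage ff => x y _ _; exact: (can_inj (wactK w n)).
Qed.

Lemma ind_fin_supp I J f : J != finset.set0 -> fin_supp f -> fin_supp (ind I J f).
Proof. by move=> J0 ff; apply: asum_fin_supp => //; exact: fin_supp_cut. Qed.

Lemma asumZ J (c : int) f : asum J (fun x => c * f x) = (fun x => c * asum J f x).
Proof.
apply/funext => x; rewrite /asum mulr_fsumr.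
by apply: eq_fsbigr => w _; rewrite mulrCA.
Qed.

Lemma asum_sum (K : eqType) (r : seq K) J (c : K -> int) (F : K -> L -> int) :
  (forall k, k \in r -> fin_supp (F k)) ->
  asum J (fun x => \sum_(k <- r) c k * F k x) =
  (fun x => \sum_(k <- r) c k * asum J (F k) x).
Proof.
move=> ff; apply/funext => x; rewrite /asum.
transitivity (\sum_(w \in parab J) \sum_(k <- r) c k * (wsign w * F k (val w n x))).
  apply: eq_fsbigr => w _; rewrite mulr_sumr.
  by apply: eq_bigr => k _; rewrite mulrCA.
rewrite fsum_seq; first by apply: eq_bigr => k _; rewrite mulr_fsumr.
move=> k kr; apply: sub_finite_set (asum_supp J x (ff _ kr)) => w [wJ /= wf].
by split=> //=; apply: contraNneq wf => ->; rewrite mulr0.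
Qed.

Lemma ind_sum (K : eqType) (r : seq K) I J (c : K -> int) (F : K -> L -> int) :
  (forall k, k \in r -> fin_supp (F k)) ->
  ind I J (fun x => \sum_(k <- r) c k * F k x) =
  (fun x => \sum_(k <- r) c k * ind I J (F k) x).
Proof.
move=> ff; rewrite /ind -asum_sum; last by move=> k kr; apply: fin_supp_cut; exact: ff.
congr asum; apply/funext => x; rewrite /cut; case: ifP => // _.
by rewrite big1 // => k _; rewrite mulr0.
Qed.

(** Both sides agree after multiplication by the orders of W_J and W_K, by
    asum_trans. *)
Lemma ind_trans I J (K : {set 'I_l.+1}) f : J != finset.set0 -> I \subset J -> J \subset K ->
  fin_supp f -> antif K f -> ind J I (ind K J f) = ind K I f.
Proof.
move=> J0 IJ JK ff fK.
have K0 : K != finset.set0.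
  case/set0Pn: J0 => j jJ; apply/set0Pn; exists j.
  exact: (fintype.subsetP JK).
have Jp := parabolic_order_gt0 J0; have Kp := parabolic_order_gt0 K0.
have IK : I \subset K by apply: fintype.subset_trans IJ JK.
apply/funext => x; apply: (@mulfI _ (parabolic_order D K)%:Z).
  by rewrite eqz_nat -lt0n.
apply: (@mulfI _ (parabolic_order D J)%:Z); first by rewrite eqz_nat -lt0n.
have E := asum_ind J0 IJ (ind_fin_supp K J0 ff) (@ind_antif K J f).
rewrite mulrCA -[in LHS](congr1 (@^~ x) E).
rewrite -(congr1 (@^~ x) (asumZ _ _ _)) -asum_ind // asum_trans //.
by rewrite (congr1 (@^~ x) (asum_ind K0 IK ff fK)).
Qed.

Lemma asumD J f g : fin_supp f -> fin_supp g ->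
  asum J (fun x => f x + g x) = (fun x => asum J f x + asum J g x).
Proof.
move=> ff gg; apply/funext => x; rewrite /asum -fsum_split ?asum_supp //.
- by apply: eq_fsbigr => w _; rewrite mulrDr.
- exact: (asum_supp J x ff).
- exact: (asum_supp J x gg).
Qed.

(** * The boundary operator *)

(** The sign with which the face J of i |: J enters the boundary. *)
Definition esgn (i : 'I_l.+1) J : int := (-1) ^+ #|[set j in J | (j < i)%N]|.

(** The boundary with the augmentation as its component at the empty set. *)
Definition dE (c : chain G) J x : int :=
  \sum_(i | i \notin J) esgn i J * ind (i |: J) J (c (i |: J)) x.

Lemma chains_antif p (c : chain G) I : chains D n p c -> antif I (c I).
Proof.
move=> /(_ I); case: ifP => [_ //|_ ->] w _ x.
by rewrite !gr0E mulr0.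
Qed.

(** The terms are regrouped by the index i removed from I; the position of i in
    I gives the sign. *)
Lemma boundaryE (c : chain G) J x : (forall I, antif I (c I)) ->
  J != finset.set0 -> boundary D n c J x = dE c J x.
Proof.
move=> cI J0; rewrite /boundary ffunE gr_sumE.
transitivity (\sum_(I : {set 'I_l.+1} | (1 < #|I|)%N)
   \sum_(i in I | I :\ i == J) esgn i J * ind I J (c I) x).
  apply: eq_bigr => I I1; rewrite gr_sumE.
  rewrite [RHS]big_enum_val_cond; apply: eq_big => // r /eqP IJ.
  have rI := enum_valP r.
  rewrite gr_mulzE sk_indE //; last first.
  - by rewrite -IJ subD1set.
  - by apply: contraTneq I1 => ->; rewrite cards0.
  congr (_ ^+ _ * _); rewrite -[LHS]rank_enum_val -IJ; apply: eq_card => j.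
  by rewrite !inE; case: (eqVneq j _) => [->|//]; rewrite ltnn !andbF.
rewrite (exchange_big_dep (fun i => i \notin J)) /=; last first.
  by move=> I i _ /andP[_ /eqP <-]; rewrite setD11.
apply: eq_bigr => i iJ; rewrite (big_pred1 (i |: J)) // => I /=.
apply/andP/eqP => [[_ /andP[iI /eqP <-]]|->]; first by rewrite finset.setD1K.
rewrite finset.setU11 finset.setU1K // eqxx; split=> //.
by rewrite cardsU1 iJ ltnS card_gt0.
Qed.

Lemma boundary0 (c : chain G) : boundary D n c finset.set0 = 0.
Proof.
rewrite /boundary ffunE big1 // => I I1; rewrite big1 // => r /eqP IJ.
have := cardsD1 (enum_val r) I; rewrite enum_valP -/(face r) IJ cards0.
by move=> I2; exfalso; move: I1; rewrite I2.
Qed.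

Lemma augmentationE (c : chain G) x : (forall I, antif I (c I)) ->
  augmentation D n c x = dE c finset.set0 x.
Proof.
move=> cI; rewrite /augmentation /dE; apply: congr_big => // [i|i _]; first by rewrite inE.
rewrite sk_affE finset.setU0.
have i0 : [set i]%SET != finset.set0 by apply/set0Pn; exists i; rewrite inE.
rewrite (asum_ind i0 (finset.sub0set _) (fin_supp_gr _) (cI _)).
rewrite mulKz; last by rewrite eqz_nat -lt0n parabolic_order_gt0.
by rewrite /esgn (_ : #|_| = 0%N) ?mul1r //; apply: eq_card0 => j; rewrite !inE.
Qed.

Lemma dE_antif (c : chain G) J : antif J (dE c J).
Proof.
move=> w wJ x; rewrite /dE mulr_sumr; apply: eq_bigr => i _.
by rewrite (@ind_antif (i |: J) J _ w wJ) mulrCA.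
Qed.

Lemma esgn_sq i J : esgn i J * esgn i J = 1.
Proof. by rewrite /esgn -expr2 sqrr_sign. Qed.

(** This sign rule is what makes the square of dE vanish. *)
Lemma esgn_swap i j J : i \notin J -> j \notin J -> i != j ->
  esgn i J * esgn j (i |: J) = - (esgn j J * esgn i (j |: J)).
Proof.
wlog ij : i j / (i < j)%N.
  move=> H iJ jJ ij; case: (ltngtP i j) => [?|?|/ord_inj E]; first exact: H.
    by rewrite (H j i) ?opprK // eq_sym.
  by rewrite E eqxx in ij.
move=> iJ jJ _.
have E1 : esgn j (i |: J) = - esgn j J.
  rewrite /esgn -[RHS]mulN1r -exprS; congr (_ ^+ _).
  rewrite (cardsD1 i) !inE eqxx ij add1n; congr _.+1; apply: eq_card => k.
  rewrite !inE; case: (eqVneq k i) => [->|//].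
  by rewrite (negbTE iJ).
have E2 : esgn i (j |: J) = esgn i J.
  rewrite /esgn; congr (_ ^+ _); apply: eq_card => k; rewrite !inE.
  case: (eqVneq k j) => [->|//].
  by rewrite (ltnNge j) (ltnW ij) andbF andbF.
by rewrite E1 E2 mulrN mulrC.
Qed.

Lemma ind_zero I J f x : (forall y, f y = 0) -> ind I J f x = 0.
Proof.
move=> f0; rewrite /ind /asum fsbig1 // => w _.
by rewrite /cut f0 if_same mulr0.
Qed.

Lemma dE_boundary (c : chain G) J x : (forall I, antif I (c I)) ->
  dE (boundary D n c) J x = 0.
Proof.
move=> cI; pose T i k := esgn i J * esgn k (i |: J) *
  ind (k |: (i |: J)) J (c (k |: (i |: J))) x.
have iJ0 i : i |: J != finset.set0 by apply/set0Pn; exists i; rewrite finset.setU11.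
have -> : dE (boundary D n c) J x = \sum_(i | i \notin J) \sum_(k | k \notin i |: J) T i k.
  apply: eq_bigr => i iJ.
  pose r := [seq k <- index_enum 'I_l.+1 | k \notin i |: J].
  have -> : ((boundary D n c (i |: J) : grpring L) : L -> int) =
      (fun y => \sum_(k <- r) esgn k (i |: J) *
        ind (k |: (i |: J)) (i |: J) (c (k |: (i |: J))) y).
    by apply/funext => y; rewrite boundaryE // big_filter.
  rewrite ind_sum; last by move=> k _; apply: ind_fin_supp => //; exact: fin_supp_gr.
  rewrite big_filter mulr_sumr; apply: eq_bigr => k kJ.
  by rewrite ind_trans ?mulrA ?subsetU1 //; exact: fin_supp_gr.
pose S := \sum_i \sum_k (if (i \notin J) && (k \notin i |: J) then T i k else 0).
have -> : \sum_(i | i \notin J) \sum_(k | k \notin i |: J) T i k = S.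
  rewrite big_mkcond; apply: eq_bigr => i _; case: ifP => iJ; last by rewrite big1.
  by rewrite big_mkcond.
have : S = - S.
  rewrite {1}/S exchange_big /= -sumrN; apply: eq_bigr => i _.
  rewrite -sumrN; apply: eq_bigr => k _; rewrite !inE !negb_or eq_sym.
  case: (boolP (k == i)) => [|ki] /=; first by rewrite !andbF oppr0.
  rewrite andbC; case: ifP => [/andP[iJ kJ]|_]; last by rewrite oppr0.
  have EK : i |: (k |: J) = k |: (i |: J) by rewrite finset.setUCA.
  by rewrite /T (esgn_swap kJ iJ ki) mulNr EK.
by lia.
Qed.

(** The nontrivial elements of W_J move y strictly away from the alcove, by
    weyl_dist_strict, to where f vanishes: on leading terms, inducing is the
    identity. *)
Lemma ind_top I J f y : J \subset I -> sdom J n y ->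
  (forall z, sdom I n z -> weyl_dist n y < weyl_dist n z -> f z = 0) ->
  ind I J f y = f y.
Proof.
move=> JI yJ f0; have yI : sdom I n y.
  apply/sdomP => i iI; apply: (sdomP _ _ _ yJ).
  by apply: contra iI; exact: (fintype.subsetP JI).
rewrite /ind /asum (fsbigE [:: wone]) //.
- rewrite big_mkcond big_seq1 ifT ?inE; last exact: parabolic1.
  by rewrite wsign_of expr0 mul1r /cut yI.
- by move=> w /=; rewrite inE => /eqP ->; exact: parabolic1.
- move=> w wJ; rewrite inE => w1; rewrite /cut; case: ifP => wy; rewrite ?mulr0 //.
  by rewrite f0 ?mulr0 //; exact: (weyl_dist_strict wJ).
Qed.

Lemma sk_wt_asum I x y : I != finset.set0 -> sk_wt D I n x y = asum I (delta x) y.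
Proof.
move=> I0; rewrite sk_wtE // /asum reindex_parabolicV; apply: eq_fsbigr => w _.
rewrite wsignV deltaE; congr (_ * (nat_of_bool _)%:R).
by apply/eqP/eqP => [<-|->]; rewrite ?wactVK ?wactK.
Qed.

Lemma sk_wt_antif I x : I != finset.set0 -> antif I (sk_wt D I n x).
Proof. by move=> I0 w wI y; rewrite !sk_wt_asum // asum_antif. Qed.

Lemma asum_delta_sdom I x y : sdom I n x -> sdom I n y ->
  asum I (delta x) y = (x == y)%:R.
Proof.
move=> xI yI; rewrite /asum (fsbigE [:: wone]) //.
- rewrite big_mkcond big_seq1 ifT ?inE; last exact: parabolic1.
  by rewrite wsign_of expr0 mul1r deltaE.
- by move=> w /=; rewrite inE => /eqP ->; exact: parabolic1.
- move=> w wI; rewrite inE => /eqP w1; rewrite deltaE.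
  case: eqP => [xy|_]; last by rewrite mulr0.
  case: w1; apply: (parabolic_dominant (n := n) wI (sdomP _ _ _ yI)).
  by rewrite -xy; exact/sdomP.
Qed.

Lemma sk_wt_sdom I x y : I != finset.set0 -> sdom I n x -> sdom I n y ->
  sk_wt D I n x y = (x == y)%:R.
Proof. by move=> I0 xI yI; rewrite sk_wt_asum // asum_delta_sdom. Qed.

(** A positive combination of the simple affine coroots, with the coefficients
    of theta, depends only on the level, and is positive because n is. *)
Lemma apairing_pos x : exists i, 0 < apairing D n i x.
Proof.
apply: contrapT => H; have [t [Et coef]] := root_coefs.
have [e [_ te _]] := coef _ (alpha_max_in D).
pose d i : int := if unlift ord0 i is Some j then t j else 1.
have d0 i : 0 <= d i.
  by rewrite /d; case: unliftP => [j _|//]; apply: le_trans (te j).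
have dE0 : acomb d = 0.
  rewrite acombE /d unlift_none scale1r [X in _ - X]Et -sumrB big1 // => i _.
  by rewrite liftK subrr.
have : 0 < acf d n x.
  rewrite acfE dE0 ip0l mulr0 add0r /d unlift_none mulr1 mulr_gt0 //.
  by rewrite ip_root_gt0 ?alpha_max_in.
rewrite ltNge /acf sumr_le0 // => i _; rewrite -oppr_ge0 -!mulrN !mulr_ge0 ?ip_ge0 //.
by rewrite oppr_ge0 leNgt; apply/negP => ai; apply: H; exists i.
Qed.

Lemma antif0 I : antif I (fun=> 0).
Proof. by move=> w _ x; rewrite mulr0. Qed.

Lemma chains_boundary p (b : chain G) : chains D n p.+1 b -> chains D n p (boundary D n b).
Proof.
move=> bC I; have bI := chains_antif bC.
have [->|I0] := eqVneq I finset.set0; first by rewrite cards0 boundary0.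
have E : (boundary D n b I : grpring L) =1 dE b I by move=> x; rewrite boundaryE.
case: ifP => [_ w wI x|/negP Ip]; first by rewrite !E dE_antif.
apply/grpringP => x; rewrite E gr0E /dE big1 // => i iI.
rewrite ind_zero ?mulr0 // => y; have := bC (i |: I).
case: ifP => [|_ ->]; last by rewrite gr0E.
by rewrite cardsU1 iI eqSS.
Qed.

Lemma antif_conv I (chi : grpring L) f : chi \in winv G -> antif I f ->
  antif I (conv chi f).
Proof.
move=> chiW fI w wI x; rewrite -{1}[n]add0r.
rewrite (@conv_wact chi f w 0 n x (fun y => winv_wact w y chiW)).
by rewrite /conv mulr_sumr; apply: eq_bigr => y _; rewrite fI // mulrCA.
Qed.

Lemma antifD I f g : antif I f -> antif I g -> antif I (fun x => f x + g x).
Proof. by move=> fI gI w wI x; rewrite fI // gI // mulrDr. Qed.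

Lemma conv_fin_supp (chi : grpring L) (f : grpring L) : fin_supp (conv chi f).
Proof.
by apply: sub_finite_set (fin_supp_gr (grM chi f)) => x /=; rewrite grME.
Qed.

Lemma ind_linear I J (chi f g : grpring L) x : I != finset.set0 -> J \subset I ->
  chi \in winv G -> antif I f -> antif I g ->
  ind I J (fun y => conv chi f y + g y) x = conv chi (ind I J f) x + ind I J g x.
Proof.
move=> I0 JI chiW fI gI.
have o0 : (parabolic_order D I)%:Z != 0.
  by rewrite eqz_nat -lt0n parabolic_order_gt0.
have cfI := antif_conv chiW fI.
have cff := conv_fin_supp chi f; have gff := fin_supp_gr g.
have sff : fin_supp (fun y => conv chi f y + g y).
  by apply: sub_finite_set (fin_supp_gr (grM chi f + g)) => y /=; rewrite grDE grME.
apply: (mulfI o0); rewrite -(congr1 (@^~ x) (asum_ind I0 JI sff (antifD cfI gI))).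
rewrite asumD // asum_conv //; last exact: fin_supp_gr.
rewrite mulrDr -convZr -(congr1 (@^~ x) (asum_ind I0 JI gff gI)).
by rewrite (asum_ind I0 JI (fin_supp_gr f) fI).
Qed.

Lemma chain_scaleE (chi : rep_ring G) (c c' : chain G) I x :
  (chi *: c + c') I x = conv chi (c I) x + c' I x.
Proof. by rewrite !ffunE grDE grME. Qed.

Lemma rep_winv (chi : rep_ring G) : rep_val chi \in winv G.
Proof. exact: valP. Qed.

Lemma dE_linear (chi : rep_ring G) (c c' : chain G) J x :
  (forall I, antif I (c I)) -> (forall I, antif I (c' I)) ->
  dE (chi *: c + c') J x = conv chi (dE c J) x + dE c' J x.
Proof.
move=> cI cI'; have iJ0 i : i |: J != finset.set0.
  by apply/set0Pn; exists i; rewrite finset.setU11.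
pose r := [seq i <- index_enum 'I_l.+1 | i \notin J].
have E e y : dE e J y = \sum_(i <- r) esgn i J * ind (i |: J) J (e (i |: J)) y.
  by rewrite big_filter.
have -> : conv chi (dE c J) x =
    \sum_(i <- r) esgn i J * conv chi (ind (i |: J) J (c (i |: J))) x.
  by rewrite -conv_fsumr; congr (conv _ _ x); apply/funext => y; exact: E.
rewrite !E -big_split; apply: eq_bigr => i _; rewrite [RHS]/=.
rewrite -mulrDr -ind_linear ?subsetU1 ?rep_winv //; congr (_ * _).
congr (ind _ _ _ x); apply/funext => y; exact: chain_scaleE.
Qed.

Lemma chains_submodule p : submodule (chains D n p : set (chain G)).
Proof.
split=> [I|chi c c' cC cC' I].
  by rewrite ffunE; case: ifP => // _ w _ x; rewrite !gr0E mulr0.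
have cI := @chains_antif p c I cC; have cI' := @chains_antif p c' I cC'.
case: ifP => Ip.
  move=> w wI x; rewrite !chain_scaleE.
  exact: (antifD (antif_conv (rep_winv chi) cI) cI').
have := cC I; have := cC' I; rewrite Ip => E' E; rewrite !ffunE E E'.
by rewrite scaler0 addr0.
Qed.

Lemma chain_linE (chi : rep_ring G) (c c' : chain G) I :
  (chi *: c + c') I = chi *: c I + c' I.
Proof. by rewrite !ffunE. Qed.

Lemma boundary_linear p (chi : rep_ring G) (c c' : chain G) :
  chains D n p c -> chains D n p c' ->
  boundary D n (chi *: c + c') = chi *: boundary D n c + boundary D n c'.
Proof.
move=> cC cC'; have cI := chains_antif cC; have cI' := chains_antif cC'.
have sI := chains_antif ((chains_submodule p).2 chi _ _ cC cC').
apply/ffunP => J; have [->|J0] := eqVneq J finset.set0.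
  by rewrite chain_linE !boundary0 scaler0 addr0.
apply/grpringP => x; rewrite chain_scaleE !boundaryE // dE_linear //; congr (_ + _).
by congr (conv _ _ x); apply/funext => y; rewrite boundaryE.
Qed.

Lemma chains_face0 p (c : chain G) J : chains D n p c -> #|J| != p.+1 -> c J = 0.
Proof. by move=> /(_ J); case: ifP. Qed.

(** * Acyclicity *)

(** The chains supported, in their chambers, on the weights x at a given distance
   are the simplicial chains of the simplices I containing the indices along which
   x is not strictly dominant. Some index i is missing from that set, and the cone
   with apex i contracts the complex. *)
Lemma kill_top_layer p (c : chain G) m : chains D n p c ->
  (forall J x, dE c J x = 0) ->
  (forall J x, sdom J n x -> m < weyl_dist n x -> c J x = 0) ->
  exists b : chain G, chains D n p.+1 b /\
    forall J x, sdom J n x -> m <= weyl_dist n x -> #|J| = p.+1 ->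
    boundary D n b J x = c J x.
Proof.
move=> cC cZ cm; have /choice[iota iotaP] := apairing_pos.
have cI := chains_antif cC.
pose X := fset_set [set x : L | weyl_dist n x = m]%classic.
have XE x : (x \in X) = (weyl_dist n x == m).
  rewrite in_fset_set; last first.
    by apply: sub_finite_set (weyl_dist_finite n m) => y /= ->.
  by apply/idP/eqP => [/set_mem|xm]; [|apply/mem_set].
(* The cone over the chain at x: the component of c at the face opposite to the
   apex iota x, with its sign. *)
pose cf I x : int := if sdom I n x && (iota x \in I) then
  esgn (iota x) (I :\ iota x) * c (I :\ iota x) x else 0.
pose b : chain G := [ffun I : {set 'I_l.+1} =>
  if #|I| == p.+2 then \sum_(x <- X) sk_wt D I n x *~ cf I x else 0 : grmod G].
have I0 I : #|I| == p.+2 -> I != finset.set0.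
  by move=> Ip; rewrite -card_gt0 (eqP Ip).
have bE I y : #|I| == p.+2 -> b I y = \sum_(x <- X) cf I x * sk_wt D I n x y.
  by move=> Ip; rewrite ffunE Ip gr_sumE; apply: eq_bigr => x _; rewrite gr_mulzE.
have bC : chains D n p.+1 b.
  move=> I; case: ifP => [Ip w wI y|Ip]; last by rewrite ffunE Ip.
  rewrite !bE // mulr_sumr; apply: eq_bigr => x _.
  by rewrite (@sk_wt_antif I x (I0 _ Ip) w wI y) mulrCA.
have bI := chains_antif bC.
have bS I y : #|I| == p.+2 -> sdom I n y ->
    b I y = if weyl_dist n y == m then cf I y else 0.
  move=> Ip yI; rewrite bE // -XE; case: ifP => yX; last first.
    rewrite big_seq big1 // => x xX; rewrite /cf; case: ifP; last by rewrite mul0r.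
    move=> /andP[xI _]; rewrite sk_wt_sdom ?I0 //; case: eqP => [xy|]; last by rewrite mulr0.
    by rewrite -xy xX in yX.
  rewrite (bigD1_seq y) ?fset_uniq //= sk_wt_sdom ?I0 // eqxx mulr1.
  rewrite big1 ?addr0 // => x /negbTE xy; rewrite /cf.
  case: ifP; last by rewrite mul0r.
  by move=> /andP[xI _]; rewrite sk_wt_sdom ?I0 // xy mulr0.
exists b; split=> // J x xJ mx Jp.
have J0 : J != finset.set0 by rewrite -card_gt0 Jp.
have sup I i : i \notin I -> sdom I n x -> sdom (i |: I) n x.
  move=> _ /sdomP H; apply/sdomP => j; rewrite !inE negb_or => /andP[_].
  exact: H.
rewrite boundaryE //.
have -> : dE b J x = \sum_(i | i \notin J) esgn i J * b (i |: J) x.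
  apply: eq_bigr => i iJ; rewrite ind_top ?subsetU1 // => z zI xz.
  rewrite bS ?cardsU1 ?iJ ?Jp //; case: eqP => // zm.
  by move: xz; rewrite zm ltNge mx.
have [mE|mE] := eqVneq (weyl_dist n x) m; last first.
  have mx' : m < weyl_dist n x by rewrite lt_def mE.
  rewrite cm // big1 // => i iJ; rewrite bS ?cardsU1 ?iJ ?Jp ?sup //.
  by rewrite (negbTE mE) mulr0.
have {}bS i : i \notin J -> b (i |: J) x = cf (i |: J) x.
  by move=> iJ; rewrite bS ?mE ?eqxx ?cardsU1 ?iJ ?Jp ?sup.
rewrite (eq_bigr (fun i => esgn i J * cf (i |: J) x)); last first.
  by move=> i iJ; rewrite bS.
set j := iota x; have jx : 0 < apairing D n j x := iotaP x.
have [jJ|jJ] := boolP (j \in J); last first.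
  rewrite (bigD1 j) //= big1 ?addr0 => [|i /andP[iJ ij]].
    rewrite /cf sup // finset.setU11 finset.setU1K // -/j.
    by rewrite mulrA esgn_sq mul1r.
  rewrite /cf -/j !inE (negbTE jJ) orbF eq_sym (negbTE ij) andbF mulr0 //.
pose K := J :\ j; have jK : j \notin K by rewrite setD11.
have JK : J = j |: K by rewrite finset.setD1K.
have xK : sdom K n x.
  apply/sdomP => i; rewrite !inE negb_and negbK => /orP[/eqP ->//|iJ].
  exact: (sdomP _ _ _ xJ).
have := cZ K x.
have -> : dE c K x = \sum_(i | i \notin K) esgn i K * c (i |: K) x.
  apply: eq_bigr => i iK; rewrite ind_top ?subsetU1 // => z zI xz.
  by rewrite cm // -mE.
rewrite (bigD1 j) //= -JK => S0.
have -> : c J x = - (esgn j K * \sum_(i | (i \notin K) && (i != j)) esgn i K * c (i |: K) x).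
  apply: (mulfI (_ : esgn j K != 0)); first by rewrite /esgn signr_eq0.
  rewrite mulrN mulrA esgn_sq mul1r; apply/eqP; rewrite -subr_eq0 opprK.
  exact/eqP.
rewrite mulr_sumr -sumrN; apply: eq_big => [i|i iJ].
  by rewrite JK !inE negb_or andbC.
have [iK ij] : i \notin K /\ i != j.
  by move: iJ; rewrite JK !inE negb_or => /andP[-> ->].
have EJ : (i |: J) :\ j = i |: K.
  by rewrite JK finset.setUCA finset.setU1K // finset.in_setU1 negb_or jK andbT eq_sym.
rewrite /cf sup // -/j !inE jJ orbT /= EJ.
have := esgn_swap iK jK ij; rewrite -JK => E.
have -> : esgn i J = - (esgn j K * esgn i K * esgn j (i |: K)).
  transitivity (- (esgn j K * (- (esgn j K * esgn i J)))).
    by rewrite mulrN opprK mulrA esgn_sq mul1r.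
  by rewrite -E mulrA.
rewrite mulNr mulrA; congr (- _); rewrite -!mulrA; congr (_ * (_ * _)).
by rewrite mulrA esgn_sq mul1r.
Qed.

Lemma chain_antif_eq0 (f : grpring L) I : antif I f ->
  (forall x, sdom I n x -> f x = 0) -> f = 0.
Proof.
move=> fI f0; apply/grpringP => x.
by rewrite (antif_ext fI (@antif0 I) f0) gr0E.
Qed.

(** Induction on the radius of the support, which kill_top_layer lowers. The
    augmentation being the component of dE at the empty set, this covers
    exactness at C_0 too. *)
Lemma exact_chain p (c : chain G) : chains D n p c -> (forall J x, dE c J x = 0) ->
  exists2 b : chain G, chains D n p.+1 b & boundary D n b = c.
Proof.
move=> cC cZ.
have [m Hm] : exists m : nat, forall J x, sdom J n x -> m%:Z <= weyl_dist n x -> c J x = 0.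
  pose F J : nat := (\max_(x <- finsupp (c J)) absz (weyl_dist n x)).+1.
  exists (\max_J F J)%N => J x _ mx; apply: fsfun_dflt; apply/negP => xc.
  have : (absz (weyl_dist n x) < F J)%N.
    by rewrite ltnS (big_rem x) //= leq_maxl.
  move=> H; have {H} := leq_trans H (leq_bigmax J : (F J <= _)%N).
  by move: mx; have := weyl_dist_ge0 n x; lia.
elim: m c cC cZ Hm => [|m IH] c cC cZ Hm.
  exists 0; first exact: (chains_submodule p.+1).1.
  have -> : c = 0.
    apply/ffunP => J; rewrite [RHS]ffunE.
    apply: (chain_antif_eq0 (@chains_antif p c J cC)) => x xJ.
    by apply: Hm => //; exact: weyl_dist_ge0.
  apply/ffunP => J; rewrite [RHS]ffunE.
  have [->|J0] := eqVneq J finset.set0; first exact: boundary0.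
  apply/grpringP => x; rewrite boundaryE //; last first.
    by move=> I w _ y; rewrite !ffunE !gr0E mulr0.
  rewrite gr0E /dE big1 // => i _; rewrite ind_zero ?mulr0 // => y.
  by rewrite ffunE gr0E.
have [|b [bC bc]] := kill_top_layer (m := m%:Z) cC cZ.
  by move=> J x xJ mx; apply: Hm => //; lia.
have dbC := chains_boundary bC.
have subE (e : chain G) J x : (c - e) J x = c J x - e J x.
  by rewrite !ffunE grDE grNE.
have cbE : c - boundary D n b = (-1 : rep_ring G) *: boundary D n b + c.
  by rewrite scaleN1r addrC.
have cbC : chains D n p (c - boundary D n b).
  by rewrite cbE; apply: (chains_submodule p).2.
have bI := chains_antif bC; have cI := chains_antif cC.
have [|J x xJ mx|b' b'C b'E] := IH (c - boundary D n b) cbC.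
- move=> J x; rewrite cbE dE_linear //; last by move=> I; exact: (chains_antif dbC).
  rewrite cZ addr0 /conv big1 // => y _.
  by rewrite dE_boundary // mulr0.
- have [Jp|Jp] := eqVneq #|J| p.+1; first by rewrite subE bc ?subrr.
  by rewrite (chains_face0 cbC Jp) gr0E.
exists ((1 : rep_ring G) *: b' + b); first by apply: (chains_submodule p.+1).2.
by rewrite (boundary_linear _ b'C bC) b'E scale1r subrK.
Qed.

Lemma dE_cycle p (c : chain G) : chains D n p.+1 c -> boundary D n c = 0 ->
  forall J x, dE c J x = 0.
Proof.
move=> cC c0 J x; have [->|J0] := eqVneq J finset.set0; last first.
  by rewrite -boundaryE ?c0 ?ffunE ?gr0E //; by move=> I; exact: (chains_antif cC).
rewrite /dE big1 // => i _; rewrite ind_zero ?mulr0 // => y.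
by rewrite finset.setU0 (chains_face0 cC) ?gr0E // cards1.
Qed.

Lemma chains_top (c : chain G) : chains D n l.+1 c -> c = 0.
Proof.
move=> cC; apply/ffunP => J; rewrite (chains_face0 cC) ?ffunE //.
by rewrite neq_ltn ltnS (leq_trans (max_card _)) ?card_ord.
Qed.

End PositiveLevel.

(** * The Weyl character formula *)

Section Denominator.
Variables (k : nat) (I : {set 'I_l.+1}).
Hypothesis I0 : I != finset.set0.
Local Notation n := (k%:Z + h).

Let n0 : 0 < n.
Proof. by rewrite ltr_wpDl ?dual_coxeter_gt0. Qed.

(** The Weyl denominator of G_I. *)
Definition weyl_den : grpring L := sk_wt D I h (rho D).

Lemma sdom_rho : sdom I h (rho D).
Proof. by apply/sdomP => i _; rewrite apairing_rho. Qed.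

(** The affine fundamental weight of an index of I is fixed by W_I and gives a
    linear form y positive on the simple roots of G_I. *)
Lemma regular_vector : exists m c, [/\ 0 < m,
  (forall w, parab I w -> val w m c = c) &
  let y := m *: rho D - h *: c in forall i, i \notin I -> 0 < ip (alpha i) y].
Proof.
have /set0Pn[j jI] := I0; have [m [c [m0 mc]]] := fundamental_weight j.
exists m, c; split=> //.
  move=> w [s sI ->]; elim: s sI => //= i s IH /andP[iI /IH ->].
  rewrite /asigma mc; case: eqP => [ij|_]; first by rewrite ij jI in iI.
  by rewrite scale0r subr0.
move=> y i iI; have ij : (i == j) = false by apply: contraNF iI => /eqP ->.
have E1 := ip_apairing h i (rho D); have := ip_apairing m i c.
rewrite mc ij mulr0 => E2; rewrite apairing_rho mulr1 in E1.
rewrite -(pmulr_rgt0 _ (_ : 0 < 2)) // /y ipBr !ipZr.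
have -> : 2 * (m * ip (alpha i) (rho D) - h * ip (alpha i) c) =
  m * ip (alpha i) (alpha i).
  rewrite E1; set d := (_ == _)%:R in E2 *.
  transitivity (m * (2 * ip (alpha i) (rho D)) - h * (2 * ip (alpha i) c)); first by ring.
  have -> : 2 * ip (alpha i) c = - (m * d * ip theta theta).
    by apply/eqP; rewrite -addr_eq0 -E2.
  by ring.
by rewrite mulr_gt0 ?ip_aroot_gt0.
Qed.

(** For the linear form y the leading term of the Weyl denominator is rho, with
    coefficient 1. *)
Lemma weyl_den_conv_inj (f : grpring L) : (forall x, conv f weyl_den x = 0) -> f = 0.
Proof.
move=> fd; have [m [c [m0 _ /= ypos]]] := regular_vector; set y := (_ - _) in ypos.
have rho_top w : parab I w -> ip (rho D) y <= ip (val w h (rho D)) y -> w = wone.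
  move=> [s sI ws] H; have [t tr ts] := reduced_exists sI; apply: val_inj.
  rewrite ws -ts; case: t tr ts => // i t tr ts; exfalso; move: H.
  rewrite ws -ts leNgt => /negP; apply.
  have := @reduced_smono I h (fun x => - ip x y) (fun i => ip (alpha i) y) (i :: t) (rho D).
  rewrite ltrN2; apply=> //.
    by move=> r z _; rewrite /asigma ipBl ipZl opprB addrC mulrC.
  by move=> r _; rewrite apairing_rho.
apply: contrapT => /eqP f0.
have [x xf xmax] : exists2 x, x \in finsupp f &
    forall z, z \in finsupp f -> ip z y <= ip x y.
  have [x0 x0f] : exists x0, x0 \in finsupp f.
    apply: contrapT => H; move/eqP: f0; apply; apply/grpringP => x.
    by rewrite gr0E; apply: fsfun_dflt; apply/negP => xf; apply: H; exists x.
  pose a := [arg max_(u > [` x0f]%fset) ip (val u) y]%O.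
  exists (val a); first exact: valP.
  move=> z zf; rewrite /a; case: arg_maxP => // u _ umax.
  by have := umax [` zf]%fset isT.
have := fd (x + rho D); rewrite /conv (bigD1_seq x) ?fset_uniq //=.
rewrite addrAC subrr add0r /weyl_den sk_wt_sdom ?sdom_rho // eqxx mulr1.
rewrite big_seq_cond big1 ?addr0 => [fx|z /andP[zf zx]].
  by move: xf; rewrite mem_finsupp fx eqxx.
rewrite sk_wtE // fsbig1 ?mulr0 // => w wI; case: eqP => [E|_]; last by rewrite mulr0.
have w1 : w = wone.
  apply: rho_top => //; rewrite E ipBl ipDl addrAC lerDr subr_ge0.
  exact: xmax.
move: E zx; rewrite w1 /= => /eqP; rewrite eq_sym subr_eq addrC => /eqP/addrI ->.
by rewrite eqxx.
Qed.

Lemma weyl_den_antif : antif h I weyl_den.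
Proof. by move=> w wI x; exact: (@sk_wt_antif h I (rho D) I0 w wI x). Qed.

Lemma rep_conv_antif f : rep_level D I k%:Z f -> antif n I (conv f weyl_den).
Proof.
move=> fI w wI x.
rewrite (@conv_wact f weyl_den w k%:Z h x (fun y => fI w wI y)).
rewrite /conv mulr_sumr; apply: eq_bigr => y _.
by rewrite weyl_den_antif // mulrCA.
Qed.

Definition orbit_set (x : L) : {fset L} :=
  [fset val w k%:Z x | w in fset_set (parab I)]%fset.

Definition orbit_sum (x : L) : grpring L := [fsfun y in orbit_set x => 1].

Lemma orbit_setP x y : reflect (exists2 w, parab I w & val w k%:Z x = y) (y \in orbit_set x).
Proof.
have Ifin := parabolic_finite I0.
apply: (iffP (imfsetP _ _ _ _)) => [[w /= wI ->]|[w wI <-]].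
  by exists w => //; move: wI; rewrite in_fset_set // => /set_mem.
by exists w => //=; rewrite in_fset_set //; apply/mem_set.
Qed.

Lemma orbit_sum_rep x : rep_level D I k%:Z (orbit_sum x).
Proof.
move=> w wI y; rewrite !fsfunE.
suff -> : (val w k%:Z y \in orbit_set x) = (y \in orbit_set x) by [].
apply/orbit_setP/orbit_setP => -[u uI E].
  exists (wmul (winve w) u); first by apply: parabolicM => //; exact: parabolicV.
  by rewrite wmulE E wactK.
by exists (wmul w u); [exact: parabolicM|rewrite wmulE E].
Qed.

(** The product of an orbit sum with the Weyl denominator has a leading term for
   the distance to the fixed vector of W_I: the triangle inequality is strict
   unless the two summands lie in a common chamber. *)
Lemma orbit_sum_den m c : 0 < m -> (forall w, parab I w -> val w m c = c) ->
  let y := m *: rho D - h *: c in (forall i, i \notin I -> 0 < ip (alpha i) y) ->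
  let P x := ip (m *: x - n *: c) (m *: x - n *: c) in
  forall nu x, sdom I n nu -> sdom I n x -> P nu <= P x ->
  conv (orbit_sum (nu - rho D)) weyl_den x = (x == nu)%:R.
Proof.
move=> m0 mc y ypos P nu x nuI xI nux; set mu := nu - rho D.
have yE : y = m *: rho D - h *: c by [].
have muK : mu + rho D = nu by rewrite subrK.
clearbody y mu.
have mu0 i : i \notin I -> 0 <= apairing D k%:Z i mu.
  move=> iI; have := sdomP _ _ _ nuI i iI.
  by rewrite -muK apairing_level apairing_rho; lia.
have top w : parab I w -> ip (val w k%:Z mu) y <= ip mu y /\
    (ip mu y <= ip (val w k%:Z mu) y -> val w k%:Z mu = mu).
  move=> [s sI ws]; have [t tr ts] := reduced_exists sI; rewrite ws -ts.
  have := @reduced_mono I k%:Z (fun x => - ip x y) (fun i => ip (alpha i) y) t mu.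
  rewrite !lerN2; apply=> // r z _.
  by rewrite /asigma ipBl ipZl opprB addrC mulrC.
(* Up to the isometry w, m x - n c is y plus a conjugate of X = m mu - k c, while
   m nu - n c is X + y; the product with y of a conjugate of X is at most that of
   X itself. *)
have key u w : parab I u -> parab I w -> x = val u k%:Z mu + val w h (rho D) ->
    val u k%:Z mu = mu /\ w = wone.
  move=> uI wI xE; pose v := wmul (winve w) u.
  have vI : parab I v by apply: parabolicM => //; exact: parabolicV.
  have lin r q z : parab I r -> m *: val r q z - q *: c = val r 0 (m *: z - q *: c).
    move=> rI; rewrite -{1}(mc r rI) -!wactZ [q * m]mulrC.
    apply/eqP; rewrite subr_eq [eqbRHS]addrC -wactD.
    by rewrite [_ + (_ - _)]addrC subrK.
  have [X XE] : exists X, X = m *: mu - k%:Z *: c by exists (m *: mu - k%:Z *: c).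
  have PE r s : parab I r -> parab I s -> P (val r k%:Z mu + val s h (rho D)) =
      ip X X + ip y y + 2 * ip (val (wmul (winve s) r) 0 X) y.
    move=> rI sI; rewrite /P.
    have -> : m *: (val r k%:Z mu + val s h (rho D)) - n *: c = val r 0 X + val s 0 y.
      by rewrite XE yE -!lin // scalerDr scalerDl opprD addrACA.
    rewrite ipDl !ipDr !ip_wact [ip (val s 0 y) _]ipC.
    have -> : ip (val r 0 X) (val s 0 y) = ip (val (wmul (winve s) r) 0 X) y.
      by rewrite wmulE -[in RHS](ip_wact s) wactVK.
    by ring.
  have Pnu : P nu = ip X X + ip y y + 2 * ip X y.
    have := PE wone wone (parabolic1 _) (parabolic1 _).
    have -> : val wone k%:Z mu + val wone h (rho D) = nu by rewrite /= muK.
    have -> : wmul (winve wone) wone = wone.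
      by apply: waff_eqP => q z; rewrite wmulE wactK.
    by [].
  have vtop : ip X y <= ip (val v 0 X) y.
    by move: nux; rewrite Pnu xE PE // -/v; lia.
  have vmu : val v k%:Z mu = mu.
    apply: (top v vI).2; move: vtop; rewrite XE -lin // !ipBl lerD2r !ipZl.
    by rewrite ler_pM2l.
  have uE : val u k%:Z mu = val w k%:Z mu by rewrite -{2}vmu wmulE wactVK.
  have w1 : w = wone.
    apply: (@parabolic_dominant I n nu) => //; first exact/sdomP.
    have -> : val w n nu = x.
      by rewrite xE uE -wact_level muK.
    exact/sdomP.
  by rewrite uE w1.
have den_eval z : weyl_den z = \sum_(w \in parab I) wsign w * (val w h (rho D) == z)%:R.
  by rewrite /weyl_den sk_wtE.
have [xnu|xnu] := eqVneq x nu; last first.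
  rewrite /conv big_seq big1 // => z zo; rewrite den_eval fsbig1 ?mulr0 // => w wI.
  case: eqP => [E|_]; last by rewrite mulr0.
  have /orbit_setP[u uI uz] : z \in orbit_set mu.
    by move: zo; rewrite mem_finsupp fsfunE; case: ifP; rewrite ?eqxx.
  have xE : x = val u k%:Z mu + val w h (rho D) by rewrite uz E addrC subrK.
  have [umu w1] := key u w uI wI xE; move/eqP: xnu; case.
  by rewrite xE umu w1 /= muK.
have muo : mu \in orbit_set mu by apply/orbit_setP; exists wone => //; exact: parabolic1.
have o1 z : orbit_sum mu z = (z \in orbit_set mu)%:R by rewrite fsfunE; case: ifP.
have muf : mu \in finsupp (orbit_sum mu) by rewrite mem_finsupp o1 muo.
rewrite /conv (bigD1_seq mu) ?fset_uniq //= o1 muo mul1r.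
have -> : x - mu = rho D by rewrite xnu -muK addrAC subrr add0r.
rewrite {1}/weyl_den sk_wt_sdom ?sdom_rho // eqxx big_seq_cond big1 ?addr0 //.
move=> z /andP[zo zmu]; rewrite den_eval fsbig1 ?mulr0 // => w wI.
case: eqP => [E|_]; last by rewrite mulr0.
have /orbit_setP[u uI uz] : z \in orbit_set mu.
  by move: zo; rewrite mem_finsupp o1; case: (z \in _).
have xE : x = val u k%:Z mu + val w h (rho D) by rewrite uz E addrC subrK.
by have [umu w1] := key u w uI wI xE; rewrite -uz umu eqxx in zmu.
Qed.

Lemma rep_levelD f g : rep_level D I k%:Z f -> rep_level D I k%:Z g ->
  rep_level D I k%:Z (f + g).
Proof. by move=> fI gI w wI x; rewrite !grDE fI // gI. Qed.

(** The leading terms of orbit_sum_den allow the division by the Weyl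
    denominator, by induction on the distance from the support to the fixed
    vector of W_I. *)
Lemma weyl_den_conv_surj (g : grpring L) : antif n I g ->
  exists2 f : grpring L, rep_level D I k%:Z f & forall x, conv f weyl_den x = g x.
Proof.
have [m [c [m0 mc ypos]]] := regular_vector.
pose P x := ip (m *: x - n *: c) (m *: x - n *: c).
have Pfin N : finite_set [set x : L | P x <= N]%classic.
  by apply: affine_ball_finite; rewrite gt_eqF.
have P0 x : 0 <= P x by exact: ip_ge0.
move=> gI; have [N HN] : exists N : nat, forall x, sdom I n x -> N%:Z <= P x -> g x = 0.
  exists (\max_(x <- finsupp g) absz (P x)).+1 => x _ Nx.
  apply: fsfun_dflt; apply/negP => xg; move: Nx; rewrite (big_rem x) //=.
  by have := P0 x; set M := (\max_(_ <- _) _)%N; lia.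
elim: N g gI HN => [|N IH] g gI HN.
  exists 0 => [w _ x|x]; first by rewrite !gr0E.
  have -> : g = 0.
    by apply: (chain_antif_eq0 n0 gI) => z zI; apply: HN.
  by rewrite gr0E /conv big_seq big1 // => z; rewrite mem_finsupp gr0E eqxx.
pose X := fset_set [set x : L | P x = N%:Z]%classic.
have XE x : (x \in X) = (P x == N%:Z).
  rewrite in_fset_set; last by apply: sub_finite_set (Pfin N%:Z) => z /= ->.
  by apply/idP/eqP => [/set_mem|xm]; [|apply/mem_set].
pose f1 : grpring L := \sum_(nu <- X) orbit_sum (nu - rho D) *~ cut n I g nu.
have f1I : rep_level D I k%:Z f1.
  rewrite /f1; elim/big_ind: _ => [w _ x||nu _ w wI x]; first by rewrite !gr0E.
    by move=> a b; exact: rep_levelD.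
  by rewrite !gr_mulzE (@orbit_sum_rep _ w wI).
have f1E x : sdom I n x -> N%:Z <= P x -> conv f1 weyl_den x =
    if P x == N%:Z then g x else 0.
  move=> xI Nx; rewrite -grME.
  have -> : grM f1 weyl_den =
      \sum_(nu <- X) (orbit_sum (nu - rho D) *~ cut n I g nu) * weyl_den.
    by rewrite -mulr_suml.
  rewrite gr_sumE -XE.
  have E nu : nu \in X ->
      ((orbit_sum (nu - rho D) *~ cut n I g nu) * weyl_den) x =
      cut n I g nu * (x == nu)%:R.
    move=> nuX; rewrite -[_ *~ _]mulrzr mulrAC mulrzr gr_mulzE /cut.
    case: ifP => nuI; last by rewrite !mul0r.
    rewrite grME (orbit_sum_den m0 mc ypos) //.
    by move: nuX; rewrite XE => /eqP; rewrite /P => ->.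
  rewrite big_seq; case: ifP => xX.
    rewrite -big_seq (bigD1_seq x) ?fset_uniq //= E // eqxx mulr1 /cut xI.
    rewrite big_seq_cond big1 ?addr0 // => nu /andP[nuX nux].
    by rewrite E // eq_sym (negbTE nux) mulr0.
  rewrite big1 // => nu nuX; rewrite E //; case: eqP => [xnu|]; rewrite ?mulr0 //.
  by rewrite xnu nuX in xX.
have f1a := rep_conv_antif f1I.
have subE x : (g - grM f1 weyl_den : grpring L) x = g x - conv f1 weyl_den x.
  by rewrite grDE grNE grME.
have [|x xI Nx|f fI fE] := IH (g - grM f1 weyl_den).
- by move=> w wI x; rewrite !subE gI // f1a // mulrBr.
- rewrite subE f1E //; case: eqP => [_|/eqP Px]; first by rewrite subrr.
  by rewrite subr0; apply: HN => //; move: Px Nx; move: (P x) => z; lia.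
exists (f + f1); first exact: rep_levelD.
by move=> x; rewrite convDl fE subE subrK.
Qed.

Lemma rep_level_submodule : submodule (rep_level D I k%:Z : set (grmod G)).
Proof.
split=> [w _ x|a f g fI gI w wI x]; first by rewrite !gr0E.
rewrite !grDE gI // !grME -{1}[k%:Z]add0r; congr (_ + _).
rewrite (@conv_wact (rep_val a) f w 0 k%:Z x (fun y => winv_wact w y (rep_winv a))).
by rewrite /conv; apply: eq_bigr => y _; rewrite fI.
Qed.

Lemma antiinv_submodule : submodule (antiinv D I n : set (grmod G)).
Proof.
split=> [w _ x|a f g fI gI w wI x]; first by rewrite !gr0E mulr0.
rewrite !grDE !grME.
exact: (antifD (antif_conv (rep_winv a) fI) gI).
Qed.

Lemma irr_char_exists mu : exists2 chi : grpring L, irr_char D I k%:Z mu chi &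
  grM chi weyl_den = sk_wt D I n (mu + rho D).
Proof.
have [f fI fE] := weyl_den_conv_surj (@sk_wt_antif n I (mu + rho D) I0).
have E : grM f weyl_den = sk_wt D I n (mu + rho D).
  by apply/grpringP => x; rewrite grME fE.
by exists f.
Qed.

Lemma rep_level_iso : exists Theta : grmod G -> grmod G,
  [/\ linear_on (rep_level D I k%:Z) (antiinv D I n) Theta,
      set_bij (rep_level D I k%:Z) (antiinv D I n) Theta
    & forall mu, dominant D I k%:Z mu ->
        exists2 chi : grmod G, irr_char D I k%:Z mu chi &
          Theta chi = sk_wt D I n (mu + rho D)].
Proof.
pose Theta (f : grmod G) : grmod G := grM f weyl_den.
have ThetaB f g x : grM (f - g) weyl_den x = grM f weyl_den x - grM g weyl_den x.
  have -> : grM (f - g) weyl_den = grM f weyl_den - grM g weyl_den by exact: mulrBl.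
  by rewrite grDE grNE.
have Tanti f : rep_level D I k%:Z f -> antiinv D I n (Theta f).
  by move=> fI w wI x; rewrite !grME; exact: rep_conv_antif.
exists Theta; split.
- split=> // a x y _ _; rewrite /Theta.
  have -> : grM (a *: x + y) weyl_den = grM (a *: x) weyl_den + grM y weyl_den.
    exact: (mulrDl (a *: x : grpring L)).
  by congr (_ + _); exact: (esym (grMA (rep_val a) x weyl_den)).
- split=> [f fI|f g _ _ E|g gI]; first exact: Tanti.
    apply/eqP; rewrite -subr_eq0; apply/eqP.
    apply: (@weyl_den_conv_inj (f - g)) => x.
    by rewrite -grME ThetaB; rewrite /Theta in E; rewrite E subrr.
  have [f fI fE] := weyl_den_conv_surj gI; exists f => //.
  by apply/grpringP => x; rewrite grME fE.
by move=> mu _; have [f fI fE] := irr_char_exists mu; exists f.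
Qed.

End Denominator.

(** * Characters of the torus at the fusion points *)

Section Fusion.
Variable k : nat.
Local Notation n := (k%:Z + h).
Local Notation fin := ([set ord0]%SET : {set 'I_l.+1}).

Let n0 : 0 < n.
Proof. by rewrite ltr_wpDl ?dual_coxeter_gt0. Qed.

Let nR : 0 < n%:~R :> R.
Proof. by rewrite ltr0z. Qed.

(** The form on the weight space dual to B. *)
Definition dualB (x y : L) : R :=
  pairing (map_mx intr y) (bsharp B (map_mx intr x)).

Lemma dualBC x y : dualB x y = dualB y x.
Proof.
rewrite /dualB /pairing /bsharp.
transitivity (((map_mx intr y : 'rV[R]_l) *m (map_mx intr x *m invmx B)^T)^T 0 0).
  by rewrite [RHS]mxE.
by rewrite trmx_mul trmxK -mulmxA trmx_mul trmx_inv (basic_sym D).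
Qed.

Lemma dualBDr x y z : dualB x (y + z) = dualB x y + dualB x z.
Proof. by rewrite /dualB map_mxD /pairing mulmxDl mxE. Qed.

Lemma dualBZr c x y : dualB x (c *: y) = c%:~R * dualB x y.
Proof. by rewrite /dualB map_mxZ /pairing -scalemxAl mxE. Qed.

Lemma dualB_root x a : a \in roots G ->
  bnorm (coroot G a) * dualB x a = 2 * (<<x, a>>)%:~R.
Proof. by move=> aG; rewrite pairing_bsharp // pairing_intr. Qed.

Lemma dualB_reflection a x y : a \in roots G ->
  dualB (reflection G a x) (reflection G a y) = dualB x y.
Proof.
move=> aG; rewrite !reflectionE -!scaleNr.
rewrite dualBDr dualBZr ![dualB (_ + _) _]dualBC !dualBDr !dualBZr.
have bn := bnorm_coroot_gt0 aG; set b := bform _ _ _ in bn.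
have E z : dualB a z = 2 * (<<z, a>>)%:~R / b.
  by rewrite dualBC -dualB_root // -/b mulrAC divff ?mul1r ?gt_eqF.
rewrite !(dualBC _ a) !E [dualB y x]dualBC (pairing_coroot aG) !rmorphN.
by field; rewrite gt_eqF.
Qed.

Lemma dualB_wact w x y : dualB (val w 0 x) (val w 0 y) = dualB x y.
Proof.
have [s ->] := waffP w; elim: s => //= i s IH.
by rewrite !asigma0 dualB_reflection ?aroot_in.
Qed.

Definition tchar (x y : L) : R[i] :=
  torus_char ((n%:~R)^-1 *: bsharp B (map_mx intr x)) y.

Lemma tcharE x y : tchar x y =
  (cos (2 * pi * (dualB x y / n%:~R)) +i* sin (2 * pi * (dualB x y / n%:~R)))%C.
Proof.
rewrite /tchar /torus_char.
have -> // : pairing (map_mx intr y) ((n%:~R)^-1 *: bsharp B (map_mx intr x)) =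
  dualB x y / n%:~R :> R.
by rewrite /pairing -scalemxAr mxE mulrC.
Qed.

Lemma fusion_pointE mu y : torus_char (fusion_point D k mu) y = tchar (mu + rho D) y.
Proof.
by rewrite /tchar /fusion_point -[X in X *: _]/((k + dual_coxeter D)%:R^-1) pmulrn PoszD.
Qed.

Lemma tcharC x y : tchar x y = tchar y x.
Proof. by rewrite !tcharE dualBC. Qed.

Lemma tcharD x y z : tchar x (y + z) = tchar x y * tchar x z.
Proof. exact: torus_charD. Qed.

Lemma tchar0 x : tchar x 0 = 1.
Proof. exact: torus_char0. Qed.

Lemma tchar_wact w x y : tchar (val w 0 x) (val w 0 y) = tchar x y.
Proof. by rewrite !tcharE dualB_wact. Qed.

Lemma tchar_eq_int x y z : tchar x z = tchar y z ->
  exists m : int, dualB x z - dualB y z = n%:~R * m%:~R.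
Proof.
rewrite !tcharE => /eqP; rewrite eq_complex /= => /andP[/eqP Ec /eqP Es].
set u := dualB x z / _ in Ec Es; set v := dualB y z / _ in Ec Es.
have c1 : cos (2 * pi * (u - v)) = 1.
  by rewrite mulrBr cosB Ec Es -!expr2 cos2Dsin2.
pose m := Num.floor (u - v); exists m.
have xm : 0 <= u - v - m%:~R < 1.
  have := real_floor_itv (num_real (u - v)); rewrite -/m intrD mulr1z.
  by move=> /andP[m1 m2]; rewrite subr_ge0 m1 /= ltrBlDl.
have := cos_eq1 xm; rewrite mulrBr cosB.
have [-> ->] := cos_sin_int R m; rewrite c1 mulr0 mulr1 addr0 => /(_ erefl) E.
have {}E : u - v = m%:~R by apply/eqP; rewrite -subr_eq0; apply/eqP.
by rewrite -E /u /v -mulrBl mulrCA divff ?mulr1 // gt_eqF.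
Qed.

Lemma tchar_int x z (m : int) : dualB x z = n%:~R * m%:~R -> tchar x z = 1.
Proof.
move=> E; rewrite tcharE.
have -> : dualB x z / n%:~R = m%:~R by rewrite E mulrAC divff ?mul1r // gt_eqF.
by have [-> ->] := cos_sin_int R m.
Qed.

Lemma fin_act w m x : parab fin w -> val w m x = val w 0 x.
Proof.
move=> [s sI ->]; elim: s sI => //= i s IH /andP[iI /IH ->].
by move: iI; rewrite inE /asigma /apairing => /negbTE ->; rewrite !mulr0n.
Qed.

Lemma reflectionNl a x : a \in roots G -> reflection G (- a) x = reflection G a x.
Proof. by move=> aG; rewrite !reflectionE corootN // scaleNr scalerN opprK. Qed.

Lemma reflection_word a : a \in roots G ->
  exists2 u, parab fin u & forall x, val u 0 x = reflection G a x.
Proof.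
move=> aG.
have pos c : affroot c -> (forall i, 0 <= c i) -> c ord0 = 0 ->
    exists2 u, parab fin u & forall x, val u 0 x = reflection G (acomb c) x.
  move=> cG c0 c00; have [|s sI sE] := @affroot_word fin c cG c0.
    by move=> j; rewrite inE => /eqP ->.
  exists (wof s) => [|x]; first by exists s.
  apply/rowP => j; have /rowP/(_ j) := sE 0 x.
  rewrite acfE mul0r mul0r addr0 [ip _ x]ipC ip_root // !mxE val_wof.
  have Q0 : ip (acomb c) (acomb c) != 0 by rewrite gt_eqF ?ip_root_gt0.
  by move=> E; apply: (mulfI Q0); rewrite E; ring.
have [c [ca c0 [cp|cn]]] := affroot_of_root aG.
  by rewrite -ca; apply: pos => //; rewrite /affroot ca.
pose d i := - c i; have da : acomb d = - a.
  by rewrite -ca /acomb -sumrN; apply: eq_bigr => i _; rewrite scaleNr.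
have [|i||u uI uE] := pos d.
- by rewrite /affroot da rootN.
- by rewrite /d oppr_ge0.
- by rewrite /d c0 oppr0.
by exists u => // x; rewrite uE da reflectionNl.
Qed.

Lemma wsign_reflection u a : a \in roots G ->
  (forall x, val u 0 x = reflection G a x) -> wsign u = -1.
Proof.
move=> aG uE; have [s us] := waffP u; rewrite (wsign_word us) -det_word_mx.
rewrite -(det_refl_mx aG); congr (\det _); apply/row_matrixP => i.
by rewrite !rowE mul_word_mx mul_refl_mx -us uE.
Qed.

(** The reflections in the affine roots a + delta and a differ by a translation
    along the coroot of a, and the coroots span the lattice. *)
Lemma coweight_translation (xi : 'cV[int]_l) : exists t : waff D,
  (forall x, val t 0 x = x) /\ forall x, map_mx intr (val t n x) =
    map_mx intr x + n%:~R *: ((map_mx intr xi)^T *m B) :> 'rV[R]_l.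
Proof.
pose T (xi : 'cV[int]_l) := exists t : waff D,
  (forall x, val t 0 x = x) /\ forall x, map_mx intr (val t n x) =
    map_mx intr x + n%:~R *: ((map_mx intr xi)^T *m B) :> 'rV[R]_l.
have T0 : T 0.
  by exists wone; split=> // x; rewrite map_mx0 trmx0 mul0mx scaler0 addr0.
have TD a b : T a -> T b -> T (a + b).
  move=> [t [t0 tE]] [u [u0 uE]]; exists (wmul t u).
  split=> x; rewrite wmulE ?u0 ?t0 // tE uE map_mxD linearD mulmxDl scalerDr.
  by rewrite -addrA [X in _ + X]addrC.
have TN a : T a -> T (- a).
  move=> [t [t0 tE]]; exists (winve t); split=> x.
    by rewrite -{1}[x]t0 wactK.
  have := tE (val (winve t) n x); rewrite wactVK => ->.
  by rewrite map_mxN linearN mulNmx scalerN addrK.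
have TZ c a : T a -> T (c *: a).
  move=> Ta; have TZn (p : nat) : T (p%:Z *: a).
    elim: p => [|p IH]; first by rewrite scale0r.
    have -> : p.+1%:Z *: a = a + p%:Z *: a.
      by rewrite -[X in X + _]scale1r -scalerDl; congr (_ *: _); lia.
    exact: TD.
  by case: c => p; rewrite ?NegzE ?scaleNr; [|apply: TN]; exact: TZn.
have T1 i : T (coroot G (sroot i)).
  rewrite -[coroot _ _]opprK; apply: TN.
  have iG := simple_root_in D i.
  have [t [Et coef]] := root_coefs.
  (* The affine root alpha_i + delta, delta having the coefficients of theta and 1
     at index 0. *)
  pose c j : int := if unlift ord0 j is Some r then t r + (r == i)%:R else 1.
  have ac : acomb c = sroot i.
    rewrite acombE /c unlift_none scale1r; under eq_bigr do rewrite liftK scalerDl.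
    rewrite big_split -Et /= addrAC subrr add0r (bigD1 i) //= eqxx scale1r.
    by rewrite big1 ?addr0 // => j /negbTE ->; rewrite scale0r.
  have c0 j : 0 <= c j.
    rewrite /c; case: unliftP => [r _|//]; rewrite addr_ge0 //.
    by have [e [_ te _]] := coef _ (alpha_max_in D); apply: le_trans (te r).
  have [||s _ sE] := @affroot_word finset.set0 c _ c0; first by rewrite /affroot ac.
    by move=> j; rewrite inE.
  pose Q := ip (sroot i) (sroot i).
  have Q0 : 0 < Q by exact: ip_sroot_gt0.
  pose w := wof (rcons s (lift ord0 i)).
  have wE m x : Q *: val w m x = Q *: x - (m * ip theta theta) *: sroot i.
    rewrite /w val_wof -cats1 word_act_cat; set y := word_act D [:: _] m x.
    have := sE m y; rewrite ac -/Q => ->.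
    have yE : y = reflection G (sroot i) x.
      rewrite /y /= /asigma /apairing aroot_lift (_ : lift ord0 i == ord0 = false).
        by rewrite mulr0n addr0.
      by apply/negbTE; rewrite eq_sym neq_lift.
    rewrite acfE ac /c unlift_none mulr1 yE -ip_reflectionC // reflection_root //.
    rewrite ipNl mulrN [ip (sroot i) x]ipC ip_root // -/Q reflectionE.
    by apply/rowP => r; rewrite !mxE; ring.
  exists w; split=> x.
    apply/rowP => j; have /rowP/(_ j) := wE 0 x.
    by rewrite mul0r scale0r subr0 !mxE => /mulfI -> //; rewrite gt_eqF.
  have QR : (Q%:~R : R) != 0 by rewrite intr_eq0 gt_eqF.
  have fl : Q%:~R *: ((coR (sroot i))^T *m B) =
      (ip theta theta)%:~R *: map_mx intr (sroot i) :> 'rV[R]_l.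
    have two0 : (2 : R) != 0 by rewrite pnatr_eq0.
    apply: (scalerI two0); rewrite scalerA mulrC -scalerA coroot_flat // !scalerA.
    by rewrite ip_bnorm.
  apply: (scalerI QR); rewrite -map_mxZ wE map_mxB !map_mxZ scalerDr; congr (_ + _).
  rewrite map_mxN linearN mulNmx !scalerN; congr (- _).
  by rewrite [RHS]scalerA [_ * n%:~R]mulrC -scalerA fl scalerA -intrM.
have [m ->] := coroot_span xi; elim/big_ind: _ => // i _.
by apply: TZ; exact: T1.
Qed.

(** If the characters agree, then their points in the weight lattice differ by
    n times the image of a lattice vector, that is by a translation of the
    affine Weyl group; but distinct weights of the open alcove lie in distinct
    free orbits. *)
Lemma tchar_sep (z z' : L) w w' : sdom finset.set0 n z -> sdom finset.set0 n z' ->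
  parab fin w -> parab fin w' ->
  (forall y, tchar z (val w 0 y) = tchar z' (val w' 0 y)) -> z = z' /\ w = w'.
Proof.
move=> zI zI' wI wI' E.
pose p := val (winve w) 0 z; pose q := val (winve w') 0 z'.
have Epq y : tchar p y = tchar q y.
  by rewrite -(tchar_wact w) -(tchar_wact w' q) !wactVK E.
have /choice[xi Hxi] : forall j, exists m : int,
    dualB p (delta_mx 0 j) - dualB q (delta_mx 0 j) = n%:~R * m%:~R.
  by move=> j; exact: tchar_eq_int.
have bE x j : dualB x (delta_mx 0 j) = (map_mx intr x *m invmx B) 0 j.
  rewrite /dualB /pairing /bsharp.
  have -> : map_mx intr (delta_mx 0 j) = delta_mx 0 j :> 'rV[R]_l.
    by apply/rowP => i; rewrite !mxE; case: (_ && _).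
  by rewrite -rowE !mxE.
have pq : map_mx intr p = map_mx intr q +
    n%:~R *: ((map_mx intr (\col_j xi j))^T *m B) :> 'rV[R]_l.
  apply: (can_inj (mulmxKV basic_unit)) => /=.
  apply/rowP => j; have := Hxi j; rewrite !bE mulmxDl.
  have -> : (n%:~R *: ((map_mx intr (\col_j xi j))^T *m B)) *m invmx B =
      n%:~R *: (map_mx intr (\col_j xi j))^T :> 'rV[R]_l.
    by rewrite -scalemxAl mulmxK ?basic_unit.
  move=> H; apply/eqP; rewrite -subr_eq0 [X in _ - X]mxE opprD addrA H.
  by rewrite !mxE subrr.
have [t [t0 tE]] := coweight_translation (\col_j xi j).
have tq : val t n q = p.
  apply/rowP => j; have /rowP/(_ j) := tE q; rewrite -pq !mxE => /eqP.
  by rewrite eqr_int => /eqP.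
have W1 : wmul w (wmul t (winve w')) = wone.
  apply: (@parabolic_dominant finset.set0 n z').
  - by rewrite parabolic_set0.
  - exact/sdomP.
  have -> : val (wmul w (wmul t (winve w'))) n z' = z; last exact/sdomP.
  rewrite !wmulE [val (winve w') n z']fin_act; last exact: parabolicV.
  by rewrite -/q tq fin_act // /p wactVK.
have zz : z = z'.
  have : val (wmul w (wmul t (winve w'))) n z' = z.
    rewrite !wmulE [val (winve w') n z']fin_act; last exact: parabolicV.
    by rewrite -/q tq fin_act // /p wactVK.
  by rewrite W1.
split=> //; apply: waff_eqP => m x; rewrite !fin_act //.
have := congr1 (fun v : waff D => val v 0 (val w' 0 x)) W1.
by rewrite !wmulE wactK t0.
Qed.

(** * The S-matrix *)

(** The skew-symmetrized characters: up to normalization, the entries of the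
   S-matrix. *)
Definition wsum (x y : L) : R[i] :=
  \sum_(w \in parab fin) (wsign w)%:~R * tchar x (val w 0 y).

Let fin0 : fin != finset.set0.
Proof. by apply/set0Pn; exists ord0; rewrite inE. Qed.

Let fin_finite := parabolic_finite fin0.

Lemma wsumE x y : wsum x y =
  \sum_(w <- fset_set (parab fin)) (wsign w)%:~R * tchar x (val w 0 y).
Proof. exact: fsbig_finite. Qed.

Lemma wsum_fin u x y : parab fin u -> wsum x (val u 0 y) = (wsign u)%:~R * wsum x y.
Proof.
move=> uI; rewrite /wsum [X in _ = _ * X](reindex_parabolicr _ uI).
rewrite !fsbig_finite // mulr_sumr; apply: eq_bigr => w _.
rewrite wsignM wmulE rmorphM /=; have := wsign_sq u => /(congr1 (fun z => z%:~R : R[i])).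
by rewrite rmorphM /= => E; rewrite [RHS]mulrA [_ * (_ * _)]mulrCA E mulr1.
Qed.

Lemma wsumC x y : wsum x y = wsum y x.
Proof.
rewrite /wsum [LHS]reindex_parabolicV; apply: eq_fsbigr => w _.
by rewrite wsignV -(tchar_wact w) wactVK tcharC.
Qed.

(** The square length 2 of a long root for the dual of B makes the values of the
    character exponentials of integers. *)
Lemma tchar_long b x : b \in roots G -> ip b b = ip theta theta -> tchar x (n *: b) = 1.
Proof.
move=> bG bt; apply: (@tchar_int _ _ <<x, b>>); rewrite dualBZr; congr (_ * _).
have bn : bnorm (coroot G b) = 2.
  have : (ip theta theta)%:~R * bnorm (coroot G b) = (ip theta theta)%:~R * 2.
    by rewrite -{1}bt ip_bnorm // mulrC.
  by apply: mulfI; rewrite intr_eq0 gt_eqF ?ip_root_gt0 ?alpha_max_in.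
have two0 : (2 : R) != 0 by rewrite pnatr_eq0.
by apply: (mulfI two0); rewrite -dualB_root // bn.
Qed.

Lemma wact_root w b : b \in roots G -> val w 0 b \in roots G.
Proof.
have [s ->] := waffP w; elim: s => //= i s IH /IH.
by rewrite asigma0; apply: reflection_in; exact: aroot_in.
Qed.

Lemma wsum_translation x y : wsum x (y + n *: theta) = wsum x y.
Proof.
have tG := alpha_max_in D.
rewrite /wsum; apply: eq_fsbigr => w _; rewrite wactD wactZ0 tcharD.
by rewrite (tchar_long _ (wact_root w tG)) ?mulr1 // ip_wact.
Qed.

(** The affine simple reflection is the reflection in theta followed by the
    translation by n theta, on which tchar is trivial because theta is long. *)
Lemma wsum_waff u x y : wsum x (val u n y) = (wsign u)%:~R * wsum x y.
Proof.
have tG := alpha_max_in D.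
have [s us] := waffP u; rewrite us (wsign_word us) {u us}.
elim: s => [|i s IH]; first by rewrite expr0 mul1r.
rewrite word_act_cons exprS rmorphM -mulrA -IH {IH}; set z := word_act D s n y.
rewrite rmorphN1 mulN1r; case: (unliftP ord0 i) => [j ->|->].
  have jI : parab fin (wof [:: lift ord0 j]).
    by apply: parabolic_wof; rewrite inE eq_sym neq_lift.
  have -> : asigma D (lift ord0 j) n z = val (wof [:: lift ord0 j]) 0 z.
    by rewrite -(fin_act n).
  by rewrite wsum_fin // wsign_of expr1 rmorphN1 mulN1r.
have [u uI uE] := reflection_word tG.
have -> : asigma D ord0 n z = val u 0 z + n *: theta.
  rewrite uE /asigma /apairing aroot0 corootN // eqxx mulr1n scalerN opprK.
  by rewrite scalerDl reflectionE scaleNr addrA.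
by rewrite wsum_translation wsum_fin // (wsign_reflection tG uE) rmorphN1 mulN1r.
Qed.

Lemma antif_complex_eq0 (F : L -> R[i]) :
  (forall u x, F (val u n x) = (wsign u)%:~R * F x) ->
  (forall x, sdom finset.set0 n x -> F x = 0) -> forall x, F x = 0.
Proof.
move=> Fa F0 x; have [w wI wx] := dominant_rep n0 finset.set0 x.
have w0 : ((wsign w)%:~R : R[i]) != 0 by rewrite intr_eq0 wsign_neq0.
apply: (mulfI w0); rewrite -Fa mulr0.
have [|] := boolP (sdom finset.set0 n (val w n x)); first exact: F0.
move=> /sdomP/existsNP[i /not_implyP[iI /negP ix]]; have i0 : apairing D n i (val w n x) = 0.
  by apply/eqP; rewrite eq_le wx // leNgt ix.
have := Fa (wof [:: i]) (val w n x); rewrite wsign_of expr1 rmorphN1 mulN1r.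
have -> : val (wof [:: i]) n (val w n x) = val w n x.
  by rewrite val_wof /= /asigma i0 scale0r subr0.
move=> /eqP; rewrite -addr_eq0 -mulr2n mulrn_eq0 /= => /eqP //.
Qed.

(** In the alcove, the pairings with all the roots are bounded by the one with
    theta. *)
Lemma alcove_finite : finite_set [set x : L | sdom finset.set0 n x]%classic.
Proof.
have tG := alpha_max_in D; have [t [Et coef]] := root_coefs.
pose M := n * ip theta theta.
apply: sub_finite_set (ip_finite_ball hsc (\sum_(b <- roots G) M * M)).
move=> x /sdomP xI /=; rewrite ipE big_seq [leRHS]big_seq.
have xs i : 0 <= ip (sroot i) x.
  rewrite -(pmulr_rge0 _ (_ : 0 < 2)) // ip_sroot mulr_ge0 ?ip_ge0 //.
  have := xI (lift ord0 i); rewrite inE /apairing aroot_lift => /(_ isT).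
  rewrite (_ : lift ord0 i == ord0 = false) ?mulr0n ?addr0; first exact: ltW.
  by apply/negbTE; rewrite eq_sym neq_lift.
have tx : 2 * ip theta x <= M.
  have := xI ord0; rewrite inE /apairing aroot0 corootN // eqxx mulr1n => /(_ isT).
  rewrite addrC subr_gt0 => H; rewrite ipC ip_root // /M ler_pM2r ?ltW //.
  by rewrite ip_root_gt0.
apply: ler_sum => b bG; have [e [Ee te _]] := coef _ bG.
have bx : `|2 * ip b x| <= M.
  rewrite normrM; apply: le_trans tx; rewrite normr_nat ler_pM2l //.
  rewrite Ee Et !ip_suml; apply: le_trans (ler_norm_sum _ _ _) _.
  by apply: ler_sum => i _; rewrite !ipZl normrM (ger0_norm (xs i)) ler_wpM2r.
have Qb := ip_root_gt0 bG; rewrite ipC ip_root // in bx.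
have {}bx : `|<<x, b>>| <= M.
  apply: le_trans bx; rewrite normrM (gtr0_norm Qb) ler_peMr //.
have -> : <<x, b>> * <<x, b>> = `|<<x, b>>| * `|<<x, b>>|.
  by rewrite -normrM ger0_norm // -expr2 sqr_ge0.
by rewrite ler_pM.
Qed.

Definition alcove := fset_set [set x : L | sdom finset.set0 n x]%classic.

Lemma alcoveE x : (x \in alcove) = sdom finset.set0 n x.
Proof.
rewrite in_fset_set; last exact: alcove_finite.
by apply/idP/idP => [/set_mem|xm]; [|apply/mem_set].
Qed.

Lemma level_weightE mu : level_weight D k mu <-> mu + rho D \in alcove.
Proof.
rewrite alcoveE; split=> [H|/sdomP H i iI].
  apply/sdomP => i iI; rewrite apairing_level apairing_rho.
  by have := H i iI; lia.
by have := H i iI; rewrite apairing_level apairing_rho; lia.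
Qed.

Lemma asum_delta_act J u x y : parab J u ->
  asum n J (delta (val u n x)) y = wsign u * asum n J (delta x) y.
Proof.
move=> uJ; rewrite /asum [LHS](reindex_parabolicl _ uJ) [RHS]mulr_fsumr.
apply: eq_fsbigr => w _; rewrite wsignM wmulE !deltaE mulrA; congr (_ * (nat_of_bool _)%:R).
by rewrite (inj_eq (can_inj (wactK u n))).
Qed.

(** The function F is determined up to sign on orbits, vanishes on the walls,
    and each orbit off the walls meets the open alcove once. *)
Lemma antif_delta (F : L -> R[i]) :
  (forall u x, F (val u n x) = (wsign u)%:~R * F x) ->
  forall x, F x = \sum_(z <- alcove) (asum n finset.set0 (delta x) z)%:~R * F z.
Proof.
move=> Fa x; have [w wI wx] := dominant_rep n0 finset.set0 x.
have w0 : ((wsign w)%:~R : R[i]) != 0 by rewrite intr_eq0 wsign_neq0.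
apply: (mulfI w0); rewrite -Fa mulr_sumr.
have -> : \sum_(z <- alcove) (wsign w)%:~R * ((asum n finset.set0 (delta x) z)%:~R * F z) =
   \sum_(z <- alcove) (asum n finset.set0 (delta (val w n x)) z)%:~R * F z.
  by apply: eq_bigr => z _; rewrite asum_delta_act // rmorphM mulrA.
set y := val w n x in wx *; have [yI|yI] := boolP (sdom finset.set0 n y).
  rewrite (bigD1_seq y) ?fset_uniq ?alcoveE //= asum_delta_sdom // eqxx mul1r.
  rewrite big_seq_cond big1 ?addr0 // => z /andP[zI zy].
  have zI' : sdom finset.set0 n z by rewrite -alcoveE.
  by rewrite (asum_delta_sdom yI zI') [y == z]eq_sym (negbTE zy) mul0r.
move/sdomP/existsNP: yI => [i /not_implyP[iI /negP ix]].
have i0 : apairing D n i y = 0 by apply/eqP; rewrite eq_le wx // leNgt ix.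
have iE : val (wof [:: i]) n y = y by rewrite val_wof /= /asigma i0 scale0r subr0.
have iP := parabolic_wof iI.
have -> : F y = 0.
  have := Fa (wof [:: i]) y; rewrite wsign_of expr1 rmorphN1 mulN1r iE.
  by move=> /eqP; rewrite -addr_eq0 -mulr2n mulrn_eq0 /= => /eqP.
rewrite big1 // => z _; rewrite (_ : asum _ _ _ _ = 0) ?mul0r //.
have := asum_delta_act y z iP; rewrite iE wsign_of expr1.
by lia.
Qed.

Lemma sk_aff_wtE x y : sk_aff_wt D n x y = asum n finset.set0 (delta x) y.
Proof.
rewrite /sk_aff_wt -parabolic_set0 /asum [RHS]reindex_parabolicV.
apply: eq_fsbigr => w _; rewrite wsignV deltaE -[LHS]mulr_natr.
congr (_ * (nat_of_bool _)%:R); by apply/eqP/eqP => [<-|->]; rewrite ?wactVK ?wactK.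
Qed.

(** * The fusion ring *)

(** The realization of R(G) in the anti-invariant series. *)
Definition fusion_series (chi : grpring L) : grseries G :=
  conv chi (sk_aff_wt D n (rho D)).

Lemma fusion_seriesE chi : chi \in winv G ->
  fusion_series chi = asum n finset.set0 (conv chi (delta (rho D))).
Proof.
move=> chiW; rewrite /fusion_series asum_conv //; last exact: fin_supp_gr.
by congr conv; apply/funext => x; exact: sk_aff_wtE.
Qed.

Lemma gr_eval_wact (S : comNzRingType) (e : L -> S) (chi : grpring L) w :
  chi \in winv G ->
  \sum_(y <- finsupp chi) (chi y)%:~R * e (val w 0 y) = gr_eval e chi.
Proof.
move=> chiW; pose d := [fset val w 0 y | y in finsupp chi]%fset.
rewrite /gr_eval (@sum_finsupp_eval _ _ _ _ d); last first.
  apply/fsubsetP => y yf; apply/imfsetP; exists (val (winve w) 0 y); last by rewrite wactVK.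
  by rewrite /= mem_finsupp -(winv_wact w _ chiW) wactVK -mem_finsupp.
rewrite /d big_imfset /=; last by move=> y z _ _; exact: (can_inj (wactK w 0)).
by apply: eq_bigr => y _; rewrite winv_wact.
Qed.

Lemma rep_level_winv (chi : grpring L) m : rep_level D fin m chi -> chi \in winv G.
Proof.
move=> H; apply/asboolP => a aG x; have [u uI uE] := reflection_word aG.
by rewrite -uE -(fin_act m) // H.
Qed.

Lemma conv_deltaE (chi : grpring L) x z :
  conv chi (delta x) z = \sum_(y <- finsupp chi) chi y * delta (y + x) z.
Proof.
apply: eq_bigr => y _; rewrite !deltaE; congr (_ * (nat_of_bool _)%:R).
by rewrite eq_sym subr_eq addrC eq_sym.
Qed.

(** Evaluating a character at the point of T attached to x diagonalizes its action
   on the anti-invariant series. *)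
Lemma wsum_fusion_series (chi : grpring L) x : chi \in winv G ->
  \sum_(z <- alcove) (fusion_series chi z)%:~R * wsum x z =
  gr_eval (tchar x) chi * wsum x (rho D).
Proof.
move=> chiW; rewrite fusion_seriesE //.
transitivity (\sum_(y <- finsupp chi) (chi y)%:~R * wsum x (y + rho D)).
  transitivity (\sum_(z <- alcove) \sum_(y <- finsupp chi)
      (chi y)%:~R * ((asum n finset.set0 (delta (y + rho D)) z)%:~R * wsum x z)).
    apply: eq_bigr => z _.
    have -> : conv chi (delta (rho D)) =
        (fun z => \sum_(y <- finsupp chi) chi y * delta (y + rho D) z).
      by apply/funext => u; exact: conv_deltaE.
    rewrite (asum_sum n0); last by move=> y _; exact: fin_supp_gr.
    rewrite rmorph_sum mulr_suml; apply: eq_bigr => y _.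
    by rewrite rmorphM mulrA.
  rewrite exchange_big; apply: eq_bigr => y _ /=; rewrite -mulr_sumr; congr (_ * _).
  exact/esym/(antif_delta (fun u z => wsum_waff u x z)).
under eq_bigr do rewrite wsumE mulr_sumr.
rewrite exchange_big wsumE mulr_sumr; apply: eq_bigr => w _ /=.
rewrite -(gr_eval_wact (tchar x) w chiW) mulr_suml; apply: eq_bigr => y _.
by rewrite wactD tcharD; ring.
Qed.

(** Skew-symmetrize both sides of the Weyl character formula over the affine
    Weyl group, and divide by the order of the finite one. *)
Lemma irr_char_series (chi : grpring L) mu : irr_char D fin k%:Z mu chi ->
  fusion_series chi = sk_aff_wt D n (mu + rho D).
Proof.
move=> [chiI chiE]; have chiW := rep_level_winv chiI.
have o0 : (parabolic_order D fin)%:Z != 0.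
  by rewrite eqz_nat -lt0n parabolic_order_gt0.
have skE0 m x y : sk_wt D fin m x y = asum n fin (delta x) y.
  transitivity (sk_wt D fin n x y); last exact: sk_wt_asum.
  rewrite (sk_wtE m x y fin0) (sk_wtE n x y fin0); apply: eq_fsbigr => w /set_mem wI.
  by rewrite (fin_act m) // (fin_act n).
have skA m x : asum n finset.set0 (sk_wt D fin m x) =
    (fun y => (parabolic_order D fin)%:Z * asum n finset.set0 (delta x) y).
  rewrite -asum_trans ?finset.sub0set //; last exact: fin_supp_gr.
  by congr asum; apply/funext => y; exact: skE0.
apply/funext => z; rewrite sk_aff_wtE; apply: (mulfI o0).
rewrite -(congr1 (@^~ z) (skA (k%:Z + h) (mu + rho D))) -chiE.
have -> : ((chi * sk_wt D fin h (rho D) : grpring L) : L -> int) =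
    conv chi (sk_wt D fin h (rho D)) by apply/funext => y; exact: grME.
rewrite asum_conv //; last exact: fin_supp_gr.
rewrite skA convZr /fusion_series; congr (_ * conv _ _ z).
by apply/funext => y; exact: sk_aff_wtE.
Qed.

(** If this entry vanished then, by wsum_fusion_series for the irreducible
    characters, so would the whole row of the S-matrix, hence a nontrivial
    linear combination of distinct characters. *)
Lemma wsum_rho_neq0 x : x \in alcove -> wsum x (rho D) != 0.
Proof.
move=> xA; apply/eqP => x0.
have W0 y : wsum x y = 0.
  apply: (antif_complex_eq0 (fun u z => wsum_waff u x z)) y => z zA.
  have [chi chiI _] := irr_char_exists k fin0 (z - rho D).
  have := wsum_fusion_series x (rep_level_winv chiI.1).
  rewrite x0 mulr0 (irr_char_series chiI) subrK (bigD1_seq z) ?fset_uniq ?alcoveE //=.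
  rewrite sk_aff_wtE asum_delta_sdom // eqxx mul1r big_seq_cond big1 ?addr0 //.
  move=> u /andP[uA uz]; rewrite sk_aff_wtE asum_delta_sdom //; last by rewrite -alcoveE.
  by rewrite eq_sym (negbTE uz) mul0r.
have := @characters_indep _ _ _ (fun w y => tchar x (val w 0 y)) (fset_set (parab fin))
  (fun w => (wsign w)%:~R) _ _ (fset_uniq _) _ _ wone.
move=> H; have /eqP : ((wsign wone)%:~R : R[i]) = 0.
  apply: H => [w y z|w|w w'|y|].
  - by rewrite wactD tcharD.
  - by rewrite wact00 tchar0.
  - rewrite !in_fset_set // => /set_mem wI /set_mem wI' E.
    by have [] := tchar_sep (z := x) (z' := x) _ _ wI wI' E; rewrite -?alcoveE.
  - by rewrite -wsumE W0.
  - by rewrite in_fset_set //; apply/mem_set; exact: parabolic1.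
by rewrite intr_eq0 (negbTE (wsign_neq0 _)).
Qed.

(** The S-matrix is symmetric, so the hypothesis is a linear relation between
    its rows. Anti-invariance extends it from the alcove to all weights, where
    characters_indep applies. *)
Lemma wsum_indep (c : L -> int) :
  (forall x, x \in alcove -> \sum_(z <- alcove) (c z)%:~R * wsum x z = 0) ->
  forall z, z \in alcove -> c z = 0.
Proof.
move=> Hc z zA; pose F y := \sum_(z <- alcove) (c z)%:~R * wsum z y.
have F0 y : F y = 0.
  apply: antif_complex_eq0 y => [u y|y yA].
    by rewrite /F mulr_sumr; apply: eq_bigr => t _; rewrite wsum_waff mulrCA.
  rewrite -[RHS](Hc y); last by rewrite alcoveE.
  by apply: eq_bigr => t _; rewrite wsumC.
pose r := [seq (t, w) | t <- alcove, w <- fset_set (parab fin)].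
have := @characters_indep _ _ _ (fun p y => tchar p.1 (val p.2 0 y)) r
  (fun p => (c p.1)%:~R * (wsign p.2)%:~R) _ _ _ _ _ (z, wone).
move=> H; have /eqP : ((c z)%:~R * (wsign wone)%:~R : R[i]) = 0.
  apply: H => [p y y'|p|||y|].
  - by rewrite wactD tcharD.
  - by rewrite wact00 tchar0.
  - apply: allpairs_uniq; rewrite ?fset_uniq //.
    by move=> [t w] [t' w'] _ _.
  - move=> p q /allpairsP[[t w] [/= tA wI ->]] /allpairsP[[t' w'] [/= tA' wI' ->]] E.
    move: wI wI'; rewrite !in_fset_set // => /set_mem wI /set_mem wI'.
    rewrite alcoveE in tA; rewrite alcoveE in tA'.
    by have [-> ->] := tchar_sep tA tA' wI wI' E.
  - rewrite big_allpairs_dep -[RHS](F0 y); apply: eq_bigr => t _ /=.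
    by rewrite wsumE mulr_sumr; apply: eq_bigr => w _; rewrite mulrA.
  - apply/allpairsP; exists (z, wone); split=> //=.
    by rewrite in_fset_set //; apply/mem_set; exact: parabolic1.
by rewrite mulf_eq0 !intr_eq0 (negbTE (wsign_neq0 _)) orbF => /eqP.
Qed.

Lemma fusion_idealP (chi : rep_ring G) :
  (chi \in fusion_ideal D k) <-> (forall z, z \in alcove -> gr_eval (tchar z) chi = 0).
Proof.
have E nu : torus_char (fusion_point D k nu) = tchar (nu + rho D).
  by apply/funext => y; exact: fusion_pointE.
split=> [/asboolP H z zA|H].
  have := H (z - rho D); rewrite E subrK; apply.
  by apply/level_weightE; rewrite subrK.
by apply/asboolP => nu /level_weightE nuA; rewrite E H.
Qed.

(** By wsum_fusion_series, because the S-matrix is invertible and has no zero in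
    the column of rho. *)
Lemma fusion_kernel (chi : rep_ring G) :
  (chi \in fusion_ideal D k) <-> fusion_series (rep_val chi) = 0.
Proof.
have cW := rep_winv chi; rewrite fusion_idealP; split=> [H|H z zA].
  have anti : antif n finset.set0 (fusion_series (rep_val chi)).
    by rewrite fusion_seriesE //; exact: asum_antif.
  rewrite (antif_ext n0 anti (@antif0 n finset.set0)) // => z zA.
  apply: (@wsum_indep (fusion_series (rep_val chi))); last by rewrite alcoveE.
  by move=> x xA; rewrite wsum_fusion_series // H // mul0r.
apply: (mulIf (wsum_rho_neq0 zA)); rewrite mul0r -wsum_fusion_series // H.
by rewrite big1 // => x _; rewrite mul0r.
Qed.

Lemma fusion_series_linear (a chi chi' : rep_ring G) :
  fusion_series (rep_val (a * chi + chi')) =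
  a *: fusion_series (rep_val chi) + fusion_series (rep_val chi').
Proof.
apply/funext => x; rewrite /fusion_series.
have -> : rep_val (a * chi + chi') = grM (rep_val a) (rep_val chi) + rep_val chi' by [].
by rewrite Defs.convDl Defs.convA.
Qed.

Definition fusion_iso (r : fusion_ring D k) : grseries G :=
  fusion_series (rep_val (generic_quotient.repr r)).

Lemma fusion_iso_class (chi : rep_ring G) :
  fusion_iso (fusion_class D k chi) = fusion_series (rep_val chi).
Proof.
rewrite /fusion_iso; set chi' := generic_quotient.repr _.
have : chi' - chi \in fusion_ideal D k.
  by rewrite Quotient.idealrBE; apply/eqP; rewrite generic_quotient.reprK.
move=> /fusion_kernel; have -> : chi' - chi = (-1) * chi + chi' by rewrite mulN1r addrC.
by rewrite fusion_series_linear scaleN1r => /eqP; rewrite addrC subr_eq0 => /eqP.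
Qed.

Lemma fusion_class_repr (r : fusion_ring D k) :
  fusion_class D k (generic_quotient.repr r) = r.
Proof. exact: generic_quotient.reprK. Qed.

Lemma fusion_iso_linear : linear fusion_iso.
Proof.
move=> a x y; rewrite -[x in LHS]fusion_class_repr -[y in LHS]fusion_class_repr.
have -> : a *: fusion_class D k (generic_quotient.repr x) +
    fusion_class D k (generic_quotient.repr y) =
    fusion_class D k (a * generic_quotient.repr x + generic_quotient.repr y).
  rewrite -[a *: _]/(fusion_class D k a * _) /fusion_class.
  by rewrite [RHS]rmorphD rmorphM.
by rewrite fusion_iso_class fusion_series_linear.
Qed.

Lemma fusion_iso_additive :
  exists T : {linear fusion_ring D k -> grseries G}, T =1 fusion_iso.
Proof.
by exists (HB.pack_for {linear fusion_ring D k -> grseries G} fusion_iso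
  (GRing.isLinear.Build _ _ _ _ fusion_iso fusion_iso_linear)).
Qed.

Lemma series_mulzE (f : grseries G) (c : int) x : (f *~ c) x = c * f x.
Proof.
have natE (p : nat) : (f *+ p) x = f x *+ p.
  by elim: p => [|p IH]; rewrite ?mulr0n // !mulrS -IH.
case: c => p; first by rewrite -pmulrn natE -mulr_natl natz.
by rewrite NegzE mulrNz mulNr -pmulrn -natz mulr_natl -natE.
Qed.

Lemma sk_aff_wt_antif x : antif n finset.set0 (sk_aff_wt D n x).
Proof.
have -> : sk_aff_wt D n x = asum n finset.set0 (delta x).
  by apply/funext => y; exact: sk_aff_wtE.
exact: asum_antif.
Qed.

Lemma fusion_series_antif (chi : grpring L) : chi \in winv G ->
  antif n finset.set0 (fusion_series chi).
Proof. by move=> chiW; apply: antif_conv => //; exact: sk_aff_wt_antif. Qed.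

Lemma aff_antiinvE (u : grseries G) : aff_antiinv D n u <-> antif n finset.set0 u.
Proof.
split=> H; first by move=> w _ x; exact: H.
by move=> w x; apply: H; rewrite parabolic_set0.
Qed.

Lemma fusion_iso_bij : set_bij setT (aff_antiinv D n) fusion_iso.
Proof.
split=> [r _|r r' _ _ E|u /aff_antiinvE uA].
- by apply/aff_antiinvE; apply: fusion_series_antif; exact: rep_winv.
- rewrite -[r]fusion_class_repr -[r']fusion_class_repr.
  apply/eqP; rewrite -Quotient.idealrBE.
  have -> : generic_quotient.repr r - generic_quotient.repr r' =
      (-1) * generic_quotient.repr r' + generic_quotient.repr r by rewrite mulN1r addrC.
  by apply/fusion_kernel; rewrite fusion_series_linear -/(fusion_iso r') -E scaleN1r addNr.
have /choice[ch chP] : forall x, exists chi : rep_ring G,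
    fusion_series (rep_val chi) = sk_aff_wt D n x.
  move=> x; have [chi chiI _] := irr_char_exists k fin0 (x - rho D).
  by exists (RepRing (rep_level_winv chiI.1)); rewrite /= (irr_char_series chiI) subrK.
have [T TE] := fusion_iso_additive.
pose r : fusion_ring D k := \sum_(z <- alcove) fusion_class D k (ch z) *~ u z.
exists r => //; have rA : antif n finset.set0 (fusion_iso r).
  by apply: fusion_series_antif; exact: rep_winv.
apply: (antif_ext n0 rA uA) => x xA.
have -> : fusion_iso r x = \sum_(z <- alcove) u z * sk_aff_wt D n z x.
  rewrite -TE /r raddf_sum fct_sumE; apply: eq_bigr => z _.
  by rewrite raddfMz /= TE fusion_iso_class chP series_mulzE.
rewrite (bigD1_seq x) ?fset_uniq ?alcoveE //= sk_aff_wtE asum_delta_sdom // eqxx mulr1.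
rewrite big_seq_cond big1 ?addr0 // => z /andP[zA zx].
by rewrite sk_aff_wtE asum_delta_sdom ?(negbTE zx) ?mulr0 // -alcoveE.
Qed.

(** * The augmentation and the resolution *)

Lemma augmentation_antif (c : chain G) : chains D n 0 c ->
  antif n finset.set0 (augmentation D n c).
Proof.
move=> cC; have -> : augmentation D n c = dE n c finset.set0.
  by apply/funext => x; rewrite augmentationE //; move=> I; exact: (chains_antif cC).
exact: dE_antif.
Qed.

Lemma augmentation_linear (a : rep_ring G) (c c' : chain G) :
  chains D n 0 c -> chains D n 0 c' ->
  augmentation D n (a *: c + c') = a *: augmentation D n c + augmentation D n c'.
Proof.
move=> cC cC'; have cI := chains_antif cC; have cI' := chains_antif cC'.
have sI := chains_antif ((chains_submodule n 0).2 a _ _ cC cC').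
apply/funext => x; rewrite augmentationE // dE_linear //.
rewrite -(augmentationE n0 x cI'); congr (_ + _).
by congr (conv _ _ x); apply/funext => y; rewrite augmentationE.
Qed.

(** The summand of C_0 at {0} suffices: an anti-invariant series is a
    combination of the skew-symmetrizations of the weights of the open alcove. *)
Lemma augmentation_surj (u : grseries G) : antif n finset.set0 u ->
  exists2 c : chain G, chains D n 0 c & augmentation D n c = u.
Proof.
move=> uA; pose f : grmod G := \sum_(z <- alcove) sk_wt D fin n z *~ u z.
have fE x : f x = \sum_(z <- alcove) u z * asum n fin (delta z) x.
  by rewrite gr_sumE; apply: eq_bigr => z _; rewrite gr_mulzE sk_wt_asum.
pose c : chain G := [ffun I => if I == fin then f else 0].
have cC : chains D n 0 c.
  move=> I; rewrite ffunE; case: (eqVneq I fin) => [->|If].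
    rewrite cards1 eqxx => w wI x; rewrite !fE mulr_sumr; apply: eq_bigr => z _.
    by rewrite asum_antif // mulrCA.
  by case: ifP => // _ w _ x; rewrite !gr0E mulr0.
exists c => //; apply: (antif_ext n0 (augmentation_antif cC) uA) => x xA.
rewrite /augmentation (bigD1 ord0) //= big1 ?addr0 => [|i i0]; last first.
  have E0 : c [set i]%SET = 0.
    by rewrite ffunE ifN //; apply: contra i0 => /eqP/finset.set1_inj ->.
  rewrite sk_affE // (_ : asum _ _ _ _ = 0) ?div0z // /asum fsbig1 // => w _.
  by rewrite E0 gr0E mulr0.
have -> : c fin = f by rewrite ffunE eqxx.
rewrite sk_affE //.
have -> : asum n finset.set0 f x = (parabolic_order D fin)%:Z * u x.
  have -> : (f : L -> int) = (fun x => \sum_(z <- alcove) u z * asum n fin (delta z) x).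
    by apply/funext => y; exact: fE.
  rewrite (asum_sum n0); last by move=> z _; apply: asum_fin_supp => //; exact: fin_supp_gr.
  rewrite (bigD1_seq x) ?fset_uniq ?alcoveE //= big_seq_cond big1 ?addr0.
    rewrite (asum_trans n0 fin0 (finset.sub0set _) (fin_supp_gr _)).
    by rewrite asum_delta_sdom // eqxx mulr1 mulrC.
  move=> z /andP[zA zx].
  rewrite (asum_trans n0 fin0 (finset.sub0set _) (fin_supp_gr _)).
  by rewrite asum_delta_sdom ?(negbTE zx) ?mulr0 // -alcoveE.
by rewrite mulKz // eqz_nat -lt0n parabolic_order_gt0.
Qed.

Lemma rank_gt0 : (0 < l)%N.
Proof.
have tG := alpha_max_in D; rewrite lt0n; apply/eqP => l0.
have /eqP := root_neq0 tG; apply; apply/rowP => j.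
by have := ltn_ord j; rewrite {2}l0.
Qed.

(** Exactness at C_p is exact_chain. At C_0, the vanishing of eps amounts to that
    of the component of dE at the empty set. *)
Lemma resolution :
  [/\ forall p, submodule (chains D n p : set (chain G)),
      forall p, linear_on (chains D n p.+1) (chains D n p) (boundary D n),
      forall c, chains D n l c -> boundary D n c = 0 -> c = 0,
      forall p, (p.+1 < l)%N ->
        exact_at (chains D n p.+2) (boundary D n) (chains D n p.+1) (boundary D n)
    & exists (theta : {linear fusion_ring D k -> grseries G})
             (eps : chain G -> fusion_ring D k),
        [/\ set_bij setT (aff_antiinv D n) theta,
            forall mu (chi : rep_ring G), level_weight D k mu ->
              irr_char D fin k%:Z mu (rep_val chi) ->
              theta (fusion_class D k chi) = sk_aff_wt D n (mu + rho D),
            forall c, chains D n 0 c -> theta (eps c) = augmentation D n c,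
            linear_on (chains D n 0) setT eps
          & exact_at (chains D n 1) (boundary D n) (chains D n 0) eps /\
            set_surj (chains D n 0) setT eps]].
Proof.
have lin p : linear_on (chains D n p.+1) (chains D n p) (boundary D n).
  split=> [c|a c c' cC cC']; first exact: chains_boundary.
  exact: (boundary_linear n0 a cC cC').
split=> //; first exact: chains_submodule.
- move=> c cC c0; have cC' : chains D n l.-1.+1 c by rewrite (prednK rank_gt0).
  have [b bC <-] := exact_chain n0 cC' (dE_cycle n0 cC' c0).
  have b0 : b = 0 by apply: (@chains_top n b); move: bC; rewrite (prednK rank_gt0).
  have := lin l; rewrite /linear_on => -[_ linl].
  have z0 : chains D n l.+1 (0 : chain G) by exact: (chains_submodule n l.+1).1.
  by have := linl (-1) 0 0 z0 z0; rewrite b0 scaler0 addr0 scaleN1r addNr.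
- move=> p _; apply/seteqP; split=> [c [cC c0]|c [b bC <-]].
    by have [b bC bc] := exact_chain n0 cC (dE_cycle n0 cC c0); exists b.
  split; first exact: (lin p.+1).1.
  apply/ffunP => J; rewrite [RHS]ffunE; have [->|J0] := eqVneq J finset.set0.
    by rewrite boundary0.
  apply/grpringP => x; rewrite boundaryE //; last first.
    by move=> I; exact: (chains_antif (chains_boundary n0 bC)).
  by rewrite dE_boundary ?gr0E // => I; exact: (chains_antif bC).
have [T TE] := fusion_iso_additive.
have Tbij : set_bij setT (aff_antiinv D n) T.
  have TF : (T : fusion_ring D k -> grseries G) = fusion_iso by apply/funext => r; exact: TE.
  by rewrite TF; exact: fusion_iso_bij.
have [Timg Tinj Tsurj] := Tbij.
pose eps c := xget 0 [set r | T r = augmentation D n c]%classic.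
have epsE c : chains D n 0 c -> T (eps c) = augmentation D n c.
  move=> cC; have /aff_antiinvE/Tsurj[r _ rE] := augmentation_antif cC.
  exact: (@xgetPex _ 0 [set r | T r = augmentation D n c]%classic (ex_intro _ r rE)).
have T_inj r r' : T r = T r' -> r = r' by move=> E; apply: Tinj; rewrite ?inE.
exists T, eps; split=> //.
- by move=> mu chi _ chiI; rewrite TE fusion_iso_class; exact: irr_char_series.
- split=> // a c c' cC cC'; apply: T_inj; rewrite linearP !epsE //.
    exact: augmentation_linear.
  exact: (chains_submodule n 0).2.
split.
  apply/seteqP; split=> [c [cC c0]|c [b bC <-]].
    have cI := chains_antif cC.
    have [J x|b bC bc] := exact_chain n0 cC; last by exists b.
    have [->|J0] := eqVneq J finset.set0.
      by rewrite -augmentationE // -epsE // c0 linear0.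
    rewrite /dE big1 // => i iJ; rewrite ind_zero ?mulr0 // => y.
    rewrite (chains_face0 cC) ?gr0E // cardsU1 iJ add1n eqSS cards_eq0.
    exact: J0.
  have dbC := (lin 0%N).1 _ bC; split=> //; apply: T_inj; rewrite linear0 epsE //.
  apply/funext => x; rewrite augmentationE //; last by move=> I; exact: (chains_antif dbC).
  by rewrite dE_boundary // => I; exact: (chains_antif bC).
have Tr r : antif n finset.set0 (T r) by apply/aff_antiinvE; exact: Timg.
move=> r _; have [c cC cE] := augmentation_surj (Tr r).
by exists c => //; apply: T_inj; rewrite epsE.
Qed.

End Fusion.
End Simple.
End LieTheory.

Theorem theorem5p3 (R : realType) (l : nat) (G : root_datum l)
    (hsc : simply_connected G) (hsimple : simple_group G)
    (D : lie_data R G) (k : nat) :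
  let h := (dual_coxeter D)%:Z in
  let n := k%:Z + h in
  let C := chains D n in
  let d := boundary D n in
  (* the quotients by |W_I| are integral *)
  [/\ (forall (I J : {set 'I_l.+1}) (f : grmod G) nu,
         J != finset.set0 -> J \subset I -> antiinv D I n f ->
         (parabolic_order D I %| sk D J n f nu)%Z),
      (forall (I : {set 'I_l.+1}) (f : grmod G) nu,
         I != finset.set0 -> antiinv D I n f ->
         (parabolic_order D I %| sk_aff D n f nu)%Z),
  (* Z[Lambda^*]^{W_I - as} and R(\hat G_I)_k are isomorphic R(G)-modules *)
      (forall I : {set 'I_l.+1}, I != finset.set0 ->
         [/\ submodule (rep_level D I k%:Z),
             submodule (antiinv D I n)
           & exists Theta : grmod G -> grmod G,
               [/\ linear_on (rep_level D I k%:Z) (antiinv D I n) Theta,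
                   set_bij (rep_level D I k%:Z) (antiinv D I n) Theta
                 & forall mu, dominant D I k%:Z mu ->
                     exists2 chi : grmod G, irr_char D I k%:Z mu chi &
                       Theta chi = sk_wt D I n (mu + rho D)]])
  (* the resolution *)
    & [/\ forall p, submodule (C p),
          forall p, linear_on (C p.+1) (C p) d,
          forall c, C l c -> d c = 0 -> c = 0,
          forall p, (p.+1 < l)%N -> exact_at (C p.+2) d (C p.+1) d
        & exists (theta : {linear fusion_ring D k -> grseries G})
                 (eps : chain G -> fusion_ring D k),
            [/\ set_bij setT (aff_antiinv D n) theta,
                forall mu (chi : rep_ring G), level_weight D k mu ->
                  irr_char D [set ord0]%SET k%:Z mu (rep_val chi) ->
                  theta (fusion_class D k chi) = sk_aff_wt D n (mu + rho D),
                forall c, C 0%N c -> theta (eps c) = augmentation D n c,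
                linear_on (C 0%N) setT eps
              & exact_at (C 1%N) d (C 0%N) eps /\
                set_surj (C 0%N) setT eps]]].
Proof.
move=> h n C d; have n0 : 0 < n by rewrite ltr_wpDl ?dual_coxeter_gt0.
have dvd (I J : {set 'I_l.+1}) (f : grmod G) nu : I != finset.set0 ->
    J \subset I -> antiinv D I n f -> (parabolic_order D I %| asum D n J f nu)%Z.
  move=> I0 JI fI; rewrite (asum_ind hsc hsimple n0 I0 JI (fin_supp_gr _) fI).
  exact: dvdz_mulr.
split.
- move=> I J f nu J0 JI fI; rewrite skE //; apply: dvd => //.
  by have /set0Pn[j jJ] := J0; apply/set0Pn; exists j; exact: (fintype.subsetP JI).
- by move=> I f nu I0 fI; rewrite sk_affE //; apply: dvd => //; exact: finset.sub0set.
- move=> I I0; split; first exact: rep_level_submodule.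
    exact: antiinv_submodule.
  exact: rep_level_iso.
exact: (resolution D hsc hsimple k).
Qed.
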